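(* Let $k\in\mathbb{C}$ with $\mathrm{Re}(k)>0$ and let $\gamma_k(|w|)=k\,e^{(1-k)|w|^2}$. The symbol $\gamma_k(|w|)$ is in the class $\mathcal{P}$ if and only if $\mathrm{Re}(k)>1/2$. Correspondingly, the Toeplitz operator $T_{\gamma_k}$ is unitarily equivalent to $\tilde D_{\gamma_k}$ if and only if $\mathrm{Re}(k)>1/2$.
   Context: Notation: $\mathbb{N}=\{0,1,2,\dots\}$; $l^2$ is the Hilbert space of square summable complex sequences $\{\psi_n\}_{n\in\mathbb{N}}$. Let $d\mu(z)=\frac1\pi e^{-|z|^2}d^2z$ on $\mathbb{C}$ ($d^2z$ is Lebesgue measure). The Segal-Bargmann space $F^2(\mathbb{C},d\mu)$ is the subspace of entire functions in $L^2(\mathbb{C},d\mu)$. Put $u_n(z)=z^n/\sqrt{n!}$. The Bargmann projection $P:L^2(\mathbb{C},d\mu)\to F^2(\mathbb{C},d\mu)$ is $(Pg)(z)=\int_{\mathbb{C}}e^{z\overline w}g(w)\,d\mu(w)$. Toeplitz operator: for a measurable symbol $\varphi$ on $\mathbb{C}$, $T_\varphi\psi=P(\varphi\psi)$ with natural domain $\mathrm{Dom}(T_\varphi)=\{\psi\in F^2(\mathbb{C},d\mu):\varphi\psi\in L^2(\mathbb{C},d\mu)\}$. Class $\mathcal{P}$: the set of radial symbols $\varphi(|w|)$ such that $u_n\in\mathrm{Dom}(T_\varphi)$ for all $n\in\mathbb{N}$. Diagonal operator: for a radial symbol $\phi(|w|)$ with $\int_0^\infty|\phi(r)|r^me^{-r^2}dr<\infty$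 for all $m\in\mathbb{N}$, let $\phi_n=\frac{2}{n!}\int_0^\infty\phi(r)r^{2n+1}e^{-r^2}dr$, and let $\tilde D_\phi\{\psi_n\}=\{\phi_n\psi_n\}$ on $l^2$ with domain $\{\{\psi_n\}\in l^2:\{\phi_n\psi_n\}\in l^2\}$. For $\mathrm{Re}(k)>0$ the symbol $\gamma_k$ satisfies this integrability condition and its sequence is $\{k^{-n}\}$.
   Formalization: The unitary equivalence is stated for the closure of T_{γ_k}: with the natural domain, T_{γ_k} is not closed for 1/2 < Re(k) < 1 while D̃_{γ_k} is, so the literal claim fails there; for Re(k) ≥ 1 and Re(k) ≤ 1/2 the closure equals T_{γ_k}. *)

(* Defs.v *)
From HB Require Import structures.
From mathcomp Require Import all_boot all_order all_algebra.
From mathcomp Require Import complex.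
From mathcomp Require Import all_classical all_reals all_analysis.

Set Implicit Arguments.
Unset Strict Implicit.
Unset Printing Implicit Defensive.

Import Order.TTheory GRing.Theory Num.Theory.
Import numFieldNormedType.Exports.
Import ComplexField.Normc.

Local Open Scope classical_set_scope.
Local Open Scope ring_scope.
Local Open Scope complex_scope.

(* A Hilbert space is represented by an ambient complex vector space V, the
   set S of its elements and its inner product ip, used on S only. An unbounded
   operator is represented by its graph, a subset of V * V. *)
Section Operators.
Variable R : realType.
Local Notation C := R[i].

Definition is_unitary (V1 V2 : lmodType C)
    (S1 : set V1) (ip1 : V1 -> V1 -> C) (S2 : set V2) (ip2 : V2 -> V2 -> C)
    (U : V1 -> V2) : Prop :=
  [/\ forall x, S1 x -> S2 (U x),
      forall (a : C) x y, S1 x -> S1 y -> U (a *: x + y) = a *: U x + U y,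
      forall x y, S1 x -> S1 y -> ip2 (U x) (U y) = ip1 x y &
      forall y, S2 y -> exists2 x, S1 x & U x = y].

Definition graph (V : Type) (D : set V) (A : V -> V) : set (V * V) :=
  [set p | D p.1 /\ p.2 = A p.1].

(* For graphs of operators A and B, the equivalence below says that
   U Dom(A) = Dom(B) and U A = B U on Dom(A). *)
Definition unitarily_equivalent (V1 V2 : lmodType C)
    (S1 : set V1) (ip1 : V1 -> V1 -> C) (G1 : set (V1 * V1))
    (S2 : set V2) (ip2 : V2 -> V2 -> C) (G2 : set (V2 * V2)) : Prop :=
  exists2 U : V1 -> V2, is_unitary S1 ip1 S2 ip2 U &
    forall x y, S1 x -> S1 y -> (G1 (x, y) <-> G2 (U x, U y)).

(* The norm closure of G in S x S; if G is the graph of a closable operator,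
   this is the graph of its closure. *)
Definition graph_closure (V : lmodType C) (S : set V) (ip : V -> V -> C)
    (G : set (V * V)) : set (V * V) :=
  [set p | [/\ S p.1, S p.2 & forall e : R, 0 < e -> exists q, [/\ G q,
      complex.Re (ip (p.1 - q.1) (p.1 - q.1)) < e &
      complex.Re (ip (p.2 - q.2) (p.2 - q.2)) < e]]].

End Operators.

Section SegalBargmann.
Variable R : realType.
Local Notation C := R[i].

Definition expC (z : C) : C :=
  (expR (complex.Re z) * cos (complex.Im z)) +i*
  (expR (complex.Re z) * sin (complex.Im z)).

Definition ofR2 (p : R * R) : C := p.1 +i* p.2.

Local Notation leb2 := (@lebesgue_measure R \x @lebesgue_measure R)%E.

Definition measurable_cfun (g : C -> C) : Prop :=
  measurable_fun [set: measurableTypeR R * measurableTypeR R]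
    (fun p => complex.Re (g (ofR2 p))) /\
  measurable_fun [set: measurableTypeR R * measurableTypeR R]
    (fun p => complex.Im (g (ofR2 p))).

(* the density of d mu with respect to the Lebesgue measure d^2 z *)
Definition gauss (z : C) : R := pi^-1 * expR (- normc z ^+ 2).

Definition int_mu (g : C -> C) : C :=
  (\int[leb2]_p (complex.Re (g (ofR2 p)) * gauss (ofR2 p))) +i*
  (\int[leb2]_p (complex.Im (g (ofR2 p)) * gauss (ofR2 p))).

Definition L2 : set (C -> C^o) :=
  [set g | measurable_cfun g /\
    (\int[leb2]_p (normc (g (ofR2 p)) ^+ 2 * gauss (ofR2 p))%:E < +oo)%E].

Definition ip_mu (f g : C -> C^o) : C := int_mu (fun z => f z * conjc (g z)).

(* derivable over the field C, i.e. complex differentiability *)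
Definition entire (f : C -> C^o) : Prop :=
  forall z : C^o, derivable (f : C^o -> C^o) z 1.

(* Entire functions that agree almost everywhere are equal, so that no quotient
   is needed for ip_mu to be an inner product on F2. *)
Definition F2 : set (C -> C^o) := [set f | entire f /\ L2 f].

Definition basis_u (n : nat) : C -> C^o :=
  fun z => z ^+ n / (Num.sqrt (n`!%:R : R))%:C.

Definition bargmann_proj (g : C -> C^o) : C -> C^o :=
  fun z => int_mu (fun w => expC (z * conjc w) * g w).

Definition toeplitz_dom (phi : C -> C) : set (C -> C^o) :=
  [set psi | F2 psi /\ L2 (fun w => phi w * psi w)].

Definition toeplitz (phi : C -> C) (psi : C -> C^o) : C -> C^o :=
  bargmann_proj (fun w => phi w * psi w).

Definition radial (phi : R -> C) : C -> C := fun w => phi (normc w).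

Definition classP (phi : R -> C) : Prop :=
  measurable_cfun (radial phi) /\ forall n, toeplitz_dom (radial phi) (basis_u n).

Definition l2 : set (nat -> C^o) :=
  [set x | cvgn (series (fun n => normc (x n) ^+ 2))].

Definition ip_l2 (x y : nat -> C^o) : C :=
  limn (series (fun n => complex.Re (x n * conjc (y n)))) +i*
  limn (series (fun n => complex.Im (x n * conjc (y n)))).

Definition diag_coef (phi : R -> C) (n : nat) : C :=
  (2 / n`!%:R : R)%:C *
  ((\int[@lebesgue_measure R]_(r in `]0, +oo[)
      (complex.Re (phi r) * (r ^+ n.*2.+1 * expR (- r ^+ 2)))) +i*
   (\int[@lebesgue_measure R]_(r in `]0, +oo[)
      (complex.Im (phi r) * (r ^+ n.*2.+1 * expR (- r ^+ 2))))).

Definition diag_op (phi : R -> C) (x : nat -> C^o) : nat -> C^o :=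
  fun n => diag_coef phi n * x n.

Definition diag_dom (phi : R -> C) : set (nat -> C^o) :=
  [set x | l2 x /\ l2 (diag_op phi x)].

Definition gamma_symbol (k : C) (r : R) : C := k * expC ((1 - k) * (r ^+ 2)%:C).

(* For 1/2 < Re k < 1 the set toeplitz_dom is strictly smaller than the domain
   of the diagonal operator: with psi = sum_n psi_n (basis_u n), it is given by
     sum_n |psi_n|^2 (2 Re k - 1)^(-n) < oo, against
     sum_n |psi_n|^2 |k|^(-2 n) < oo for the diagonal operator.
   The two operators agree on the polynomials, a core for the diagonal one.
   As usual for unbounded operators, the Toeplitz operator is therefore
   identified with its closure when it is compared with the diagonal operator,
   which is already closed. *)
Definition toeplitz_closure (phi : R -> C) :
    set ((C -> C^o) * (C -> C^o)) :=
  graph_closure F2 ip_mu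
    (graph (toeplitz_dom (radial phi)) (toeplitz (radial phi))).

Definition diag_graph (phi : R -> C) : set ((nat -> C^o) * (nat -> C^o)) :=
  graph (diag_dom phi) (diag_op phi).

End SegalBargmann.

(* Main.v *)
Require Import Defs.
From HB Require Import structures.
From mathcomp Require Import all_boot all_order all_algebra.
From mathcomp Require Import complex.
From mathcomp Require Import all_classical all_reals all_analysis.
From mathcomp Require Import measurable_realfun ring lra.

(** The proof identifies F2 with l2 through the coefficients
    [coef f n = <f, u_n>] and compares the operators there.

    Geometry of F2. Averages of an entire function over circles are computed by
    Goursat's theorem in logarithmic coordinates: the integral of
    f(e^(it) w) e^(-int) over [0, 2 pi] is a multiple of w^n ([circle_coef]), and
    equals 2 pi f(0) for n = 0 ([circle_mean]). Since rotations preserve area, an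
    area integral may be averaged over angles first, so the integral of f(w)
    conj(w)^n H(|w|) involves only the n-th Taylor coefficient of f and a radial
    integral ([aint_circle_coef]). This gives the orthonormality of the u_n and
    the mean value property for radial weights ([mean_value]), and the latter
    yields the reproducing property of the kernel e^(z conj w)
    ([reproducing]). As the exponential series expands that kernel in the basis,
    the Bargmann projection of g is the sum of the <g, u_n> u_n
    ([bargmann_projE]). Hence the functions in F2 are exactly the sums of
    x_n u_n with x in l2, and [coef] is unitary from F2 onto l2
    ([is_unitary_coef]).

    The case Re k > 1/2. The weight |gamma_k|^2 e^(-|w|^2) is a multiple of the
    Gaussian e^(-(2 Re k - 1)|w|^2), so the domain of the Toeplitz operator
    contains all polynomials. The same averaging argument shows that the operator
    multiplies the n-th coefficient by the n-th entry of the diagonal operator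
    ([coef_gamma]). This relation passes to the closure because coefficients are
    continuous, and conversely an element of the diagonal graph is approximated
    by its truncations, which are images of polynomials ([closure_diag]).

    The case Re k <= 1/2. The weight is now bounded below by a positive constant,
    so a function f in the domain is square integrable for the area. Then f^2 is
    entire and integrable, and the mean value property makes each value f(z)^2 an
    integrable constant on a plane of infinite area: f = 0
    ([toeplitz_dom_eq0]). So the basis functions are not in the domain, and the
    closure of the Toeplitz operator is defined at zero only. It cannot be
    equivalent to the diagonal operator, whose domain contains the first basis
    vector ([equivalent_gamma]). *)

Set Implicit Arguments.
Unset Strict Implicit.
Unset Printing Implicit Defensive.

Import Order.TTheory GRing.Theory Num.Theory.
Import numFieldNormedType.Exports.
Import ComplexField.Normc.

Local Open Scope classical_set_scope.
Local Open Scope ring_scope.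
Local Open Scope complex_scope.

(** * Complex numbers and the exponential *)

Section ComplexBasics.
Variable R : realType.
Local Notation C := R[i].
Implicit Types (z w h : C) (r : R).

Lemma complexReD z w : complex.Re (z + w) = complex.Re z + complex.Re w.
Proof. by case: z w => [a b] [c d]. Qed.
Lemma complexImD z w : complex.Im (z + w) = complex.Im z + complex.Im w.
Proof. by case: z w => [a b] [c d]. Qed.
Lemma complexReN z : complex.Re (- z) = - complex.Re z.
Proof. by case: z. Qed.
Lemma complexImN z : complex.Im (- z) = - complex.Im z.
Proof. by case: z. Qed.
Lemma complexReM z w : complex.Re (z * w) =
  complex.Re z * complex.Re w - complex.Im z * complex.Im w.
Proof. by case: z w => [a b] [c d]. Qed.
Lemma complexImM z w : complex.Im (z * w) =
  complex.Re z * complex.Im w + complex.Im z * complex.Re w.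
Proof. by case: z w => [a b] [c d]. Qed.
Lemma Re_conj z : complex.Re (conjc z) = complex.Re z.
Proof. by case: z. Qed.
Lemma Im_conj z : complex.Im (conjc z) = - complex.Im z.
Proof. by case: z. Qed.

Definition ReImE := (complexReD, complexImD, complexReN, complexImN,
  complexReM, complexImM, Re_conj, Im_conj).

Lemma complex_ext z w :
  complex.Re z = complex.Re w -> complex.Im z = complex.Im w -> z = w.
Proof. by case: z w => [a b] [c d] /= -> ->. Qed.

Lemma normc_sqrtE z :
  normc z = Num.sqrt (complex.Re z ^+ 2 + complex.Im z ^+ 2).
Proof. by case: z. Qed.

Lemma norm_normc z : `|z| = (normc z)%:C.
Proof. by case: z. Qed.

Lemma sqr_normcE z : normc z ^+ 2 = complex.Re z ^+ 2 + complex.Im z ^+ 2.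
Proof. by rewrite normc_sqrtE sqr_sqrtr// addr_ge0// sqr_ge0. Qed.

Lemma normc_ge0 z : 0 <= normc z.
Proof. by rewrite normc_sqrtE sqrtr_ge0. Qed.

Lemma ler_normcD z w : normc (z + w) <= normc z + normc w.
Proof. by have := ler_normD z w; rewrite !norm_normc -raddfD lecR. Qed.

Lemma normcN z : normc (- z) = normc z.
Proof. by rewrite !normc_sqrtE complexReN complexImN !sqrrN. Qed.

Lemma normcJ z : normc (conjc z) = normc z.
Proof. by rewrite !normc_sqrtE Re_conj Im_conj sqrrN. Qed.

Lemma normcX z n : normc (z ^+ n) = normc z ^+ n.
Proof. by elim: n => [|n ih]; rewrite ?expr0 ?normc1// !exprS normcM ih. Qed.

Lemma normc_real r : normc r%:C = `|r|.
Proof. by rewrite normc_sqrtE /= expr0n addr0 sqrtr_sqr. Qed.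

Lemma normcB z w : normc (z - w) = normc (w - z).
Proof. by rewrite -normcN opprB. Qed.

Lemma normc_eq0 z : (normc z == 0) = (z == 0).
Proof.
by apply/eqP/eqP => [/eq0_normc//|->]; rewrite normc0.
Qed.

Lemma Re_le_normc z : `|complex.Re z| <= normc z.
Proof.
by rewrite normc_sqrtE -sqrtr_sqr ler_sqrt ?addr_ge0 ?sqr_ge0// lerDl sqr_ge0.
Qed.

Lemma Im_le_normc z : `|complex.Im z| <= normc z.
Proof.
by rewrite normc_sqrtE -sqrtr_sqr ler_sqrt ?addr_ge0 ?sqr_ge0// lerDr sqr_ge0.
Qed.

Lemma normc_le_ReIm z : normc z <= `|complex.Re z| + `|complex.Im z|.
Proof.
rewrite {1}(_ : z = (complex.Re z)%:C + 'i%C * (complex.Im z)%:C); last first.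
  exact: complexE.
apply: le_trans (ler_normcD _ _) _.
rewrite normcM !normc_real (_ : normc 'i%C = 1) ?mul1r//.
by rewrite /= expr0n expr1n add0r sqrtr1.
Qed.

Lemma conjc_mul z w : conjc (z * w) = conjc z * conjc w.
Proof. exact: rmorphM. Qed.

Lemma conjcX z n : conjc (z ^+ n) = conjc z ^+ n.
Proof. by elim: n => [|n ih]; rewrite ?expr0 ?conjc1// !exprS conjc_mul ih. Qed.

Lemma mulcJ z : z * conjc z = (normc z ^+ 2)%:C.
Proof. by apply: complex_ext; rewrite !ReImE ?sqr_normcE /=; ring. Qed.

End ComplexBasics.

Section Exponential.
Variable R : realType.
Local Notation C := R[i].
Implicit Types (z w h : C) (r : R).

Lemma expCD z w : expC (z + w) = expC z * expC w.
Proof.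
apply: complex_ext; rewrite /expC !ReImE /= expRD ?cosD ?sinD; ring.
Qed.

Lemma expC0 : expC (0 : C) = 1.
Proof. by rewrite /expC /= expR0 cos0 sin0 mulr1 mulr0. Qed.

Lemma expC_real r : expC (r%:C) = (expR r)%:C.
Proof. by rewrite /expC /= cos0 sin0 mulr1 mulr0. Qed.

Lemma expCNK z : expC z * expC (- z) = 1.
Proof. by rewrite -expCD subrr expC0. Qed.

Lemma expC_neq0 z : expC z != 0.
Proof.
by apply/eqP => e; have /eqP := expCNK z; rewrite e mul0r eq_sym oner_eq0.
Qed.

Lemma expCN z : expC (- z) = (expC z)^-1.
Proof. by apply: (mulfI (expC_neq0 z)); rewrite expCNK mulfV ?expC_neq0. Qed.

Lemma expC_natmul z n : expC (z *+ n) = expC z ^+ n.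
Proof.
by elim: n => [|n ih]; rewrite ?mulr0n ?expC0// mulrS expCD ih exprS.
Qed.

Lemma normc_expC z : normc (expC z) = expR (complex.Re z).
Proof.
rewrite normc_sqrtE /expC/= !exprMn -mulrDr cos2Dsin2 mulr1 sqrtr_sqr ger0_norm//.
Qed.

Lemma conj_expC z : conjc (expC z) = expC (conjc z).
Proof.
by apply: complex_ext; rewrite /expC !ReImE /= ?cosN ?sinN// mulrN.
Qed.

Lemma expC_2pi z : expC (z + 0 +i* (pi *+ 2)) = expC z.
Proof.
rewrite expCD /(expC (0 +i* _))/= expR0 cos2pi sin2pi mulr0 mulr1.
by rewrite (_ : 1 +i* 0 = 1 :> C)// mulr1.
Qed.

(** The witness is the logarithm of the modulus plus i times the argument,
    taken as an arc cosine or as its reflection, according to the sign of the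
    imaginary part. *)
Lemma expC_surj w : w != 0 -> exists2 z, expC z = w & 0 <= complex.Im z <= pi *+ 2.
Proof.
move=> w0; have n0 : 0 < normc w by rewrite lt0r normc_eq0 w0 normc_ge0.
set a := complex.Re w / normc w; set b := complex.Im w / normc w.
have ab : a ^+ 2 + b ^+ 2 = 1.
  rewrite /a /b !exprMn -mulrDl -sqr_normcE exprVn mulfV//.
  by rewrite expf_neq0// gt_eqF.
have aN : -1 <= a <= 1.
  by rewrite -ler_norml -(@ler_sqr _ _ 1) ?nnegrE// expr1n -ab real_normK ?num_real// lerDl sqr_ge0.
have sa : sin (acos a) = `|b|.
  by rewrite sin_acos// -ab addrAC subrr add0r sqrtr_sqr.
have [b0|b0] := leP 0 b.
- exists (ln (normc w) +i* acos a).
    rewrite /expC /= lnK ?posrE// acosK ?in_itv//= sa ger0_norm//.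
    by apply: complex_ext => /=; rewrite mulrC mulfVK// gt_eqF.
  by rewrite /= acos_ge0//= (le_trans (acos_lepi _))// mulr2n lerDl pi_ge0.
- exists (ln (normc w) +i* (pi *+ 2 - acos a)).
    rewrite /expC /= lnK ?posrE//.
    rewrite cosB sinB cos2pi sin2pi !mul1r !mul0r addr0 sub0r acosK ?in_itv//= sa.
    rewrite ltr0_norm// opprK.
    by apply: complex_ext => /=; rewrite mulrC mulfVK// gt_eqF.
  rewrite /= subr_ge0 (le_trans (acos_lepi _))//= ?mulr2n ?lerDl ?pi_ge0//.
  by rewrite lerBlDr lerDl acos_ge0.
Qed.

End Exponential.

(** * Complex differentiability *)

Section ComplexDerivative.

Lemma is_deriveP (K : numFieldType) (f : K^o -> K^o) (x l : K) :
  is_derive (x : K^o) 1 f l <->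
  (forall e : K, 0 < e -> exists2 d : K, 0 < d &
     forall h, `|h| < d -> `|f (x + h) - f x - l * h| <= e * `|h|).
Proof.
split=> [df e e0|H].
- have [dfx lE] := df.
  have := dfx; rewrite /derivable => /cvg_ex[l' cl].
  have ll : l' = l by rewrite -lE /derive; apply/esym/cvg_lim.
  rewrite {}ll in cl.
  move/cvgrPdist_le: cl => /(_ e e0).
  rewrite near_withinE => -[d /= d0 dH].
  exists d => // h hd; have [->|h0] := eqVneq h 0.
    by rewrite addr0 subrr mulr0 subrr !normr0 mulr0.
  have := dH h; rewrite /= sub0r normrN => /(_ hd h0).
  rewrite [h *: 1]mulr1 /= => {}dH.
  rewrite (_ : _ - _ = - (h * (l - h^-1 * (f (h + x) - f x)))); last first.
    by rewrite (addrC h); field.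
  by rewrite normrN normrM mulrC ler_wpM2r.
- have cl : h^-1 *: ((f \o shift x) (h *: (1 : K^o)) - f x) @[h --> 0^'] --> (l : K^o).
    apply/cvgrPdist_le => e e0.
    have [d d0 dH] := H e e0.
    rewrite near_withinE; exists d => //= h /=; rewrite sub0r normrN => hd h0.
    have nh : 0 < `|h| by rewrite normr_gt0.
    rewrite -(ler_pM2r nh) -normrM.
    apply: le_trans (dH h hd).
    rewrite [h *: 1]mulr1 /= (addrC x) le_eqVlt; apply/orP; left; apply/eqP.
    rewrite -normrN; congr `|_|.
    by rewrite /GRing.scale/=; field.
  apply: DeriveDef; first by apply/cvg_ex; exists l.
  exact/cvg_lim.
Qed.

Variable R : realType.
Local Notation C := R[i].
Implicit Types (z w h : C).

(** Differentiability over the complex field, but with real epsilon and delta: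
    the estimates below compare moduli, which are real. *)
Definition cdiff (f : C -> C) z (l : C) := forall e : R, 0 < e ->
  exists2 d : R, 0 < d & forall h, normc h < d ->
    normc (f (z + h) - f z - l * h) <= e * normc h.

Lemma cdiffP (f : C -> C) z l : is_derive (z : C^o) 1 (f : C^o -> C^o) l <-> cdiff f z l.
Proof.
rewrite is_deriveP; split => H e e0.
- have [|d d0 dH] := H (e%:C); first by rewrite ltcR.
  have := d0; rewrite ltcE => /andP[/eqP d1 d2].
  exists (complex.Re d) => // h hd.
  have /dH : `|h| < d by rewrite norm_normc ltcE/= d1 eqxx.
  by rewrite !norm_normc -rmorphM /= lecR.
- have := e0; rewrite ltcE => /andP[/eqP e1 e2].
  have [d d0 dH] := H _ e2.
  exists d%:C => [|h]; first by rewrite ltcR.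
  rewrite !norm_normc ltcR => /dH.
  rewrite (_ : e = (complex.Re e)%:C) -?rmorphM ?lecR//.
  by apply: complex_ext.
Qed.

Lemma entireP (f : C -> C^o) : entire f <-> forall z, exists l, cdiff f z l.
Proof.
split=> H z.
- exists ('D_1 (f : C^o -> C^o) (z : C^o)).
  by apply/cdiffP/derivableP; exact: H.
- by have [l /cdiffP[]] := H z.
Qed.

Lemma entire_comp (f g : C -> C^o) : entire f -> entire g -> entire (f \o g).
Proof.
move=> ef eg z; apply/derivable1_diffP.
apply: (@differentiable_comp _ _ _ _ (g : C^o -> C^o) (f : C^o -> C^o)).
- exact/derivable1_diffP/eg.
- exact/derivable1_diffP/ef.
Qed.

Lemma entireM (f g : C -> C^o) : entire f -> entire g -> entire (fun z => f z * g z).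
Proof. by move=> ef eg z; exact: (derivableM (ef z) (eg z)). Qed.

Lemma entireD (f g : C -> C^o) : entire f -> entire g -> entire (fun z => f z + g z).
Proof. by move=> ef eg z; exact: (derivableD (ef z) (eg z)). Qed.

Lemma entire_cst (c : C) : entire (fun=> c : C^o).
Proof. by move=> z; exact: derivable_cst. Qed.

Lemma entire_id : entire (fun z => z : C^o).
Proof. by move=> z; exact: derivable_id. Qed.

Lemma entireX n : entire (fun z => z ^+ n : C^o).
Proof.
elim: n => [|n ih].
  by under [X in entire X]eq_fun do rewrite expr0; exact: entire_cst.
by under [X in entire X]eq_fun do rewrite exprS; exact: (entireM entire_id ih).
Qed.

Lemma entire_affine (a b : C) : entire (fun z => a + b * z : C^o).
Proof.
apply: (@entireD (fun=> a) (fun z => b * z)); first exact: entire_cst.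
by apply: (@entireM (fun=> b) (fun z => z)); [exact: entire_cst|exact: entire_id].
Qed.

Lemma cdiff_continuous (f : C -> C) z l : cdiff f z l ->
  forall e : R, 0 < e -> exists2 d : R, 0 < d & forall h, normc h < d ->
    normc (f (z + h) - f z) <= e.
Proof.
move=> /(_ 1 ltr01)[d d0 dH] e e0.
have M0 : 0 < 1 + normc l by rewrite ltr_pwDl// normc_ge0.
exists (Num.min d (e / (1 + normc l))); first by rewrite lt_min d0 divr_gt0.
move=> h; rewrite lt_min => /andP[hd he].
have := dH h hd; rewrite mul1r => H.
rewrite -(subrK (l * h) (f (z + h) - f z)).
apply: le_trans (ler_normcD _ _) _; rewrite normcM.
rewrite ltr_pdivlMr// in he.
by have := ltW he; rewrite mulrDr mulr1 (mulrC (normc h)) => h2; lra.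
Qed.

End ComplexDerivative.

Section ExpDerivative.
Variable R : realType.
Local Notation C := R[i].
Implicit Types (z w h : C).

(** This reduces to the derivatives at zero of the real exponential, cosine and
    sine, by splitting the remainder as
    (e^x - 1 - x) + i (e^x - 1) y + e^x ((cos y - 1) + i (sin y - y)). *)
Lemma cdiff_expC0 : cdiff (@expC R) 0 1.
Proof.
move=> e e0; pose e1 := Num.min 1 (e / 6).
have e10 : 0 < e1 by rewrite lt_min ltr01 divr_gt0.
have e11 : e1 <= 1 by rewrite ge_min lexx.
have e1e : 6 * e1 <= e.
  rewrite mulrC -ler_pdivlMr//.
  by rewrite /e1 ge_min lexx orbT.
have dE := is_derive_expR (0 : R); rewrite expR0 in dE.
have dC := is_derive_cos (0 : R); rewrite sin0 oppr0 in dC.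
have dS := is_derive_sin (0 : R); rewrite cos0 in dS.
have [d1 d10 HE] := (is_deriveP _ _ _).1 dE e1 e10.
have [d2 d20 HC] := (is_deriveP _ _ _).1 dC e1 e10.
have [d3 d30 HS] := (is_deriveP _ _ _).1 dS e1 e10.
exists (Num.min (e1 / 2) (Num.min d1 (Num.min d2 d3))).
  by rewrite !lt_min d10 d20 d30 divr_gt0.
move=> h; rewrite !lt_min => /and4P[h0 h1 h2 h3].
rewrite add0r expC0 mul1r.
set x := complex.Re h; set y := complex.Im h.
have xh : `|x| <= normc h := Re_le_normc h.
have yh : `|y| <= normc h := Im_le_normc h.
have := HE x (le_lt_trans xh h1); rewrite add0r expR0 mul1r => A.
have := HC y (le_lt_trans yh h2); rewrite add0r cos0 mul0r subr0 => B1.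
have := HS y (le_lt_trans yh h3); rewrite add0r sin0 mul1r subr0 => B2.
have e2x : `|expR x - 1| <= e1.
  rewrite -(subrK x (expR x - 1)); apply: le_trans (ler_normD _ _) _.
  apply: (@le_trans _ _ (`|x| + `|x|)).
    by rewrite lerD2r (le_trans A)// ler_piMl.
  by have := ltW h0; lra.
have ex2 : expR x <= 2.
  by have := le_trans (ler_norm _) e2x; lra.
rewrite (_ : _ - 1 - h = (expR x - 1 - x)%:C + (0 +i* ((expR x - 1) * y)) +
   (expR x)%:C * ((cos y - 1) +i* (sin y - y))); last first.
  by apply: complex_ext; rewrite !ReImE /expC /= -/x -/y; ring.
apply: le_trans (ler_normcD _ _) _.
apply: le_trans (lerD (ler_normcD _ _) (lexx _)) _.
rewrite normc_real normcM normc_real (ger0_norm (expR_ge0 x)).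
have n1 : normc (0 +i* ((expR x - 1) * y)) <= e1 * `|y|.
  apply: le_trans (normc_le_ReIm _) _.
  by rewrite /= normr0 add0r normrM ler_wpM2r.
have n2 : normc ((cos y - 1) +i* (sin y - y)) <= e1 * `|y| + e1 * `|y|.
  by apply: le_trans (normc_le_ReIm _) _; rewrite /= lerD.
have n3 : expR x * normc ((cos y - 1) +i* (sin y - y)) <= 2 * (e1 * `|y| + e1 * `|y|).
  by rewrite ler_pM ?expR_ge0 ?normc_ge0.
have e1x : e1 * `|x| <= e1 * normc h by rewrite ler_pM2l.
have e1y : e1 * `|y| <= e1 * normc h by rewrite ler_pM2l.
have : 6 * e1 * normc h <= e * normc h by rewrite ler_wpM2r// normc_ge0.
move=> e6; apply: (le_trans _ e6).
apply: le_trans (lerD (lerD A n1) n3) _.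
lra.
Qed.

Lemma cdiff_expC z : cdiff (@expC R) z (expC z).
Proof.
move=> e e0; have [d d0 H] := cdiff_expC0 (divr_gt0 e0 (expR_gt0 (complex.Re z))).
exists d => // h hd; have := H h hd; rewrite add0r expC0 mul1r => {}H.
rewrite expCD (_ : _ - _ - _ = expC z * (expC h - 1 - h)); last by ring.
rewrite normcM normc_expC -ler_pdivlMl ?expR_gt0//.
by apply: le_trans H _; rewrite [e / _]mulrC mulrA.
Qed.

Lemma entire_expC : entire (@expC R : C -> C^o).
Proof. by apply/entireP => z; exists (expC z); exact: cdiff_expC. Qed.

(** A complex function whose derivative vanishes is constant along every
    segment through the origin, by the real statement applied to its real and
    imaginary parts. *)
Lemma cdiff0_cst (f : C -> C) : (forall z, cdiff f z 0) -> forall z, f z = f 0.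
Proof.
move=> f0 z.
have key (p : C -> R) : (forall w, `|p w| <= normc w) -> (forall w w', p (w - w') = p w - p w') ->
    forall s t : R, p (f (s%:C * z)) = p (f (t%:C * z)).
  move=> pn pB s t; apply: (@is_derive_0_is_cst _ (fun t => p (f (t%:C * z)))) => {s t} t.
  apply/(is_deriveP (fun t => p (f (t%:C * z)))) => e e0.
  have N0 : 0 < normc z + 1 by rewrite ltr_wpDl// normc_ge0.
  have [d d0 H] := f0 (t%:C * z) (e / (normc z + 1)) (divr_gt0 e0 N0).
  exists (d / (normc z + 1)) => [|h]; first by rewrite divr_gt0.
  rewrite ltr_pdivlMr// => hd.
  have hz : normc (h%:C * z) < d.
    by apply: le_lt_trans hd; rewrite normcM normc_real ler_wpM2l// lerDl.
  rewrite mul0r subr0 -pB; apply: le_trans (pn _) _.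
  have := H _ hz; rewrite mul0r subr0 -mulrDl -rmorphD => /le_trans; apply.
  rewrite normcM normc_real mulrAC mulrA -mulrA ler_piMr ?mulr_ge0 ?(ltW e0)//.
  by rewrite ler_pdivrMr// mul1r lerDl.
have := key _ (@Re_le_normc R) _ 1 0; have := key _ (@Im_le_normc R) _ 1 0.
rewrite !mul1r !mul0r => kI kR; apply: complex_ext.
- by apply: kR => w w'; rewrite !ReImE.
- by apply: kI => w w'; rewrite !ReImE.
Qed.

End ExpDerivative.

(** * Complex series and the exponential series *)

Section RealSeries.
Variable R : realType.
Implicit Types (u v : nat -> R).

Lemma le0_cvg_series u v : (forall n, 0 <= u n <= v n) ->
  cvgn (series v) -> cvgn (series u).
Proof.
move=> uv; apply: series_le_cvg => n.
- by case/andP: (uv n).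
- by case/andP: (uv n) => a b; exact: le_trans b.
- by case/andP: (uv n).
Qed.

Lemma series_le_lim u n : (forall n, 0 <= u n) -> cvgn (series u) ->
  series u n <= limn (series u).
Proof.
move=> u0 cu; apply: nondecreasing_cvgn_le => //.
by apply/nondecreasing_seqP => m; rewrite seriesSr lerDl.
Qed.

Lemma bounded_cvg_series u M : (forall n, 0 <= u n) -> (forall n, series u n <= M) ->
  cvgn (series u).
Proof.
move=> u0 uM; apply: nondecreasing_is_cvgn.
  by apply/nondecreasing_seqP => n; rewrite seriesSr lerDl.
by exists M => _ [n _ <-].
Qed.

End RealSeries.

Section ComplexSeries.
Variable R : realType.
Local Notation C := R[i].
Implicit Types (a b : nat -> C) (z w h : C).

Definition abs_summable a := cvgn (series (fun n => normc (a n))).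

(** The limit is taken in each component, so that the theory of real series
    applies. *)
Definition csum a : C :=
  limn (series (fun n => complex.Re (a n))) +i*
  limn (series (fun n => complex.Im (a n))).

Lemma abs_summable_Re a : abs_summable a -> cvgn (series (fun n => complex.Re (a n))).
Proof.
move=> sa; apply: normed_cvg; apply: le0_cvg_series sa => n.
by rewrite normr_ge0 Re_le_normc.
Qed.

Lemma abs_summable_Im a : abs_summable a -> cvgn (series (fun n => complex.Im (a n))).
Proof.
move=> sa; apply: normed_cvg; apply: le0_cvg_series sa => n.
by rewrite normr_ge0 Im_le_normc.
Qed.

Lemma abs_summable_le a (u : nat -> R) :
  (forall n, normc (a n) <= u n) -> cvgn (series u) -> abs_summable a.
Proof. by move=> au; apply: le0_cvg_series => n; rewrite normc_ge0 au. Qed.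

Lemma normc_csum_le a : abs_summable a ->
  normc (csum a) <= 2 * limn (series (fun n => normc (a n))).
Proof.
move=> sa; apply: le_trans (normc_le_ReIm _) _.
rewrite mulr_natl mulr2n; apply: lerD => /=.
- have h : cvgn [normed series (fun n => complex.Re (a n))].
    by apply: le0_cvg_series sa => n; rewrite normr_ge0 Re_le_normc.
  apply: le_trans (lim_series_norm h) _.
  by apply: lim_series_le => // n; exact: Re_le_normc.
- have h : cvgn [normed series (fun n => complex.Im (a n))].
    by apply: le0_cvg_series sa => n; rewrite normr_ge0 Im_le_normc.
  apply: le_trans (lim_series_norm h) _.
  by apply: lim_series_le => // n; exact: Im_le_normc.
Qed.

Lemma abs_summableD a b : abs_summable a -> abs_summable b ->
  abs_summable (fun n => a n + b n).
Proof.
move=> sa sb; apply: (@abs_summable_le _ ((fun n => normc (a n)) + (fun n => normc (b n)))).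
  by move=> n; exact: ler_normcD.
exact: is_cvg_seriesD.
Qed.

Lemma abs_summableZ c a : abs_summable a -> abs_summable (fun n => c * a n).
Proof.
move=> sa; apply: (@abs_summable_le _ (normc c *: (fun n => normc (a n)))).
  by move=> n; rewrite normcM.
exact: is_cvg_seriesZ.
Qed.

Lemma csumD a b : abs_summable a -> abs_summable b ->
  csum (fun n => a n + b n) = csum a + csum b.
Proof.
move=> sa sb; apply: complex_ext; rewrite ReImE /csum /=.
- rewrite -lim_seriesD; [|exact: abs_summable_Re|exact: abs_summable_Re].
  by congr (limn (series _)); apply/funext => n; rewrite complexReD.
- rewrite -lim_seriesD; [|exact: abs_summable_Im|exact: abs_summable_Im].
  by congr (limn (series _)); apply/funext => n; rewrite complexImD.
Qed.

Lemma lim_series_comb (s t : R) (u v : nat -> R) :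
  cvgn (series u) -> cvgn (series v) ->
  limn (series (fun n => s * u n + t * v n)) =
  s * limn (series u) + t * limn (series v).
Proof.
move=> cu cv; have -> : s * limn (series u) = limn (series (s *: u)).
  by rewrite lim_seriesZ.
have -> : t * limn (series v) = limn (series (t *: v)) by rewrite lim_seriesZ.
by rewrite -lim_seriesD//; exact: is_cvg_seriesZ.
Qed.

Lemma csumZ c a : abs_summable a -> csum (fun n => c * a n) = c * csum a.
Proof.
move=> sa; have sR := abs_summable_Re sa; have sI := abs_summable_Im sa.
apply: complex_ext; rewrite ReImE /csum /=.
- rewrite -mulNr -lim_series_comb//.
  by congr (limn (series _)); apply/funext => n; rewrite complexReM mulNr.
- rewrite -lim_series_comb//.
  by congr (limn (series _)); apply/funext => n; rewrite complexImM.
Qed.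

Lemma limn_series_recl (u : nat -> R) : cvgn (series u) ->
  cvgn (series (fun n => u n.+1)) /\
  limn (series u) = u 0%N + limn (series (fun n => u n.+1)).
Proof.
move=> cu.
have e n : series (fun n => u n.+1) n = series u n.+1 - u 0%N.
  by rewrite !seriesEnat /= big_nat_recl// addrAC subrr add0r.
have c1 : series (fun n => u n.+1) n @[n --> \oo] --> limn (series u) - u 0%N.
  under eq_fun do rewrite e.
  by apply: cvgB; [rewrite (cvg_shiftS (series u)); exact: cu|exact: cvg_cst].
by split; [apply/cvg_ex; eexists; exact: c1|rewrite (cvg_lim _ c1)// addrC subrK].
Qed.

Lemma csum_recl a : abs_summable a ->
  abs_summable (fun n => a n.+1) /\ csum a = a 0%N + csum (fun n => a n.+1).
Proof.
move=> sa; split; first exact: (limn_series_recl sa).1.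
apply: complex_ext; rewrite ReImE /csum /=.
- by rewrite (limn_series_recl (abs_summable_Re sa)).2.
- by rewrite (limn_series_recl (abs_summable_Im sa)).2.
Qed.

Lemma csum0 : csum (fun=> 0) = 0.
Proof.
by apply: complex_ext; rewrite /csum /=; apply: lim_near_cst => //;
  apply: nearW => n; rewrite seriesEnat /= big1.
Qed.

End ComplexSeries.

Section PowerSeries.
Variable R : realType.
Local Notation C := R[i].
Implicit Types (a : nat -> C) (z w h : C).

Lemma normc_nat n : normc (n%:R : C) = n%:R.
Proof.
have -> : (n%:R : C) = (n%:R : R)%:C by rewrite rmorph_nat.
by rewrite normc_real ger0_norm.
Qed.

(** Both bounds grow like (rho + 1)^n, so that they can be summed against the
    coefficients of an everywhere convergent power series. The first is the
    second order Taylor estimate; its induction step uses the second. *)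
Lemma exprn_Taylor2 z h n (rho : R) : normc z <= rho -> normc (z + h) <= rho ->
  normc ((z + h) ^+ n - z ^+ n - (n%:R * z ^+ n.-1) * h) <=
  normc h ^+ 2 * (rho + 1) ^+ n /\ n%:R * rho ^+ n.-1 <= (rho + 1) ^+ n.
Proof.
move=> zr zhr; have r0 : 0 <= rho by exact: le_trans (normc_ge0 z) zr.
elim: n => [|n [ih1 ih2]].
  rewrite !expr0 mul0r subrr sub0r mul0r normcN normc0 mulr1.
  by rewrite mulr1 sqr_ge0 ler01.
have h1 : n.+1%:R * rho ^+ n <= (rho + 1) ^+ n.+1.
  rewrite -natr1 mulrDl mul1r exprS mulrDl mul1r; apply: lerD; last first.
    by rewrite lerXn2r ?nnegrE ?addr_ge0// lerDl.
  case: n ih2 {ih1} => [_|n ih2]; first by rewrite mul0r mulr_ge0 ?expr0.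
  by rewrite exprS mulrCA ler_wpM2l.
split => //=.
have -> : (z + h) ^+ n.+1 - z ^+ n.+1 - (n.+1%:R * z ^+ n) * h =
  (z + h) * ((z + h) ^+ n - z ^+ n - (n%:R * z ^+ n.-1) * h) +
  (n%:R * z ^+ n.-1) * h ^+ 2.
  rewrite !exprS -natr1; case: n {ih1 ih2 h1} => [|n] /=.
    by rewrite !expr0; ring.
  by rewrite !exprS; ring.
apply: le_trans (ler_normcD _ _) _.
rewrite !normcM [(rho + 1) ^+ n.+1]exprS mulrDl mul1r mulrDr; apply: lerD.
- apply: (@le_trans _ _ (rho * (normc h ^+ 2 * (rho + 1) ^+ n))).
    by apply: ler_pM => //; exact: normc_ge0.
  by rewrite le_eqVlt; apply/orP; left; apply/eqP; ring.
- rewrite mulrC normcX ler_wpM2l ?sqr_ge0//.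
  apply: le_trans ih2.
  by rewrite normc_nat ler_wpM2l// lerXn2r ?nnegrE ?normc_ge0.
Qed.

(** A power series with infinite radius of convergence may be differentiated
    term by term: the remainder is of second order in the increment. *)
Lemma cdiff_power_series a z :
  (forall rho : R, 0 <= rho -> cvgn (series (fun n => normc (a n) * rho ^+ n))) ->
  abs_summable (fun n => a n * (n%:R * z ^+ n.-1)) /\
  cdiff (fun w => csum (fun n => a n * w ^+ n)) z
        (csum (fun n => a n * (n%:R * z ^+ n.-1))).
Proof.
move=> sa; have nz := normc_ge0 z.
have sumz w : abs_summable (fun n => a n * w ^+ n).
  apply: abs_summable_le (sa _ (normc_ge0 w)) => n.
  by rewrite normcM normcX.
have sumd : abs_summable (fun n => a n * (n%:R * z ^+ n.-1)).
  apply: abs_summable_le (sa (normc z + 1) _) => [n|]; last by rewrite addr_ge0.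
  rewrite !normcM ler_wpM2l ?normc_ge0//.
  have [||_] := @exprn_Taylor2 z 0 n (normc z); rewrite ?addr0//.
  by apply: le_trans; rewrite normcX normc_nat.
split => // e e0.
pose M := limn (series (fun n => normc (a n) * (normc z + 1 + 1) ^+ n)).
have cM : cvgn (series (fun n => normc (a n) * (normc z + 1 + 1) ^+ n)).
  by apply: sa; rewrite !addr_ge0.
have M0 : 0 <= M.
  have := series_le_lim 0 _ cM; rewrite seriesEnat /= big_geq//; apply => n.
  by rewrite mulr_ge0 ?normc_ge0 ?exprn_ge0 ?addr_ge0.
exists (Num.min 1 (e / (2 * M + 1))).
  by rewrite lt_min ltr01 divr_gt0// ltr_wpDl// mulr_ge0.
move=> h; rewrite lt_min ltr_pdivlMr ?ltr_wpDl ?mulr_ge0// => /andP[h1 he].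
have s1 := @abs_summableZ _ (-1) _ (sumz z).
have s2 := @abs_summableZ _ (- h) _ sumd.
have s3 := abs_summableD (sumz (z + h)) s1.
have s4 := abs_summableD s3 s2.
have -> : csum (fun n => a n * (z + h) ^+ n) - csum (fun n => a n * z ^+ n) -
    csum (fun n => a n * (n%:R * z ^+ n.-1)) * h =
    csum (fun n => a n * (z + h) ^+ n + -1 * (a n * z ^+ n) +
                   - h * (a n * (n%:R * z ^+ n.-1))).
  rewrite csumD// csumD// !csumZ//; ring.
apply: le_trans (normc_csum_le s4) _.
have bnd n : normc (a n * (z + h) ^+ n + -1 * (a n * z ^+ n) +
     - h * (a n * (n%:R * z ^+ n.-1))) <=
    normc h ^+ 2 * (normc (a n) * (normc z + 1 + 1) ^+ n).
  have -> : a n * (z + h) ^+ n + -1 * (a n * z ^+ n) +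
     - h * (a n * (n%:R * z ^+ n.-1)) =
     a n * ((z + h) ^+ n - z ^+ n - (n%:R * z ^+ n.-1) * h) by ring.
  rewrite normcM mulrCA ler_wpM2l ?normc_ge0//.
  apply: (exprn_Taylor2 n _ _).1; first by rewrite lerDl.
  by apply: le_trans (ler_normcD _ _) _; rewrite lerD2l ltW.
have c2 : cvgn (series (normc h ^+ 2 *: (fun n => normc (a n) * (normc z + 1 + 1) ^+ n))).
  exact: is_cvg_seriesZ.
have := lim_series_le s4 c2 bnd; rewrite lim_seriesZ// -/M => le1.
apply: (@le_trans _ _ (2 * (normc h ^+ 2 *: M))); first by rewrite ler_wpM2l.
rewrite /GRing.scale/= expr2 (_ : 2 * _ = 2 * M * normc h * normc h); last by ring.
rewrite ler_wpM2r ?normc_ge0//; apply: le_trans (ltW he).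
by rewrite mulrC ler_wpM2l ?normc_ge0// lerDl.
Qed.

Lemma cvg_exp_series (x : R) : cvgn (series (fun n => x ^+ n / n`!%:R)).
Proof. exact: is_cvg_series_exp_coeff. Qed.

(** The power series satisfies the same differential equation as [expC], so
    its quotient by [expC] is constant. *)
Lemma expC_series z : abs_summable (fun n => z ^+ n / n`!%:R) /\
  expC z = csum (fun n => z ^+ n / n`!%:R).
Proof.
have cv (rho : R) : 0 <= rho -> cvgn (series (fun n => normc ((n`!%:R : C)^-1) * rho ^+ n)).
  move=> r0; under eq_fun do rewrite normcV normc_nat mulrC.
  exact: cvg_exp_series.
pose E w : C := csum (fun n => (n`!%:R : C)^-1 * w ^+ n).
have sE w : abs_summable (fun n => (n`!%:R : C)^-1 * w ^+ n).
  apply: abs_summable_le (cv _ (normc_ge0 w)) => n.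
  by rewrite normcM normcX.
have dE w : cdiff E w (E w).
  have [s1 d1] := cdiff_power_series w cv.
  suff -> : E w = csum (fun n => (n`!%:R : C)^-1 * (n%:R * w ^+ n.-1)) by [].
  have [_ ->] := csum_recl s1; rewrite mul0r mulr0 add0r.
  congr csum; apply/funext => n /=.
  rewrite factS natrM mulrA; congr (_ * _).
  by rewrite invfM mulrAC mulVf ?mul1r// pnatr_eq0.
have dN w : cdiff (fun w => expC (- w)) w (- expC (- w)).
  move=> e e0; have [d d0 H] := cdiff_expC (- w) e0.
  exists d => // h hd; have := H (- h); rewrite normcN => /(_ hd).
  by rewrite opprD mulNr opprK mulrN opprK.
have dF w : cdiff (fun w => E w * expC (- w)) w 0.
  apply/cdiffP; have /cdiffP h1 := dE w; have /cdiffP h2 := dN w.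
  have := is_deriveM h1 h2; rewrite /GRing.scale/= mulrN (mulrC (expC _)) addNr.
  exact.
have := cdiff0_cst dF z; rewrite oppr0 expC0 mulr1 => h.
have E0 : E 0 = 1.
  rewrite /E; have [_ ->] := csum_recl (sE 0).
  rewrite expr0 mulr1 fact0 invr1 (_ : (fun n => _) = fun=> 0) ?csum0 ?addr0//.
  by apply/funext => n; rewrite exprS mul0r mulr0.
have EE w : (fun n => w ^+ n / (n`!%:R : C)) = (fun n => (n`!%:R : C)^-1 * w ^+ n).
  by apply/funext => n; rewrite mulrC.
split; first by rewrite EE.
rewrite EE -/(E z) -[LHS]mul1r -E0 -h -mulrA (mulrC (expC (- z))) expCNK mulr1 //.
Qed.

End PowerSeries.

(** * Complex valued integrals *)

Section ComplexIntegral.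
Context d (T : measurableType d) (R : realType).
Variable mu : {measure set T -> \bar R}.
Local Notation C := R[i].
Implicit Types (D : set T) (f g : T -> C) (c : C).

(** As for series, the integral is taken in each component, whence the factor 2 in
    [normc_cint_le]. *)
Definition cint D f : C :=
  (\int[mu]_(x in D) complex.Re (f x)) +i* (\int[mu]_(x in D) complex.Im (f x)).

Definition cmeasurable D f :=
  measurable_fun D (fun x => complex.Re (f x)) /\
  measurable_fun D (fun x => complex.Im (f x)).

Definition cintegrable D f :=
  mu.-integrable D (EFin \o (fun x => complex.Re (f x))) /\
  mu.-integrable D (EFin \o (fun x => complex.Im (f x))).

Lemma eq_cint D f g : {in D, f =1 g} -> cint D f = cint D g.
Proof.
by move=> fg; rewrite /cint; congr (_ +i* _); apply: eq_Rintegral => x xD; rewrite fg.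
Qed.

Lemma cintegrable_cmeasurable D f : cintegrable D f -> cmeasurable D f.
Proof.
by case=> /measurable_int/measurable_EFinP ? /measurable_int/measurable_EFinP.
Qed.

Lemma cmeasurableD D f g : cmeasurable D f -> cmeasurable D g ->
  cmeasurable D (fun x => f x + g x).
Proof.
case=> f1 f2 [g1 g2]; split.
  by under eq_fun do rewrite complexReD; exact: measurable_funD.
by under eq_fun do rewrite complexImD; exact: measurable_funD.
Qed.

Lemma cmeasurableM D f g : cmeasurable D f -> cmeasurable D g ->
  cmeasurable D (fun x => f x * g x).
Proof.
case=> f1 f2 [g1 g2]; split.
  under eq_fun do rewrite complexReM.
  by apply: measurable_funB; exact: measurable_funM.
under eq_fun do rewrite complexImM.
by apply: measurable_funD; exact: measurable_funM.
Qed.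

Lemma cmeasurable_cst D c : cmeasurable D (fun=> c).
Proof. by split; exact: measurable_cst. Qed.

Lemma cmeasurableJ D f : cmeasurable D f -> cmeasurable D (fun x => conjc (f x)).
Proof.
case=> f1 f2; split.
  by under eq_fun do rewrite Re_conj.
by under eq_fun do rewrite Im_conj; exact: measurable_funN.
Qed.

Lemma cmeasurable_normc_sqr D f : cmeasurable D f ->
  measurable_fun D (fun x => normc (f x) ^+ 2).
Proof.
case=> f1 f2; under eq_fun do rewrite sqr_normcE.
by apply: measurable_funD; exact: measurable_funX.
Qed.

Lemma cmeasurable_normc D f : cmeasurable D f ->
  measurable_fun D (fun x => normc (f x)).
Proof.
move=> mf; rewrite (_ : (fun x => _) = Num.sqrt \o (fun x => normc (f x) ^+ 2)).
  apply: measurableT_comp; last exact: cmeasurable_normc_sqr.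
  by apply: continuous_measurable_fun; exact: sqrt_continuous.
by apply/funext => x /=; rewrite sqrtr_sqr ger0_norm// normc_ge0.
Qed.

Lemma cmeasurable_real D (u : T -> R) : measurable_fun D u ->
  cmeasurable D (fun x => (u x)%:C).
Proof. by move=> mu'; split => //=; exact: measurable_cst. Qed.

Lemma cintegrable_le D f (u : T -> R) : measurable D -> cmeasurable D f ->
  (forall x, D x -> normc (f x) <= u x) -> mu.-integrable D (EFin \o u) ->
  cintegrable D f.
Proof.
move=> mD [f1 f2] fu iu; split.
- apply: (le_integrable mD _ _ iu); first exact/measurable_EFinP.
  move=> x Dx /=; rewrite lee_fin (le_trans (Re_le_normc _))//.
  by rewrite (le_trans (fu _ Dx))// ler_norm.
- apply: (le_integrable mD _ _ iu); first exact/measurable_EFinP.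
  move=> x Dx /=; rewrite lee_fin (le_trans (Im_le_normc _))//.
  by rewrite (le_trans (fu _ Dx))// ler_norm.
Qed.

Lemma cintegrable_normc D f : measurable D -> cintegrable D f ->
  mu.-integrable D (EFin \o (fun x => normc (f x))).
Proof.
move=> mD fi; have [f1 f2] := fi.
have := integrableD mD (integrable_abse f1) (integrable_abse f2).
apply: le_integrable => //.
  by apply/measurable_EFinP; apply: cmeasurable_normc; exact: cintegrable_cmeasurable.
move=> x Dx /=; rewrite lee_fin ger0_norm ?normc_ge0//.
by rewrite (le_trans (normc_le_ReIm _))// ler_norm.
Qed.

Lemma integrable_comb D (u v : T -> R) (s t : R) : measurable D ->
  mu.-integrable D (EFin \o u) -> mu.-integrable D (EFin \o v) ->
  mu.-integrable D (EFin \o (fun x => s * u x + t * v x)).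
Proof.
move=> mD iu iv.
have := integrableD mD (integrableZl mD s iu) (integrableZl mD t iv).
by apply: eq_integrable => // x _ /=; rewrite EFinD !EFinM.
Qed.

Lemma Rintegral_comb D (u v : T -> R) (s t : R) : measurable D ->
  mu.-integrable D (EFin \o u) -> mu.-integrable D (EFin \o v) ->
  \int[mu]_(x in D) (s * u x + t * v x) =
  s * (\int[mu]_(x in D) u x) + t * (\int[mu]_(x in D) v x).
Proof.
move=> mD iu iv; rewrite RintegralD//.
- by rewrite !RintegralZl.
- have := integrableZl mD s iu; apply: eq_integrable => // x _ /=.
- have := integrableZl mD t iv; apply: eq_integrable => // x _ /=.
Qed.

Lemma cintegrableZ D c f : measurable D -> cintegrable D f ->
  cintegrable D (fun x => c * f x).
Proof.
move=> mD [f1 f2]; split.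
- have := @integrable_comb D _ _ (complex.Re c) (- complex.Im c) mD f1 f2.
  by apply: eq_integrable => // x _ /=; rewrite complexReM mulNr.
- have := @integrable_comb D _ _ (complex.Re c) (complex.Im c) mD f2 f1.
  by apply: eq_integrable => // x _ /=; rewrite complexImM.
Qed.

Lemma cintD D f g : measurable D -> cintegrable D f -> cintegrable D g ->
  cint D (fun x => f x + g x) = cint D f + cint D g.
Proof.
move=> mD [f1 f2] [g1 g2]; apply: complex_ext; rewrite ReImE /cint /= -RintegralD//.
- by apply: eq_Rintegral => x _; rewrite complexReD.
- by apply: eq_Rintegral => x _; rewrite complexImD.
Qed.

Lemma cintZ D c f : measurable D -> cintegrable D f ->
  cint D (fun x => c * f x) = c * cint D f.
Proof.
move=> mD [f1 f2]; apply: complex_ext; rewrite ReImE /cint /=.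
- rewrite -mulNr -Rintegral_comb//.
  by apply: eq_Rintegral => x _; rewrite complexReM mulNr.
- rewrite -Rintegral_comb//.
  by apply: eq_Rintegral => x _; rewrite complexImM.
Qed.

Lemma cintegrableN D f : measurable D -> cintegrable D f ->
  cintegrable D (fun x => - f x).
Proof.
move=> mD fi; rewrite (_ : (fun x => - f x) = (fun x => (-1) * f x)).
  exact: cintegrableZ.
by apply/funext => x; rewrite mulN1r.
Qed.

Lemma cintB D f g : measurable D -> cintegrable D f -> cintegrable D g ->
  cint D (fun x => f x - g x) = cint D f - cint D g.
Proof.
move=> mD fi gi; rewrite cintD//; last exact: cintegrableN.
congr (_ + _); rewrite -mulN1r -cintZ//.
by apply: eq_cint => x _; rewrite mulN1r.
Qed.

Lemma cintJ D f : measurable D -> cintegrable D f ->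
  cint D (fun x => conjc (f x)) = conjc (cint D f).
Proof.
move=> mD [f1 f2]; apply: complex_ext; rewrite ?ReImE /cint /=.
- by apply: eq_Rintegral => x _; rewrite Re_conj.
- rewrite -mulN1r -RintegralZl//.
  by apply: eq_Rintegral => x _; rewrite Im_conj mulN1r.
Qed.

Lemma normc_cint_le D f (u : T -> R) : measurable D -> cintegrable D f ->
  (forall x, D x -> normc (f x) <= u x) -> mu.-integrable D (EFin \o u) ->
  normc (cint D f) <= 2 * \int[mu]_(x in D) u x.
Proof.
move=> mD [f1 f2] fu iu; apply: le_trans (normc_le_ReIm _) _.
rewrite mulr_natl mulr2n /=; apply: lerD.
- apply: le_trans (le_normr_Rintegral mD f1) _.
  apply: le_Rintegral => //; first exact: integrable_norm.
  by move=> x Dx; rewrite (le_trans (Re_le_normc _))// fu.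
- apply: le_trans (le_normr_Rintegral mD f2) _.
  apply: le_Rintegral => //; first exact: integrable_norm.
  by move=> x Dx; rewrite (le_trans (Im_le_normc _))// fu.
Qed.

End ComplexIntegral.

Section IntervalIntegral.
Variable R : realType.
Local Notation C := R[i].
Local Notation leb := (@lebesgue_measure R).
Implicit Types (a b m : R) (g : R -> C).

Definition ccontinuous g :=
  continuous (fun x => complex.Re (g x)) /\ continuous (fun x => complex.Im (g x)).

Lemma ccontinuousP g :
  (forall x (e : R), 0 < e -> exists2 d : R, 0 < d & forall t, `|t| < d ->
     normc (g (x + t) - g x) <= e) -> ccontinuous g.
Proof.
move=> H; split => x; apply/cvgrPdist_le => e e0.
- have [d d0 dH] := H x e e0; exists d => //= t xt.
  have := dH (t - x); rewrite subrKC distrC => /(_ xt).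
  rewrite normcB; apply: le_trans.
  by apply: le_trans (Re_le_normc _); rewrite !ReImE.
- have [d d0 dH] := H x e e0; exists d => //= t xt.
  have := dH (t - x); rewrite subrKC distrC => /(_ xt).
  rewrite normcB; apply: le_trans.
  by apply: le_trans (Im_le_normc _); rewrite !ReImE.
Qed.

Lemma ccontinuous_integrable g a b : ccontinuous g -> cintegrable leb `[a, b] g.
Proof.
case=> g1 g2; split; apply: continuous_compact_integrable;
  do ?[exact: segment_compact | exact: continuous_subspaceT].
Qed.

Lemma cint_cst a b (c : C) : a <= b -> cint leb `[a, b] (fun=> c) = (b - a)%:C * c.
Proof.
move=> ab; have mab : fine (leb `[a, b]) = b - a.
  rewrite lebesgue_measure_itv/= lte_fin; case: ltP => //= ba.
  by rewrite (le_anti (_ : a <= b <= a)) ?ab ?ba// subrr.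
apply: complex_ext; rewrite ReImE /cint /= Rintegral_cst// mab; ring.
Qed.

Lemma cint_split g a m b : ccontinuous g -> a <= m -> m <= b ->
  cint leb `[a, b] g = cint leb `[a, m] g + cint leb `[m, b] g.
Proof.
move=> cg am mb; have [g1 g2] := ccontinuous_integrable a b cg.
have key (u : R -> R) : leb.-integrable `[a, b] (EFin \o u) ->
    \int[leb]_(x in `[a, b]) u x = \int[leb]_(x in `[a, m]) u x + \int[leb]_(x in `[m, b]) u x.
  move=> ui; rewrite -(@Rintegral_itv_obnd_cbnd _ m (BRight b) u); last first.
    apply: integrableS ui => //; apply: subset_itvr.
    by rewrite bnd_simp.
  by rewrite -(@Rintegral_itvB _ u (BLeft a) (BRight b) m) ?bnd_simp// addrC subrK.
by apply: complex_ext; rewrite ReImE /cint /= key.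
Qed.

Lemma normc_cint_bound g a b M : a <= b -> ccontinuous g ->
  (forall x, a <= x <= b -> normc (g x) <= M) ->
  normc (cint leb `[a, b] g) <= 2 * (M * (b - a)).
Proof.
move=> ab cg gM.
have [Mi _] : cintegrable leb `[a, b] (fun=> M%:C).
  by apply: ccontinuous_integrable; split => x; exact: cst_continuous.
have := @normc_cint_le _ _ _ leb `[a, b] g (fun=> M) _ (ccontinuous_integrable a b cg) _ Mi.
have -> : \int[leb]_(_ in `[a, b]) M = complex.Re (cint leb `[a, b] (fun=> M%:C)) by [].
by rewrite cint_cst// ReImE /= mulr0 subr0 [M * _]mulrC; apply => //.
Qed.

Lemma ccontinuousB g (h : R -> C) : ccontinuous g -> ccontinuous h ->
  ccontinuous (fun x => g x - h x).
Proof.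
case=> g1 g2 [h1 h2]; split.
  by under eq_fun do rewrite complexReD complexReN; move=> x; exact: (continuousB (g1 x) (h1 x)).
by under eq_fun do rewrite complexImD complexImN; move=> x; exact: (continuousB (g2 x) (h2 x)).
Qed.

Lemma ccontinuous_cst (c : C) : ccontinuous (fun=> c).
Proof. by split => x; exact: cst_continuous. Qed.

Lemma entire_ccontinuous (f : C -> C^o) (p : R -> C) : entire f ->
  (forall x h, normc (p (x + h) - p x) <= `|h|) -> ccontinuous (fun x => f (p x)).
Proof.
move=> /entireP ef pl; apply: ccontinuousP => x e e0.
have [l fl] := ef (p x); have [d d0 H] := cdiff_continuous fl e0.
exists d => // h hd; have := H (p (x + h) - p x).
by rewrite subrKC; apply; exact: le_lt_trans (pl x h) hd.
Qed.

End IntervalIntegral.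

(** * Goursat's theorem on rectangles *)

Section Goursat.
Variable R : realType.
Local Notation C := R[i].
Local Notation leb := (@lebesgue_measure R).
Variables (f : C -> C) (ef : entire f).
Implicit Types (a b c d m : R).

(** The integral of f(z) dz over the boundary of the rectangle with corners
    a + ic and b + id, run counterclockwise; opposite sides are paired, which is
    how they cancel in the proofs. *)
Definition rect_int a b c d : C :=
  cint leb `[a, b] (fun x => f (x +i* c) - f (x +i* d)) +
  'i%C * cint leb `[c, d] (fun y => f (b +i* y) - f (a +i* y)).

Lemma horizontal_ccontinuous c : ccontinuous (fun x => f (x +i* c)).
Proof.
apply: entire_ccontinuous => // x h; rewrite (_ : _ - _ = h%:C) ?normc_real//.
by apply: complex_ext; rewrite ReImE /= ?subrr// addrAC subrr add0r.
Qed.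

Lemma vertical_ccontinuous a : ccontinuous (fun y => f (a +i* y)).
Proof.
apply: entire_ccontinuous => // x h; rewrite (_ : _ - _ = 'i%C * h%:C); last first.
  apply: complex_ext; rewrite !ReImE /= ?subrr; first by rewrite !mul0r mul1r subrr.
  by rewrite addrAC subrr add0r mul0r mul1r add0r.
by rewrite normcM normc_real /= expr0n expr1n add0r sqrtr1 mul1r.
Qed.

Let hc := horizontal_ccontinuous.
Let vc := vertical_ccontinuous.

Lemma rect_int_splitx a m b c d : a <= m -> m <= b ->
  rect_int a b c d = rect_int a m c d + rect_int m b c d.
Proof.
move=> am mb; rewrite /rect_int.
rewrite (cint_split (m := m) (ccontinuousB (hc c) (hc d)))//.
rewrite (_ : (fun y => f (b +i* y) - f (a +i* y)) =
  (fun y => (f (m +i* y) - f (a +i* y)) + (f (b +i* y) - f (m +i* y)))); last first.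
  by apply/funext => y; ring.
rewrite [X in 'i%C * X]cintD//; [ring|..]; apply: ccontinuous_integrable; exact: ccontinuousB.
Qed.

Lemma rect_int_splity a b c m d : c <= m -> m <= d ->
  rect_int a b c d = rect_int a b c m + rect_int a b m d.
Proof.
move=> am mb; rewrite /rect_int.
rewrite (cint_split (m := m) (ccontinuousB (vc b) (vc a)))//.
rewrite (_ : (fun x => f (x +i* c) - f (x +i* d)) =
  (fun x => (f (x +i* c) - f (x +i* m)) + (f (x +i* m) - f (x +i* d)))); last first.
  by apply/funext => y; ring.
rewrite [X in X + _ = _]cintD//; [ring|..]; apply: ccontinuous_integrable; exact: ccontinuousB.
Qed.

(** The affine part of [f] at [p] contributes nothing to the boundary integral,
    so only the first order remainder is left. *)
Lemma rect_int_local (p : C) (e : R) : 0 < e -> exists2 delta : R, 0 < delta &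
  forall a b c d, a <= complex.Re p <= b -> c <= complex.Im p <= d ->
    b - a + (d - c) < delta ->
    normc (rect_int a b c d) <= e * (b - a + (d - c)) ^+ 2.
Proof.
move=> e0; have [l fl] := (entireP f).1 ef p.
have [delta delta0 H] := fl (e / 4) (divr_gt0 e0 (ltr0n _ 4)).
exists delta => // a b c d /andP[ap pb] /andP[cp pd] sd.
have ab : a <= b by exact: le_trans pb.
have cd : c <= d by exact: le_trans pd.
set S := b - a + (d - c) in sd *.
have S0 : 0 <= S by rewrite /S; lra.
pose rho z := f z - f p - l * (z - p).
have rhoE z : f z = f p + l * (z - p) + rho z by rewrite /rho; ring.
have rho_le x y : a <= x <= b -> c <= y <= d -> normc (rho (x +i* y)) <= e / 4 * S.
  move=> /andP[ax xb] /andP[cy yd].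
  have nS : normc (x +i* y - p) <= S.
    apply: le_trans (normc_le_ReIm _) _; rewrite !ReImE /S; apply: lerD => /=.
    - by rewrite ler_norml; apply/andP; split; lra.
    - by rewrite ler_norml; apply/andP; split; lra.
  have := H (x +i* y - p) (le_lt_trans nS sd).
  rewrite (_ : p + (_ - p) = x +i* y); last by ring.
  by move=> /le_trans; apply; rewrite ler_pM2l// divr_gt0.
pose k1 : C := - ('i%C * l * (d - c)%:C); pose k2 : C := l * (b - a)%:C.
pose g1 x := f (x +i* c) - f (x +i* d) - k1.
pose g2 y := f (b +i* y) - f (a +i* y) - k2.
have cg1 : ccontinuous g1.
  by apply: ccontinuousB; [exact: ccontinuousB|exact: ccontinuous_cst].
have cg2 : ccontinuous g2.
  by apply: ccontinuousB; [exact: ccontinuousB|exact: ccontinuous_cst].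
have -> : rect_int a b c d = cint leb `[a, b] g1 + 'i%C * cint leb `[c, d] g2.
  rewrite /g1 /g2 !cintB//; try by [apply: ccontinuous_integrable; exact: ccontinuous_cst];
    try by [apply: ccontinuous_integrable; exact: ccontinuousB];
    try by [apply: ccontinuous_integrable].
  rewrite !cint_cst// /rect_int !cintB//;
    try by [apply: ccontinuous_integrable; exact: hc];
    try by [apply: ccontinuous_integrable; exact: vc].
  rewrite /k1 /k2; ring.
have b1 : normc (cint leb `[a, b] g1) <= 2 * (e / 4 * S + e / 4 * S) * (b - a).
  rewrite -mulrA; apply: normc_cint_bound => // x xab.
  rewrite (_ : g1 x = rho (x +i* c) - rho (x +i* d)).
    apply: le_trans (ler_normcD _ _) _; rewrite normcN.
    by apply: lerD; apply: rho_le => //; rewrite ?lexx ?cd.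
  rewrite /g1 (rhoE (x +i* c)) (rhoE (x +i* d)) /k1 (_ : x +i* d = x +i* c + 'i%C * (d - c)%:C); first by ring.
  by apply: complex_ext; rewrite !ReImE/=; ring.
have b2 : normc (cint leb `[c, d] g2) <= 2 * (e / 4 * S + e / 4 * S) * (d - c).
  rewrite -mulrA; apply: normc_cint_bound => // y ycd.
  rewrite (_ : g2 y = rho (b +i* y) - rho (a +i* y)).
    apply: le_trans (ler_normcD _ _) _; rewrite normcN.
    by apply: lerD; apply: rho_le => //; rewrite ?lexx ?ab.
  rewrite /g2 (rhoE (b +i* y)) (rhoE (a +i* y)) /k2 (_ : b +i* y = a +i* y + (b - a)%:C); first by ring.
  by apply: complex_ext; rewrite !ReImE/=; ring.
apply: le_trans (ler_normcD _ _) _; rewrite normcM.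
rewrite (_ : normc 'i%C = 1) ?mul1r; last by rewrite /= expr0n expr1n add0r sqrtr1.
apply: le_trans (lerD b1 b2) _.
rewrite -mulrDr -/S expr2 le_eqVlt; apply/orP; left; apply/eqP.
by field.
Qed.

Lemma rect_int_quarter (M : R) a c w h : 0 <= w -> 0 <= h ->
  M <= normc (rect_int a (a + w) c (c + h)) ->
  exists ac : R * R, [/\ a <= ac.1, ac.1 + w / 2 <= a + w,
    c <= ac.2, ac.2 + h / 2 <= c + h &
    M / 4 <= normc (rect_int ac.1 (ac.1 + w / 2) ac.2 (ac.2 + h / 2))].
Proof.
have half (x t : R) : 0 <= t -> [/\ x + t / 2 <= x + t, x <= x + t / 2 & x + t / 2 + t / 2 <= x + t].
  by move=> t0; split; lra.
move=> w0 h0 MJ.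
pose J a c := rect_int a (a + w / 2) c (c + h / 2).
have JE : rect_int a (a + w) c (c + h) =
    J a c + J a (c + h / 2) + (J (a + w / 2) c + J (a + w / 2) (c + h / 2)).
  rewrite (@rect_int_splitx a (a + w / 2)); [|lra|lra].
  rewrite (@rect_int_splity a _ c (c + h / 2)); [|lra|lra].
  rewrite (@rect_int_splity (a + w / 2) _ c (c + h / 2)); [|lra|lra].
  have e1 : a + w / 2 + w / 2 = a + w by field.
  have e2 : c + h / 2 + h / 2 = c + h by field.
  by rewrite /J e1 e2.
have [|H] := pselect (exists ac : R * R, [/\ a <= ac.1, ac.1 + w / 2 <= a + w,
    c <= ac.2, ac.2 + h / 2 <= c + h & M / 4 <= normc (J ac.1 ac.2)]) => //.
exfalso; have N x y : a <= x -> x + w / 2 <= a + w -> c <= y -> y + h / 2 <= c + h ->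
    normc (J x y) < M / 4.
  by move=> *; rewrite ltNge; apply/negP => ?; apply: H; exists (x, y).
have : normc (rect_int a (a + w) c (c + h)) < M.
  rewrite JE; apply: le_lt_trans (ler_normcD _ _) _.
  apply: le_lt_trans (lerD (ler_normcD _ _) (ler_normcD _ _)) _.
  have := N a c; have := N a (c + h / 2); have := N (a + w / 2) c.
  have := N (a + w / 2) (c + h / 2).
  have [x1 x2 x3] := half a _ w0; have [y1 y2 y3] := half c _ h0.
  move=> /(_ x2 x3 y2 y3) N4 /(_ x2 x3 (lexx c) y1) N3 /(_ (lexx a) x1 y2 y3) N2.
  move=> /(_ (lexx a) x1 (lexx c) y1) N1.
  have -> : M = M / 4 + M / 4 + (M / 4 + M / 4) by field.
  by apply: ltrD; apply: ltrD.
by rewrite ltNge MJ.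
Qed.

Lemma exp2_small (S delta : R) : 0 <= S -> 0 < delta -> exists n : nat, S / 2 ^+ n < delta.
Proof.
move=> S0 d0; exists (Num.truncn (S / delta)).+1.
rewrite ltr_pdivrMr ?exprn_gt0// mulrC -ltr_pdivrMr//.
apply: lt_trans (_ : (Num.truncn (S / delta)).+1%:R < _).
  by have /andP[_] := truncn_itv (divr_ge0 S0 (ltW d0)).
by rewrite -natrX ltr_nat ltn_expl.
Qed.

(** Bisection: if the integral were nonzero, some quarter of the rectangle
    would carry at least a quarter of it, and so on down to a point, where the
    local estimate is violated. *)
Lemma Goursat a b c d : a < b -> c < d -> rect_int a b c d = 0.
Proof.
move=> ab cd; apply/eqP; rewrite -normc_eq0; apply/eqP/le_anti.
rewrite normc_ge0 andbT leNgt; apply/negP => J0.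
set eta := normc _ in J0.
pose W n : R := (b - a) / 2 ^+ n; pose H n : R := (d - c) / 2 ^+ n.
have W0 n : 0 <= W n by rewrite divr_ge0 ?exprn_ge0// subr_ge0 ltW.
have H0 n : 0 <= H n by rewrite divr_ge0 ?exprn_ge0// subr_ge0 ltW.
have WS n : W n.+1 = W n / 2 by rewrite /W exprS; field; rewrite expf_neq0.
have HS n : H n.+1 = H n / 2 by rewrite /H exprS; field; rewrite expf_neq0.
pose big n (s : R * R) := eta / 4 ^+ n <=
  normc (rect_int s.1 (s.1 + W n) s.2 (s.2 + H n)).
have step (ns : nat * (R * R)) : exists s' : R * R, big ns.1 ns.2 ->
    [/\ ns.2.1 <= s'.1, s'.1 + W ns.1.+1 <= ns.2.1 + W ns.1,
        ns.2.2 <= s'.2, s'.2 + H ns.1.+1 <= ns.2.2 + H ns.1 & big ns.1.+1 s'].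
  case: ns => n s /=; have [bs|] := pselect (big n s); last by exists s.
  have [s' [h1 h2 h3 h4 h5]] := rect_int_quarter (W0 n) (H0 n) bs.
  exists s' => _; rewrite /big !WS !HS; split => //.
  by rewrite exprS invfM mulrA mulrAC.
have [F FP] := choice step.
pose s := fix s n := if n is m.+1 then F (m, s m) else (a, c).
have bigs n : big n (s n).
  elim: n => [|n ih]; last by have [] := FP (n, s n) ih.
  by rewrite /big /W /H /= !expr0 !divr1 !subrKC.
have mon (n m : nat) : (n <= m)%N -> [/\ (s n).1 <= (s m).1, (s m).1 + W m <= (s n).1 + W n,
   (s n).2 <= (s m).2 & (s m).2 + H m <= (s n).2 + H n].
  elim: m => [|m ih]; first by rewrite leqn0 => /eqP ->; rewrite !lexx.
  rewrite leq_eqVlt => /predU1P[<-|]; first by rewrite !lexx.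
  rewrite ltnS => /ih[i1 i2 i3 i4].
  have [/= j1 j2 j3 j4 _] := FP (m, s m) (bigs m).
  by split; [exact: le_trans j1|exact: le_trans i2|exact: le_trans j3|exact: le_trans i4].
have up1 (n m : nat) : (s m).1 <= (s n).1 + W n.
  have [nm|/ltnW mn] := leqP n m.
    by have [_ h _ _] := mon n m nm; apply: le_trans h; rewrite lerDl.
  by have [h _ _ _] := mon m n mn; apply: le_trans h _; rewrite lerDl.
have up2 (n m : nat) : (s m).2 <= (s n).2 + H n.
  have [nm|/ltnW mn] := leqP n m.
    by have [_ _ _ h] := mon n m nm; apply: le_trans h; rewrite lerDl.
  by have [_ _ h _] := mon m n mn; apply: le_trans h _; rewrite lerDl.
pose p1 := sup (range (fun n => (s n).1)); pose p2 := sup (range (fun n => (s n).2)).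
have p1n n : (s n).1 <= p1 <= (s n).1 + W n.
  apply/andP; split.
    apply: ub_le_sup; last by exists n.
    by exists ((s 0%N).1 + W 0%N) => _ [m _ <-].
  by apply: ge_sup; [by exists (s 0%N).1, 0%N|move=> _ [m _ <-]].
have p2n n : (s n).2 <= p2 <= (s n).2 + H n.
  apply/andP; split.
    apply: ub_le_sup; last by exists n.
    by exists ((s 0%N).2 + H 0%N) => _ [m _ <-].
  by apply: ge_sup; [by exists (s 0%N).2, 0%N|move=> _ [m _ <-]].
set S := b - a + (d - c).
have S0 : 0 < S by rewrite /S; lra.
have e0 : 0 < eta / (2 * S ^+ 2) by rewrite divr_gt0// mulr_gt0// exprn_gt0.
have [delta delta0 Hd] := rect_int_local (p1 +i* p2) e0.
have [n Sn] := exp2_small (ltW S0) delta0.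
have SnE : (s n).1 + W n - (s n).1 + ((s n).2 + H n - (s n).2) = S / 2 ^+ n.
  by rewrite /S /W /H; ring.
have := Hd _ _ _ _ (p1n n) (p2n n); rewrite SnE => /(_ Sn).
have := bigs n; rewrite /big => h1 h2; have := le_trans h1 h2.
rewrite leNgt => /negP; apply.
have -> : eta / (2 * S ^+ 2) * (S / 2 ^+ n) ^+ 2 = eta / 4 ^+ n / 2.
  have -> : (4 : R) ^+ n = 2 ^+ n * 2 ^+ n by rewrite -exprMn; congr (_ ^+ n); ring.
  by field; rewrite expf_neq0//= gt_eqF.
by rewrite ltr_pdivrMr// ltr_pMr ?ltr1n// divr_gt0// exprn_gt0.
Qed.

(** The horizontal sides of a rectangle of height T cancel by periodicity, so
    Goursat's theorem identifies the integrals over the vertical ones. *)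
Lemma vertical_period_int a b (T : R) : 0 < T ->
  (forall x, f (x +i* T) = f (x +i* 0)) ->
  cint leb `[0, T] (fun y => f (a +i* y)) = cint leb `[0, T] (fun y => f (b +i* y)).
Proof.
move=> T0 per; wlog ab : a b / a < b.
  move=> wl; have [ab|ba|->//] := ltgtP a b; first exact: wl.
  by apply/esym; exact: wl.
have := Goursat ab T0; rewrite /rect_int.
rewrite (_ : (fun x => f (x +i* 0) - f (x +i* T)) = fun=> 0); last first.
  by apply/funext => x; rewrite per subrr.
rewrite cint_cst ?(ltW ab)// mulr0 add0r cintB//; try exact: ccontinuous_integrable.
move=> /eqP; rewrite mulf_eq0 => /orP[|]; last by rewrite subr_eq0 => /eqP.
by rewrite eq_complex /= oner_eq0 andbF.
Qed.

End Goursat.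

(** * Translations, rotations and radial functions in the plane *)

Section LebesgueAffine.
Variable R : realType.
Local Notation leb := (@lebesgue_measure R).

(** The Lebesgue measure is the only measure that agrees with it on half open
    intervals, and its scaled image under an increasing affine map does. *)
Lemma integral_affine (a b : R) (F : R -> \bar R) : 0 < a ->
  measurable_fun [set: measurableTypeR R] F -> (forall x, (0 <= F x)%E) ->
  (\int[leb]_x F x = a%:E * \int[leb]_x F (b + a * x)%R)%E.
Proof.
move=> a0 mF F0.
pose phi (x : measurableTypeR R) : measurableTypeR R := b + a * x.
have mphi : measurable_fun setT phi.
  by apply: measurable_funD => //; exact: measurable_funM.
pose M := isMeasurableFun.Build _ _ _ _ _ mphi.
pose Phi : {mfun measurableTypeR R >-> measurableTypeR R} := HB.pack phi M.
pose a' : {nonneg R} := NngNum (ltW a0).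
have E (X : set (measurableTypeR R)) : measurable X ->
    leb X = mscale a' (pushforward leb Phi) X.
  apply: lebesgue_measure_unique => _ [[s t]] _ <-.
  rewrite -[RHS]/(a%:E * leb (phi @^-1` `]s, t]%classic))%E.
  have -> : phi @^-1` `]s, t] = `](s - b) / a, (t - b) / a]%classic.
    apply/seteqP; split => x /=; rewrite !in_itv/= ltr_pdivrMr// ler_pdivlMr//;
      by rewrite ltrBlDl lerBrDl mulrC.
  rewrite !lebesgue_measure_itv/= !lte_fin ltr_pM2r ?invr_gt0// ltrD2r.
  case: ltP => // st; last by rewrite mule0.
  by rewrite -!EFinD -EFinM; congr EFin; field; rewrite gt_eqF.
rewrite (eq_measure_integral (mscale a' (pushforward leb Phi))); last first.
  by move=> A mA _; exact: E.
rewrite ge0_integral_mscale//=; congr (_ * _)%E.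
by rewrite ge0_integral_pushforward//= ?preimage_setT.
Qed.

Lemma integral_shift (b : R) (F : R -> \bar R) :
  measurable_fun [set: measurableTypeR R] F -> (forall x, (0 <= F x)%E) ->
  (\int[leb]_x F x = \int[leb]_x F (b + x)%R)%E.
Proof.
move=> mF F0; rewrite (integral_affine b ltr01 mF F0) mul1e.
by apply: eq_integral => x _; rewrite mul1r.
Qed.

Lemma integral_even (F : R -> \bar R) :
  measurable_fun [set: measurableTypeR R] F -> (forall x, (0 <= F x)%E) ->
  (forall x, F (- x) = F x) ->
  (\int[leb]_x F x = 2%:E * \int[leb]_(x in `]0%R, +oo[) F x)%E.
Proof.
move=> mF F0 Fe.
have -> : [set: measurableTypeR R] = `]-oo, 0%R] `|` `]0%R, +oo[.
  apply/seteqP; split => // x _ /=; rewrite !in_itv/= andbT.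
  by case: (leP x 0) => ?; [left|right].
rewrite ge0_integral_setU//=; last 2 first.
- exact: measurable_funS mF.
- apply/disj_setPS => x []/=; rewrite !in_itv/= andbT => x1 x2.
  by have := lt_le_trans x2 x1; rewrite ltxx.
have -> : (\int[leb]_(x in `]-oo, 0%R]) F x = \int[leb]_(x in `]0%R, +oo[) F x)%E.
  under eq_integral do rewrite -Fe.
  rewrite -ge0_integration_by_substitution0//.
  by rewrite integral_itv_obnd_cbnd//; exact: measurable_funS mF.
by rewrite -{1 2}[X in (X + X)%E]mul1e -ge0_muleDl// -EFinD.
Qed.

End LebesgueAffine.

Section Plane.
Variable R : realType.
Local Notation RT := (measurableTypeR R).
Local Notation leb := (@lebesgue_measure R).
Local Notation leb2 := (leb \x leb)%E.
Local Open Scope ereal_scope.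

Lemma measurable_plane_map (u v : RT * RT -> R) (F : RT * RT -> \bar R) :
  measurable_fun setT u -> measurable_fun setT v -> measurable_fun setT F ->
  measurable_fun setT (fun p => F (u p, v p)).
Proof. by move=> mu mv mF; exact: (measurableT_comp mF (measurable_fun_pair mu mv)). Qed.

(** By Tonelli's theorem a shear preserves area: it translates each line parallel
    to one of the axes. *)
Lemma integral_shear1 (t : R) (F : RT * RT -> \bar R) :
  measurable_fun setT F -> (forall p, 0 <= F p) ->
  \int[leb2]_p F (p.1 + t * p.2, p.2)%R = \int[leb2]_p F p.
Proof.
move=> mF F0.
have mF' : measurable_fun setT (fun p : RT * RT => F (p.1 + t * p.2, p.2)%R).
  apply: measurable_plane_map => //.
  by apply: measurable_funD => //; exact: measurable_funM.
rewrite (fubini_tonelli2 _ mF')// (fubini_tonelli2 _ mF)//.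
apply: eq_integral => y _; rewrite /fubini_G /=.
rewrite [RHS](integral_shift (t * y)%R)//; last exact: measurable_fun_pair1.
by apply: eq_integral => x _; rewrite addrC.
Qed.

Lemma integral_shear2 (t : R) (F : RT * RT -> \bar R) :
  measurable_fun setT F -> (forall p, 0 <= F p) ->
  \int[leb2]_p F (p.1, p.2 + t * p.1)%R = \int[leb2]_p F p.
Proof.
move=> mF F0.
have mF' : measurable_fun setT (fun p : RT * RT => F (p.1, p.2 + t * p.1)%R).
  apply: measurable_plane_map => //.
  by apply: measurable_funD => //; exact: measurable_funM.
rewrite (fubini_tonelli1 _ mF')// (fubini_tonelli1 _ mF)//.
apply: eq_integral => x _; rewrite /fubini_F /=.
rewrite [RHS](integral_shift (t * x)%R)//; last exact: measurable_fun_pair2.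
by apply: eq_integral => y _; rewrite addrC.
Qed.

Lemma integral_translation (q : R * R) (F : RT * RT -> \bar R) :
  measurable_fun setT F -> (forall p, 0 <= F p) ->
  \int[leb2]_p F (q.1 + p.1, q.2 + p.2)%R = \int[leb2]_p F p.
Proof.
move=> mF F0.
have mF' : measurable_fun setT (fun p : RT * RT => F (q.1 + p.1, q.2 + p.2)%R).
  by apply: measurable_plane_map => //; exact: measurable_funD.
rewrite (fubini_tonelli1 _ mF')// (fubini_tonelli1 _ mF)//.
rewrite [RHS](integral_shift q.1)//; last 2 first.
- exact: measurable_fun_fubini_tonelli_F.
- by move=> x; exact: integral_ge0.
apply: eq_integral => x _; rewrite /fubini_F /=.
by rewrite [RHS](integral_shift q.2)//; exact: measurable_fun_pair2.
Qed.

(** A rotation by an angle other than a half turn is a product of three shears;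
    the half turn is the square of a quarter turn. *)
Lemma integral_rotation (c s : R) (F : RT * RT -> \bar R) :
  (c ^+ 2 + s ^+ 2 = 1)%R ->
  measurable_fun setT F -> (forall p, 0 <= F p) ->
  \int[leb2]_p F (c * p.1 - s * p.2, s * p.1 + c * p.2)%R = \int[leb2]_p F p.
Proof.
have rot1 (c' s' : R) (G : RT * RT -> \bar R) : (c' ^+ 2 + s' ^+ 2 = 1)%R -> (c' != -1)%R ->
    measurable_fun setT G -> (forall p, 0 <= G p) ->
    \int[leb2]_p G (c' * p.1 - s' * p.2, s' * p.1 + c' * p.2)%R = \int[leb2]_p G p.
  move=> cs c1 mG G0.
  have c1' : (1 + c' != 0)%R by rewrite addrC -[X in (_ + X)%R]opprK subr_eq0.
  (* the tangent of half the angle *)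
  pose t := (s' / (1 + c'))%R.
  have mG1 : measurable_fun setT (fun p : RT * RT => G (p.1 + - t * p.2, p.2)%R).
    apply: measurable_plane_map => //.
    by apply: measurable_funD => //; exact: measurable_funM.
  have mG2 : measurable_fun setT (fun p : RT * RT =>
      G (p.1 + - t * (p.2 + s' * p.1), p.2 + s' * p.1)%R).
    apply: (@measurable_plane_map _ _ (fun p => G (p.1 + - t * p.2, p.2)%R)) => //.
    by apply: measurable_funD => //; exact: measurable_funM.
  rewrite -[RHS](integral_shear1 (- t))//.
  rewrite -[RHS](integral_shear2 s')//= -[RHS](integral_shear1 (- t))//=.
  have ss : (s' ^+ 2 = (1 - c') * (1 + c'))%R.
    have -> : (s' ^+ 2 = 1 - c' ^+ 2)%R by rewrite -cs addrAC subrr add0r.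
    by ring.
  apply: eq_integral => -[x y] _ /=; congr (G (_, _)).
    have e1 : (s' * t = 1 - c')%R by rewrite /t mulrA -expr2 ss mulfK.
    have e2 : (t * (1 + c') = s')%R by rewrite /t mulfVK.
    rewrite -[in LHS]e2.
    have -> : (x + - t * y + - t * (y + s' * (x + - t * y)) =
      (1 - s' * t) * x - t * (2 - s' * t) * y)%R by ring.
    by rewrite e1; ring.
  have e1 : (s' * t = 1 - c')%R by rewrite /t mulrA -expr2 ss mulfK.
  have -> : (y + s' * (x + - t * y) = s' * x + (1 - s' * t) * y)%R by ring.
  by rewrite e1; ring.
move=> cs mF F0; have [c1|c1] := eqVneq c (-1)%R; last exact: rot1.
have s0 : s = 0%R.
  by apply/eqP; rewrite -sqrf_eq0 -(inj_eq (addrI (c ^+ 2)%R)) cs c1 sqrrN expr1n addr0.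
have mF1 : measurable_fun setT (fun p : RT * RT => F (0 * p.1 - 1 * p.2, 1 * p.1 + 0 * p.2)%R).
  apply: measurable_plane_map => //.
    by apply: measurable_funB => //; exact: measurable_funM.
  by apply: measurable_funD => //; exact: measurable_funM.
have c01 : (0 ^+ 2 + 1 ^+ 2 = 1 :> R)%R by rewrite expr1n expr0n add0r.
have cN : (0 != -1 :> R)%R by rewrite eq_sym oppr_eq0 oner_eq0.
rewrite -[RHS](rot1 0%R 1%R)// -[RHS](rot1 0%R 1%R)//.
apply: eq_integral => -[x y] _ /=; rewrite c1 s0; congr (F (_, _)); ring.
Qed.

(** On each vertical line substitute y = |x| u, so that x^2 + y^2 becomes
    x^2 (1 + u^2); then exchange the integrals and rescale x for each u. This
    takes the place of polar coordinates: the angular variable is the arc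
    tangent of u. *)
Lemma radial_integral_cst (h : R -> \bar R) :
  measurable_fun setT h -> (forall x, 0 <= h x) ->
  \int[leb2]_p h (p.1 ^+ 2 + p.2 ^+ 2)%R =
  \int[leb]_u ((1 + u ^+ 2)^-1)%:E * \int[leb]_t (`|t|%:E * h (t ^+ 2)%R).
Proof.
move=> mh h0.
have mF : measurable_fun setT (fun p : RT * RT => h (p.1 ^+ 2 + p.2 ^+ 2)%R).
  by apply: measurableT_comp => //; apply: measurable_funD; exact: measurable_funX.
pose G (p : RT * RT) := (`|p.1|%:E * h (p.1 ^+ 2 * (1 + p.2 ^+ 2))%R).
have mG : measurable_fun setT G.
  apply: emeasurable_funM.
    by apply/measurable_EFinP; exact: measurableT_comp.
  apply: measurableT_comp => //; apply: measurable_funM; first exact: measurable_funX.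
  by apply: measurable_funD => //; exact: measurable_funX.
have G0 p : 0 <= G p by rewrite mule_ge0// lee_fin.
rewrite fubini_tonelli1//.
transitivity (\int[leb]_x \int[leb]_u G (x, u)).
  apply: ae_eq_integral => //.
  - exact: measurable_fun_fubini_tonelli_F.
  - exact: measurable_fun_fubini_tonelli_F.
  exists [set 0%R]; split => //; first exact: lebesgue_measure_set1.
  move=> x /= H; apply: contrapT => x0; apply: H => _.
  have {}x0 : (0 < `|x|)%R by rewrite normr_gt0; exact/eqP.
  have mhx : measurable_fun [set: RT] (fun y : RT => h (x ^+ 2 + y ^+ 2)%R).
    exact: (measurable_fun_pair2 (f := fun p : RT * RT => h (p.1 ^+ 2 + p.2 ^+ 2)%R)).
  rewrite /fubini_F (integral_affine 0%R x0)//= -ge0_integralZl//=.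
  - apply: eq_integral => u _; rewrite /G/=; congr (_ * h _).
    by rewrite add0r exprMn real_normK ?num_real//; ring.
  - apply: measurableT_comp => //; apply: measurable_funD => //.
    by apply: measurable_funX; apply: measurable_funD => //; exact: measurable_funM.
rewrite fubini_tonelli//.
set K := \int[leb]_t (`|t|%R%:E * _).
have mK : measurable_fun [set: RT] (fun t : RT => (`|t|%:E * h (t ^+ 2)%R)).
  apply: emeasurable_funM; first by apply/measurable_EFinP; exact: normr_measurable.
  by apply: measurableT_comp => //; exact: measurable_funX.
have K0 : 0 <= K by apply: integral_ge0 => t _; rewrite mule_ge0// lee_fin.
have mI : measurable_fun [set: RT] (fun u : RT => ((1 + u ^+ 2)^-1)%:E : \bar R).
  apply/measurable_EFinP; apply: continuous_measurable_fun => u.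
  apply: (@continuousV _ _ (fun u : R => 1 + u ^+ 2)%R).
    by rewrite gt_eqF// ltr_pwDl// sqr_ge0.
  by apply: continuousD; [exact: cst_continuous|exact: exprn_continuous].
rewrite -ge0_integralZr//; last first.
  by move=> u _; rewrite lee_fin invr_ge0 addr_ge0// sqr_ge0.
apply: eq_integral => u _.
have u0 : (0 < 1 + u ^+ 2)%R by rewrite ltr_pwDl// sqr_ge0.
pose s := Num.sqrt (1 + u ^+ 2)%R.
have s0 : (0 < s)%R by rewrite sqrtr_gt0.
have s2 : (s ^+ 2 = 1 + u ^+ 2)%R by rewrite sqr_sqrtr// ltW.
have mGu : measurable_fun [set: RT] (fun x : RT => G (x, u)).
  exact: measurable_fun_pair1.
rewrite /K (integral_affine 0%R s0 mK); last by move=> t; rewrite mule_ge0// lee_fin.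
have -> : \int[leb]_x (`|0 + s * x|%R%:E * h ((0 + s * x) ^+ 2)%R) =
    s%:E * \int[leb]_x G (x, u).
  rewrite -ge0_integralZl//=; last by rewrite lee_fin ltW.
  apply: eq_integral => x _; rewrite /G /= add0r normrM gtr0_norm// EFinM muleA.
  by rewrite exprMn s2 (mulrC (x ^+ 2)%R).
by rewrite (muleA s%:E) -EFinM -expr2 s2 muleA -EFinM mulVf ?mul1e// gt_eqF.
Qed.

End Plane.

Section GaussianMoments.
Variable R : realType.
Local Notation RT := (measurableTypeR R).
Local Notation leb := (@lebesgue_measure R).
Local Notation leb2 := (leb \x leb)%E.

(** An antiderivative of s^n e^(-s) / n!. *)
Let P (n : nat) (s : R) : R := - \sum_(j < n.+1) s ^+ j / j`!%:R * expR (- s).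

Let dP n (s : R) : is_derive s 1 (P n) (s ^+ n / n`!%:R * expR (- s)).
Proof.
have dE : is_derive s 1 (fun s : R => expR (- s)) (- expR (- s)).
  rewrite -[X in is_derive _ _ _ X]mulrN1.
  exact: is_derive1_comp.
elim: n => [|n ih].
  rewrite (_ : P 0 = fun s => - expR (- s)); last first.
    by apply/funext => t; rewrite /P big_ord1 expr0 fact0 divr1 mul1r.
  by rewrite expr0 fact0 divr1 mul1r -[X in is_derive _ _ _ X]opprK; exact: is_deriveN.
rewrite (_ : P n.+1 = P n - (fun s => (n.+1`!%:R)^-1 *: (s ^+ n.+1 * expR (- s)))); last first.
  apply/funext => t; rewrite /P big_ord_recr /= opprD.
  by rewrite [in RHS]/GRing.add /= /GRing.opp /= /GRing.scale /= mulrA (mulrC _^-1).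
have dX : is_derive s 1 (fun s : R => s ^+ n.+1) (n.+1%:R * s ^+ n).
  have := is_deriveX n.+1 (is_derive_id s 1).
  rewrite /GRing.scale /= mulr1; congr (is_derive _ _ _ _).
  by apply/funext => t; rewrite exprfctE.
have dM := is_deriveM dX dE.
have := is_deriveB ih (is_deriveZ (n.+1`!%:R)^-1 dM).
congr (is_derive _ _ _ _); rewrite /GRing.scale /= factS natrM.
by field; rewrite pnatr_eq0 -lt0n fact_gt0 /= nat1r pnatr_eq0.
Qed.

Let cvg_expM n : (fun s : R => s ^+ n * expR (- s)) s @[s --> +oo] --> (0 : R).
Proof.
apply/cvgrPdist_le => e e0; near=> s.
have s0 : 0 < s by near: s; exact: nbhs_pinfty_gt.
rewrite sub0r normrN ger0_norm; last by rewrite mulr_ge0 ?exprn_ge0 ?expR_ge0// ltW.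
have H : s ^+ n.+1 / (n.+1)`!%:R <= expR s.
  by apply: le_trans (expR_ge1Dxn n (ltW s0)); rewrite lerDr.
rewrite expRN ler_pdivrMr ?expR_gt0//.
apply: le_trans (_ : e * (s ^+ n.+1 / (n.+1)`!%:R) <= _); last by rewrite ler_pM2l.
rewrite (_ : e * _ = s ^+ n * (e * s / n.+1`!%:R)); last by rewrite exprS; ring.
rewrite ler_peMr ?exprn_ge0 ?(ltW s0)// ler_pdivlMr ?ltr0n ?fact_gt0// mul1r.
rewrite mulrC -ler_pdivrMr//.
Unshelve. all: end_near.
Qed.

Lemma gauss_moment (n : nat) (c : R) : 0 < c ->
  (\int[leb]_(r in `[0%R, +oo[) (r ^+ n.*2.+1 * expR (- (c * r ^+ 2)))%:E =
   (n`!%:R / (2 * c ^+ n.+1))%:E)%E.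
Proof.
move=> c0; pose k := n`!%:R / (2 * c ^+ n.+1).
pose F (r : R) := k *: P n (c * r ^+ 2).
have dF (r : R) : is_derive r 1 F (r ^+ n.*2.+1 * expR (- (c * r ^+ 2))).
  have d2 : is_derive r 1 (fun r : R => c * r ^+ 2) (c * (2 * r)).
    have := is_deriveZ c (is_deriveX 2 (is_derive_id r 1)).
    by rewrite /GRing.scale /= mulr1 expr1.
  have := is_deriveZ k (@is_derive1_comp _ _ (fun r => c * r ^+ 2) _ _ _ (dP n (c * r ^+ 2)) d2).
  congr (is_derive _ _ _ _); rewrite /GRing.scale /= /k.
  rewrite exprMn -exprM mul2n !exprS.
  by field; rewrite pnatr_eq0 -lt0n fact_gt0 /= ?expf_neq0 ?gt_eqF.
have P0 : P n 0 = -1.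
  rewrite /P big_ord_recl big1 => [|i _]; last by rewrite /= /bump /= exprS !mul0r.
  by rewrite expr0 fact0 divr1 mul1r oppr0 expR0 addr0.
have Py : P n s @[s --> +oo] --> (0 : R).
  elim: n {k F dF P0} => [|n ih].
    rewrite (_ : P 0 = fun s => - (s ^+ 0 * expR (- s))); last first.
      by apply/funext => t; rewrite /P big_ord1 expr0 fact0 divr1.
    by rewrite -[X in _ --> X]oppr0; apply: cvgN; exact: cvg_expM.
  rewrite (_ : P n.+1 = fun s => P n s - (n.+1`!%:R)^-1 * (s ^+ n.+1 * expR (- s))); last first.
    by apply/funext => t; rewrite /P big_ord_recr /= opprD mulrA (mulrC _^-1).
  rewrite -[X in _ --> X]subr0; apply: cvgB => //.
  by rewrite -[X in _ --> X](mulr0 (n.+1`!%:R)^-1); apply: cvgMl_tmp; exact: cvg_expM.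
have cf : continuous (fun x : R => x ^+ n.*2.+1 * expR (- (c * x ^+ 2))).
  move=> x; apply: (@continuousM _ _ (fun x : R => x ^+ n.*2.+1)
    (fun x : R => expR (- (c * x ^+ 2)))); first exact: exprn_continuous.
  apply: (@continuous_comp _ _ _ (fun x : R => - (c * x ^+ 2)) expR); last exact: continuous_expR.
  apply: (@continuousN _ _ _ (fun x : R => c * x ^+ 2)).
  apply: (@continuousM _ _ (fun=> c) (fun x : R => x ^+ 2)); first exact: cst_continuous.
  exact: exprn_continuous.
rewrite (@ge0_continuous_FTC2y _ _ F 0 0).
- rewrite /F expr0n mulr0 P0 /GRing.scale/= mulrN1 /k; congr EFin.
  by rewrite opprK add0r.
- by move=> x x0; rewrite mulr_ge0 ?exprn_ge0 ?expR_ge0.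
- exact: (continuous_subspaceT cf).
- rewrite -[X in _ --> X](mulr0 k); apply: cvgMl_tmp.
  by apply: (cvg_comp _ _ _ Py); apply: gt0_cvgMry => //; exact: cvgr_expr2.
- by move=> x _; have [] := dF x.
- apply: cvg_at_right_filter; apply: differentiable_continuous.
  by apply/derivable1_diffP; have [] := dF 0.
- by move=> x _; rewrite derive1E; have [_ ->] := dF x.
Qed.

Lemma gauss_moment_oo (n : nat) (c : R) : 0 < c ->
  (\int[leb]_(r in `]0%R, +oo[) (r ^+ n.*2.+1 * expR (- (c * r ^+ 2)))%:E =
   (n`!%:R / (2 * c ^+ n.+1))%:E)%E.
Proof.
move=> c0; rewrite -gauss_moment// integral_itv_obnd_cbnd//.
apply/measurable_EFinP; apply: measurable_funTS; apply: measurable_funM.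
  exact: measurable_funX.
apply: measurableT_comp => //; apply: measurable_funN.
by apply: measurable_funM => //; exact: measurable_funX.
Qed.

Lemma radial_integral_oo (h : R -> \bar R) :
  measurable_fun setT h -> (forall x, (0 <= h x)%E) ->
  (\int[leb]_t (`|t|%:E * h (t ^+ 2)%R) =
   2%:E * \int[leb]_(t in `]0%R, +oo[) (t%:E * h (t ^+ 2)%R))%E.
Proof.
move=> mh h0; rewrite integral_even.
- congr (_ * _)%E; apply: eq_integral => t.
  by rewrite inE/= in_itv/= andbT => t0; rewrite gtr0_norm.
- apply: emeasurable_funM.
    by apply/measurable_EFinP; exact: normr_measurable.
  by apply: measurableT_comp => //; exact: measurable_funX.
- by move=> t; rewrite mule_ge0// lee_fin.
- by move=> t; rewrite normrN sqrrN.
Qed.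

(** Evaluate both sides of [radial_integral_cst] on the Gaussian
    e^(-x^2-y^2), whose integral is the square of a known one. *)
Lemma integral_arctan_density :
  (\int[leb]_u ((1 + u ^+ 2)^-1)%:E = (pi : R)%:E)%E.
Proof.
have mg : measurable_fun [set: RT] (fun s : RT => (expR (- s))%:E : \bar R).
  by apply/measurable_EFinP; apply: measurableT_comp => //; exact: measurable_funN.
have g0 (s : R) : (0 <= (expR (- s))%:E)%E by rewrite lee_fin expR_ge0.
have := radial_integral_cst mg g0.
rewrite (radial_integral_oo mg g0).
have -> : (\int[leb]_(t in `]0%R, +oo[) (t%:E * (expR (- t ^+ 2))%:E) = (2^-1 : R)%:E)%E.
  have := gauss_moment_oo 0 ltr01; rewrite expr1n mulr1 fact0 div1r => <-.
  by apply: eq_integral => t _; rewrite -EFinM expr1 mul1r.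
rewrite -EFinM divff// mule1 => <-.
have mF : measurable_fun setT (fun p : RT * RT => (expR (- (p.1 ^+ 2 + p.2 ^+ 2)))%:E : \bar R).
  by apply: (measurableT_comp mg); apply: measurable_funD; exact: measurable_funX.
rewrite fubini_tonelli1//= /fubini_F.
transitivity (\int[leb]_x ((gauss_fun x)%:E * (Num.sqrt pi)%:E))%E.
  apply: eq_integral => x _; rewrite -integralT_gauss -ge0_integralZl//=; last 3 first.
  - by apply/measurable_EFinP; exact: measurable_gauss_fun.
  - by move=> y _; rewrite lee_fin gauss_fun_ge0.
  - by rewrite lee_fin gauss_fun_ge0.
  by apply: eq_integral => y _; rewrite /gauss_fun -EFinM -expRD opprD.
rewrite ge0_integralZr//; last 2 first.
- by apply/measurable_EFinP; exact: measurable_gauss_fun.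
- by move=> y _; rewrite lee_fin gauss_fun_ge0.
by rewrite integralT_gauss -EFinM -expr2 sqr_sqrtr// pi_ge0.
Qed.

Lemma radial_integral (h : R -> \bar R) :
  measurable_fun setT h -> (forall x, (0 <= h x)%E) ->
  (\int[leb2]_p h (p.1 ^+ 2 + p.2 ^+ 2)%R =
  (pi *+ 2)%:E * \int[leb]_(t in `]0%R, +oo[) (t%:E * h (t ^+ 2)%R))%E.
Proof.
move=> mh h0; rewrite radial_integral_cst// integral_arctan_density.
by rewrite radial_integral_oo// muleA -EFinM mulr_natr.
Qed.

End GaussianMoments.

(** * Averages of entire functions over circles *)

Section MeasurePreserving.
Context d (T : measurableType d) (R : realType).
Variables (mu : {measure set T -> \bar R}) (phi : T -> T).
Hypothesis mphi : measurable_fun setT phi.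
Hypothesis phiE : forall F : T -> \bar R, measurable_fun setT F ->
  (forall x, (0 <= F x)%E) -> (\int[mu]_x F (phi x) = \int[mu]_x F x)%E.

Lemma integrable_preserving (f : T -> R) : mu.-integrable setT (EFin \o f) ->
  mu.-integrable setT (EFin \o (fun x => f (phi x))).
Proof.
move=> /integrableP[mf fi]; apply/integrableP; split.
  exact: (measurableT_comp mf mphi).
rewrite (phiE (F := fun x => `|(f x)%:E|%E)) //.
exact: measurableT_comp.
Qed.

Lemma Rintegral_preserving (f : T -> R) : mu.-integrable setT (EFin \o f) ->
  \int[mu]_x f (phi x) = \int[mu]_x f x.
Proof.
move=> /measurable_int mf; rewrite /Rintegral; congr fine.
rewrite [LHS]integralE [RHS]integralE; congr (_ - _)%E.
- pose F := ((EFin \o f)^\+)%E.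
  have mF : measurable_fun setT F by exact: measurable_funepos.
  by rewrite -[RHS](phiE mF (fun x => funepos_ge0 _ x)); apply: eq_integral => x _; rewrite /F !funeposE.
- pose F := ((EFin \o f)^\-)%E.
  have mF : measurable_fun setT F by exact: measurable_funeneg.
  by rewrite -[RHS](phiE mF (fun x => funeneg_ge0 _ x)); apply: eq_integral => x _; rewrite /F !funenegE.
Qed.

Lemma cintegrable_preserving (f : T -> R[i]) : cintegrable mu setT f ->
  cintegrable mu setT (fun x => f (phi x)).
Proof.
by case=> f1 f2; split; [exact: (integrable_preserving f1)|exact: (integrable_preserving f2)].
Qed.

Lemma cint_preserving (f : T -> R[i]) : cintegrable mu setT f ->
  cint mu setT (fun x => f (phi x)) = cint mu setT f.
Proof.
case=> f1 f2; apply: complex_ext => /=.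
- exact: (Rintegral_preserving f1).
- exact: (Rintegral_preserving f2).
Qed.

End MeasurePreserving.

Section CircleAverages.
Variable R : realType.
Local Notation C := R[i].
Local Notation leb := (@lebesgue_measure R).
Local Notation twopi := ((pi : R) *+ 2).

Definition cis (t : R) : C := expC (0 +i* t).

Lemma cisD s t : cis (s + t) = cis s * cis t.
Proof.
by rewrite /cis -expCD; congr expC; apply: complex_ext; rewrite /= ?addr0.
Qed.

Lemma cis_2pi t : cis (t + twopi) = cis t.
Proof.
rewrite /cis -(expC_2pi (0 +i* t)); congr expC.
by apply: complex_ext; rewrite /= ?addr0.
Qed.

Lemma normc_cis t : normc (cis t) = 1.
Proof. by rewrite /cis normc_expC /= expR0. Qed.

Lemma conj_cis t : conjc (cis t) = cis (- t).
Proof. by rewrite /cis conj_expC. Qed.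

Lemma cisJ t : cis t * conjc (cis t) = 1.
Proof. by rewrite mulcJ normc_cis expr1n. Qed.

Lemma twopi_gt0 : 0 < twopi.
Proof. by rewrite mulr2n addr_gt0// pi_gt0. Qed.

Lemma Rintegral_itv_shift (h : R -> R) (a T : R) : continuous h ->
  \int[leb]_(y in `[0, T]) h (a + y) = \int[leb]_(y in `[a, a + T]) h y.
Proof.
move=> ch; rewrite Rintegral_mkcond [RHS]Rintegral_mkcond.
transitivity (\int[leb]_y (h \_ `[a, a + T]) (a + y)).
  apply: eq_Rintegral => y _; rewrite !patchE !mem_setE.
  by rewrite !in_itv/= lerDl lerD2l.
apply: (@Rintegral_preserving _ _ _ leb (fun y => a + y)).
- by move=> F mF F0; rewrite -integral_shift.
- have ih : leb.-integrable `[a, a + T] (EFin \o h).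
    apply: continuous_compact_integrable; first exact: segment_compact.
    exact: continuous_subspaceT.
  rewrite -restrict_EFin.
  by apply: (@integrable_mkcond _ _ _ leb `[a, a + T] (EFin \o h) _).1.
Qed.

Lemma cint_itv_shift (h : R -> C) (a T : R) : ccontinuous h ->
  cint leb `[0, T] (fun y => h (a + y)) = cint leb `[a, a + T] h.
Proof.
case=> h1 h2; apply: complex_ext => /=.
- exact: (Rintegral_itv_shift a T h1).
- exact: (Rintegral_itv_shift a T h2).
Qed.

Lemma cint_period_shift (h : R -> C) (a T : R) : 0 <= a <= T -> ccontinuous h ->
  (forall y, h (y + T) = h y) ->
  cint leb `[0, T] (fun y => h (a + y)) = cint leb `[0, T] h.
Proof.
move=> /andP[a0 aT] ch per.
rewrite cint_itv_shift// (@cint_split _ h a T (a + T))//; last by rewrite lerDr.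
rewrite (@cint_split _ h 0 a T)// addrC; congr (_ + _).
rewrite addrC -cint_itv_shift//.
by apply: eq_cint => y _; rewrite addrC per.
Qed.

Variables (f : C -> C) (ef : entire f).

Lemma entire_expN n : entire (fun z : C => expC ((- z) *+ n) : C^o).
Proof.
apply: (@entire_comp _ (@expC R) (fun z => (- z) *+ n)); first exact: entire_expC.
rewrite (_ : (fun z => (- z) *+ n) = fun z => 0 + (- n%:R) * z); first exact: entire_affine.
by apply/funext => z; rewrite add0r mulNr mulr_natl mulNrn.
Qed.

Lemma circle_ccontinuous (w : C) n : ccontinuous (fun t => f (cis t * w) * cis (- t) ^+ n).
Proof.
pose g (z : C) : C := f (expC z * w) * expC ((- z) *+ n).
have eg : entire g.
  apply: entireM; last exact: entire_expN.
  apply: (@entire_comp _ f (fun z => expC z * w)); first exact: ef.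
  by apply: (@entireM _ (@expC R) (fun=> w)); [exact: entire_expC|exact: entire_cst].
have := vertical_ccontinuous eg 0; congr ccontinuous.
apply/funext => t; rewrite /g /cis expC_natmul; congr (f _ * expC _ ^+ n).
by apply: complex_ext; rewrite !ReImE /= ?oppr0.
Qed.

Let avg n : C := cint leb `[0, twopi] (fun t => f (cis t) * cis (- t) ^+ n) / twopi%:C.

(** In logarithmic coordinates the circle integral becomes the integral of a
    periodic entire function over a vertical period, which Goursat's theorem
    allows to be moved; hence the average is homogeneous in [w]. *)
Lemma circle_coef_neq0 (w : C) n : w != 0 ->
  cint leb `[0, twopi] (fun t => f (cis t * w) * cis (- t) ^+ n) =
  twopi%:C * (avg n * w ^+ n).
Proof.
move=> w0; have [z zw zi] := expC_surj w0.
pose a := complex.Im z; pose s := complex.Re z.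
pose g (u : C) : C := f (expC (0 +i* a + u)) * expC ((- (0 +i* a + u)) *+ n).
have eg : entire g.
  pose k (z : C) : C := f (expC z) * expC ((- z) *+ n).
  apply: (@entire_comp _ k (fun u => 0 +i* a + u)).
    apply: entireM; last exact: entire_expN.
    by apply: (@entire_comp _ f (@expC R)); [exact: ef|exact: entire_expC].
  rewrite (_ : (fun u => _) = fun u => 0 +i* a + 1 * u); first exact: entire_affine.
  by apply/funext => u; rewrite mul1r.
have per x : g (x +i* twopi) = g (x +i* 0).
  rewrite /g !expC_natmul !expCN.
  have -> : expC (0 +i* a + x +i* twopi) = expC (0 +i* a + x +i* 0).
    by rewrite -(expC_2pi (_ + x +i* 0)); congr expC; apply: complex_ext; rewrite /= ?addr0.
  by [].
have gE x y : g (x +i* y) = f (cis y * expC (x +i* a)) * (cis (- y) ^+ n * (expC (x +i* a) ^+ n)^-1).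
  rewrite /g !expC_natmul -exprVn -exprMn -expCN /cis -!expCD; congr (f (expC _) * expC _ ^+ n);
  by apply: complex_ext; rewrite !ReImE /=; ring.
have e1 : cint leb `[0, twopi] (fun t => f (cis t * w) * cis (- t) ^+ n) =
    w ^+ n * cint leb `[0, twopi] (fun y => g (s +i* y)).
  rewrite -cintZ//; last by apply: ccontinuous_integrable; exact: vertical_ccontinuous.
  apply: eq_cint => y _; rewrite gE (_ : expC (s +i* a) = w); last by rewrite -zw; congr expC; rewrite /s /a; case: (z).
  by rewrite mulrCA; congr (_ * _); rewrite mulrCA mulfV ?mulr1// expf_neq0.
rewrite e1 (vertical_period_int eg s 0 twopi_gt0 per).
have -> : (fun y => g (0 +i* y)) = (fun y => f (cis (a + y) * 1) * cis (- (a + y)) ^+ n).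
  apply/funext => y; rewrite gE mulr1 cisD (mulrC (cis a)) opprD cisD exprMn -/(cis a).
  by congr (_ * _); rewrite mulrC -exprVn /cis -expCN; congr (expC _ ^+ _ * _); apply: complex_ext; rewrite /= ?oppr0.
rewrite (@cint_period_shift (fun y => f (cis y * 1) * cis (- y) ^+ n) a twopi)//; last 2 first.
- exact: circle_ccontinuous.
- move=> y; rewrite cis_2pi; congr (_ * _ ^+ _).
  by rewrite -(cis_2pi (- (y + _))) opprD addrNK.
rewrite [LHS]mulrC [RHS]mulrA; congr (_ * _); rewrite /avg [RHS]mulrC mulfVK; last first.
  by rewrite eq_complex /= eqxx andbT gt_eqF// twopi_gt0.
by apply: eq_cint => y _; rewrite mulr1.
Qed.

Lemma cint_circle_cst (c : C) : cint leb `[0, twopi] (fun=> c) = twopi%:C * c.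
Proof. by rewrite cint_cst ?subr0// ltW// twopi_gt0. Qed.

(** The average over a circle does not depend on its radius, by homogeneity, and
    it tends to [f 0] with the radius. *)
Lemma circle_mean (w : C) :
  cint leb `[0, twopi] (fun t => f (cis t * w)) = twopi%:C * f 0.
Proof.
have E (z : C) : cint leb `[0, twopi] (fun t => f (cis t * z)) =
    cint leb `[0, twopi] (fun t => f (cis t * z) * cis (- t) ^+ 0).
  by apply: eq_cint => t _; rewrite expr0 mulr1.
have [->|w0] := eqVneq w 0.
  by rewrite -cint_circle_cst; apply: eq_cint => t _; rewrite mulr0.
rewrite E circle_coef_neq0// expr0 mulr1; congr (_ * _).
apply/eqP; rewrite -subr_eq0 -normc_eq0; apply/eqP/le_anti.
rewrite normc_ge0 andbT; apply/ler_addgt0Pr => e e0; rewrite add0r.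
have [l fl] := (entireP f).1 ef 0.
have e20 : 0 < e / 2 by rewrite divr_gt0.
have [d d0 H] := cdiff_continuous fl e20.
pose r : C := (d / 2)%:C.
have r0 : r != 0 by rewrite eq_complex /= eqxx andbT gt_eqF// divr_gt0.
have rd : normc r < d by rewrite normc_real gtr0_norm ?divr_gt0//; lra.
have cr : ccontinuous (fun t => f (cis t * r)).
  have := circle_ccontinuous r 0; congr ccontinuous.
  by apply/funext => t; rewrite expr0 mulr1.
have : normc (cint leb `[0, twopi] (fun t => f (cis t * r) - f 0)) <= 2 * (e / 2 * (twopi - 0)).
  apply: normc_cint_bound; first by rewrite ltW// twopi_gt0.
    by apply: ccontinuousB => //; exact: ccontinuous_cst.
  move=> t _; have := H (cis t * r); rewrite add0r; apply.
  by rewrite normcM normc_cis mul1r.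
rewrite cintB//; try exact: ccontinuous_integrable; last first.
  by apply: ccontinuous_integrable; exact: ccontinuous_cst.
rewrite E circle_coef_neq0// expr0 mulr1 cint_circle_cst -mulrBr normcM normc_real.
rewrite gtr0_norm ?twopi_gt0// subr0 mulrA (mulrC 2) divfK// mulrC.
by rewrite ler_pM2r// twopi_gt0.
Qed.

End CircleAverages.

Section CircleCoefficients.
Variable R : realType.
Local Notation C := R[i].
Local Notation leb := (@lebesgue_measure R).
Local Notation twopi := ((pi : R) *+ 2).

(** Homogeneity of the average for the constant function 1: the integral does
    not change when it is multiplied by 2 ^ n.+1. *)
Lemma cint_cis0 n : cint leb `[0, twopi] (fun t => cis (- t) ^+ n.+1) = 0 :> C.
Proof.
have ec : entire (fun=> 1 : C) := @entire_cst R 1.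
have E : cint leb `[0, twopi] (fun t => cis (- t) ^+ n.+1) =
    cint leb `[0, twopi] (fun t => (1 : C) * cis (- t) ^+ n.+1).
  by apply: eq_cint => t _; rewrite mul1r.
have n20 : (2 : C) != 0 by rewrite pnatr_eq0.
have E1 := etrans E (circle_coef_neq0 ec n.+1 (oner_neq0 C)).
have E2 := etrans E (circle_coef_neq0 ec n.+1 n20).
move: E1 E2; set I := cint _ _ _; set c := (X in _ = _ * (X * _)) => E1 E2.
have : I * 2 ^+ n.+1 = I by rewrite {1}E1 E2 expr1n mulr1 mulrA.
move=> /eqP; rewrite -subr_eq0 -{2}[I]mulr1 -mulrBr mulf_eq0 => /orP[/eqP//|].
by rewrite subr_eq0 -natrX pnatr_eq1 expnS => /eqP/(congr1 odd); rewrite oddM.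
Qed.

(** The constant c is the n-th Taylor coefficient of f; it is found as the average
    over the unit circle. *)
Lemma circle_coef (f : C -> C) n : entire f -> exists c : C, forall w,
  cint leb `[0, twopi] (fun t => f (cis t * w) * cis (- t) ^+ n) =
  twopi%:C * (c * w ^+ n).
Proof.
move=> ef; eexists => w; have [->|w0] := eqVneq w 0; last exact: circle_coef_neq0.
case: n => [|n].
  rewrite expr0 mulr1.
  transitivity (cint leb `[0, twopi] (fun t => f (cis t * 1) * cis (- t) ^+ 0)).
    rewrite [RHS](_ : _ = cint leb `[0, twopi] (fun t => f (cis t * 1))).
      rewrite circle_mean// -(circle_mean ef 0).
      by apply: eq_cint => t _; rewrite expr0 mulr1.
    by apply: eq_cint => t _; rewrite expr0 mulr1.
  by rewrite circle_coef_neq0 ?oner_neq0// expr0 mulr1.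
rewrite exprS mul0r !mulr0.
transitivity (cint leb `[0, twopi] (fun t => f 0 * cis (- t) ^+ n.+1)).
  by apply: eq_cint => t _; rewrite mulr0.
rewrite cintZ ?cint_cis0 ?mulr0//; apply: ccontinuous_integrable.
have := circle_ccontinuous (@entire_cst R 1) 0 n.+1; congr ccontinuous.
by apply/funext => t; rewrite mul1r.
Qed.

End CircleCoefficients.

(** * Area integrals by angular averaging *)

Section PlaneIntegrals.
Variable R : realType.
Local Notation C := R[i].
Local Notation RT := (measurableTypeR R).
Local Notation leb := (@lebesgue_measure R).
Local Notation leb2 := (leb \x leb)%E.
Local Notation twopi := ((pi : R) *+ 2).

Lemma measurable_cosine : measurable_fun [set: RT] (cos : RT -> R).
Proof. by apply: continuous_measurable_fun; exact: continuous_cos. Qed.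

Lemma measurable_sine : measurable_fun [set: RT] (sin : RT -> R).
Proof. by apply: continuous_measurable_fun; exact: continuous_sin. Qed.

Lemma cis_ofR2 (t : R) (p : R * R) : cis t * ofR2 p =
  ofR2 (cos t * p.1 - sin t * p.2, sin t * p.1 + cos t * p.2).
Proof.
apply: complex_ext; rewrite ReImE /cis /expC /ofR2 /= expR0 !mul1r//.
by rewrite addrC.
Qed.

Lemma plane_sigma_finite : sigma_finite setT leb2.
Proof.
have /sigma_finiteP[F [TF ndF Foo]] := sigma_finiteT leb.
exists (fun n => F n `*` F n).
  rewrite -setXTT TF predeqE => -[x y]; split.
    move=> [/= [n _ Fnx] [k _ Gky]]; exists (maxn n k) => //; split.
    - by move: x Fnx; exact/subsetPset/ndF/leq_maxl.
    - by move: y Gky; exact/subsetPset/ndF/leq_maxr.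
  by move=> [n _ []/= ? ?]; split; exists n.
move=> k; have [? ?] := Foo k; split; first exact: measurableX.
by rewrite product_measure1E// lte_mul_pinfty// ge0_fin_numE.
Qed.

(** The area with its sigma-finiteness attached, to form a further product with
    the measure of the angle. *)
Definition plane_measure : {sigma_finite_measure set (RT * RT)%type -> \bar R} :=
  HB.pack leb2 (Measure_isSigmaFinite.Build _ _ _ leb2 plane_sigma_finite).

(** The integral of u equals that of each of its rotates. Averaging over the
    angle and exchanging the integrals turns u into its angular average v. *)
Lemma angular_average_real (u v : C -> R) :
  leb2.-integrable setT (EFin \o (fun p => u (ofR2 p))) ->
  (forall w, leb.-integrable `[0, twopi] (EFin \o (fun t => u (cis t * w)))) ->
  (forall w, \int[leb]_(t in `[0, twopi]) u (cis t * w) = twopi * v w) ->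
  leb2.-integrable setT (EFin \o (fun p => v (ofR2 p))) /\
  \int[leb2]_p v (ofR2 p) = \int[leb2]_p u (ofR2 p).
Proof.
move=> ui uc uv.
have mu2 : measurable_fun [set: RT * RT] (fun p : RT * RT => u (ofR2 p)).
  by have /measurable_int/measurable_EFinP := ui.
have mrot : measurable_fun [set: RT * RT * RT] (fun q : RT * RT * RT =>
    u (cis q.2 * ofR2 q.1)).
  under eq_fun do rewrite cis_ofR2.
  apply: (measurableT_comp mu2); apply: measurable_fun_pair.
  - apply: measurable_funB; apply: measurable_funM; try
      by [apply: (measurableT_comp measurable_cosine)|apply: (measurableT_comp measurable_sine)];
      by apply: measurableT_comp.
  - apply: measurable_funD; apply: measurable_funM; try
      by [apply: (measurableT_comp measurable_cosine)|apply: (measurableT_comp measurable_sine)];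
      by apply: measurableT_comp.
pose Phi (q : RT * RT * RT) := (\1_(`[0, twopi]%classic) q.2 * u (cis q.2 * ofR2 q.1))%:E.
have mPhi : measurable_fun setT Phi.
  apply/measurable_EFinP; apply: measurable_funM => //.
  by apply: measurableT_comp => //; exact: measurable_indic.
have rotE (t : R) (F : RT * RT -> \bar R) : measurable_fun setT F -> (forall p, (0 <= F p)%E) ->
   (\int[leb2]_p F (cos t * p.1 - sin t * p.2, sin t * p.1 + cos t * p.2)%R = \int[leb2]_p F p)%E.
  by move=> mF F0; apply: integral_rotation => //; exact: cos2Dsin2.
have mrotp (t : R) : measurable_fun [set: RT * RT] (fun p : RT * RT =>
    (cos t * p.1 - sin t * p.2, sin t * p.1 + cos t * p.2) : RT * RT).
  apply: measurable_fun_pair.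
    by apply: measurable_funB; exact: measurable_funM.
  by apply: measurable_funD; exact: measurable_funM.
have leb01 : (\int[leb]_t (\1_(`[0%R, twopi]%classic) t)%:E = twopi%:E)%E.
  transitivity (leb `[0, twopi]); first by rewrite integral_indic ?setIT.
  rewrite lebesgue_measure_itv/= lte_fin twopi_gt0.
  by rewrite -EFinD subr0.
have iPhi : (plane_measure \x leb)%E.-integrable setT Phi.
  apply: (iffRL (integrable21ltyP plane_measure leb mPhi)).
  have /integrableP[_ ufin] := ui.
  set K := (X in (X < _)%E) in ufin.
  have K0 : (0 <= K)%E by apply: integral_ge0.
  rewrite (_ : (\int[leb]_x _)%E = (\int[leb]_t ((\1_(`[0%R, twopi]%classic) t)%:E * K))%E).
    rewrite ge0_integralZr//=; last first.
      by apply/measurable_EFinP; exact: measurable_indic.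
    by rewrite leb01 lte_mul_pinfty// lee_fin ltW// twopi_gt0.
  apply: eq_integral => t _.
  have mabs : measurable_fun setT (fun p : RT * RT => `|(u (ofR2 p))%:E|%E).
    by apply: measurableT_comp => //; apply/measurable_EFinP.
  have -> : K = (\int[leb2]_p `|(u (cis t * ofR2 p))%:E|)%E.
    rewrite /K -[LHS](rotE t _ mabs)//.
    by apply: eq_integral => p _; rewrite cis_ofR2.
  rewrite -ge0_integralZl//=; first last.
  - apply/measurable_EFinP; apply: measurableT_comp; first exact: normr_measurable.
    exact: (measurable_fun_pair1 (f := fun q : RT * RT * RT => u (cis q.2 * ofR2 q.1)) t mrot).
  apply: eq_integral => p _.
  by rewrite normrM -EFinM; congr (_ * _)%:E; rewrite ger0_norm.
have FE t : fubini_G plane_measure Phi t = ((\1_(`[0%R, twopi]%classic) t)%:E * (\int[leb2]_p u (ofR2 p))%:E)%E.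
  rewrite /fubini_G /Phi /=.
  under eq_integral do rewrite EFinM.
  have ui' : leb2.-integrable setT (EFin \o (fun p : RT * RT => u (cis t * ofR2 p))).
    under eq_fun do rewrite /= cis_ofR2.
    exact: (integrable_preserving (mrotp t) (rotE t) ui).
  rewrite integralZl//; congr (_ * _)%E.
  rewrite -(Rintegral_preserving (rotE t) ui).
  rewrite /Rintegral fineK; last first.
    apply: (integrable_fin_num (mu := leb2)) => //.
    exact: (integrable_preserving (mrotp t) (rotE t) ui).
  by apply: eq_integral => p _; rewrite cis_ofR2.
have GE p : fubini_F leb Phi p = (twopi * v (ofR2 p))%:E.
  have mD : measurable (`[0, twopi]%classic : set RT) by [].
  have ifin := integrable_fin_num mD (uc (ofR2 p)).
  rewrite /fubini_F /Phi /= -uv /Rintegral fineK //.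
  rewrite [RHS]integral_mkcond; apply: eq_integral => t _.
  by rewrite patchE indicE; case: ifP => _; rewrite ?mul1r ?mul0r.
have t0 : twopi != 0 by rewrite gt_eqF// twopi_gt0.
have iv : leb2.-integrable setT (EFin \o (fun p => v (ofR2 p))).
  have := integrableZl measurableT twopi^-1 (integrable_fubini_F iPhi).
  apply: eq_integrable => // p _ /=.
  by rewrite GE -EFinM mulrA mulVf// mul1r.
split => //.
have i1 : leb.-integrable setT (fun t => (\1_(`[0%R, twopi]%classic) t)%:E).
  by apply/integrableP; split; [apply/measurable_EFinP; exact: measurable_indic|
    under eq_integral do rewrite /= ger0_norm//; rewrite leb01 ltry].
have e1 : (\int[plane_measure]_p fubini_F leb Phi p =
    twopi%:E * \int[leb2]_p (v (ofR2 p))%:E)%E.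
  by rewrite -integralZl//; apply: eq_integral => p _; rewrite GE.
have e2 : (\int[leb]_t fubini_G plane_measure Phi t =
    twopi%:E * (\int[leb2]_p u (ofR2 p))%:E)%E.
  by rewrite -leb01 -integralZr//; apply: eq_integral => t _; rewrite FE.
have e3 : (\int[plane_measure]_p fubini_F leb Phi p =
    \int[leb]_t fubini_G plane_measure Phi t)%E.
  by rewrite integral12_prod_meas1// integral21_prod_meas1.
move: e3; rewrite e1 e2 -[X in (_ * X)%E]fineK; last exact: (integrable_fin_num (mu := leb2)).
by rewrite -!EFinM => -[] /(mulfI t0).
Qed.

End PlaneIntegrals.

Section AreaIntegral.
Variable R : realType.
Local Notation C := R[i].
Local Notation RT := (measurableTypeR R).
Local Notation leb := (@lebesgue_measure R).
Local Notation leb2 := (leb \x leb)%E.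
Local Notation twopi := ((pi : R) *+ 2).
Implicit Types (f g A : C -> C) (w z c : C).

Definition aintegrable g := cintegrable leb2 setT (fun p => g (ofR2 p)).
Definition aint g : C := cint leb2 setT (fun p => g (ofR2 p)).

Lemma angular_average g A : aintegrable g ->
  (forall w, cintegrable leb `[0, twopi] (fun t => g (cis t * w))) ->
  (forall w, cint leb `[0, twopi] (fun t => g (cis t * w)) = twopi%:C * A w) ->
  aintegrable A /\ aint A = aint g.
Proof.
case=> g1 g2 gc gA.
have [|w|a1 e1] := @angular_average_real _ (fun w => complex.Re (g w)) (fun w => complex.Re (A w)) g1.
- by move=> w; have [] := gc w.
- by have := congr1 (@complex.Re R) (gA w); rewrite ReImE /= mul0r subr0.
have [|w|a2 e2] := @angular_average_real _ (fun w => complex.Im (g w)) (fun w => complex.Im (A w)) g2.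
- by move=> w; have [] := gc w.
- by have := congr1 (@complex.Im R) (gA w); rewrite ReImE /= mul0r addr0.
by split; [split|apply: complex_ext].
Qed.

Lemma mul_conjX w n : w ^+ n * conjc w ^+ n = (normc w ^+ n.*2)%:C.
Proof. by rewrite -exprMn mulcJ -rmorphXn /= -exprM mul2n. Qed.

(** Only the [n]-th Taylor coefficient of [f] contributes to the integral of
    [f] against [conj w ^+ n] and a radial weight. *)
Lemma aint_circle_coef f n (H : R -> C) c : entire f ->
  (forall w, cint leb `[0, twopi] (fun t => f (cis t * w) * cis (- t) ^+ n) =
     twopi%:C * (c * w ^+ n)) ->
  aintegrable (fun w => f w * conjc w ^+ n * H (normc w)) ->
  aintegrable (fun w => c * ((normc w ^+ n.*2)%:C * H (normc w))) /\
  aint (fun w => c * ((normc w ^+ n.*2)%:C * H (normc w))) =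
  aint (fun w => f w * conjc w ^+ n * H (normc w)).
Proof.
move=> ef fc ig.
have E w t : f (cis t * w) * conjc (cis t * w) ^+ n * H (normc (cis t * w)) =
    (conjc w ^+ n * H (normc w)) * (f (cis t * w) * cis (- t) ^+ n).
  by rewrite normcM normc_cis mul1r conjc_mul exprMn conj_cis; ring.
have ii w : cintegrable leb `[0, twopi] (fun t => f (cis t * w) * cis (- t) ^+ n).
  by apply: ccontinuous_integrable; exact: circle_ccontinuous.
apply: angular_average => // w.
  under [X in cintegrable _ _ X]eq_fun do rewrite E.
  by apply: cintegrableZ; [|exact: ii].
transitivity (cint leb `[0, twopi] (fun t => (conjc w ^+ n * H (normc w)) *
    (f (cis t * w) * cis (- t) ^+ n))).
  by apply: eq_cint => t _; rewrite E.
by rewrite cintZ// fc -mul_conjX; ring.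
Qed.

Lemma measurable_translation z : measurable_fun [set: RT * RT]
  (fun p : RT * RT => (complex.Re z + p.1, complex.Im z + p.2) : RT * RT).
Proof. by apply: measurable_fun_pair; exact: measurable_funD. Qed.

Lemma aint_translation g z : aintegrable g ->
  aintegrable (fun w => g (z + w)) /\ aint (fun w => g (z + w)) = aint g.
Proof.
move=> ig; pose phi (p : RT * RT) : RT * RT := (complex.Re z + p.1, complex.Im z + p.2).
have E (p : RT * RT) : z + ofR2 p = ofR2 (phi p).
  by apply: complex_ext; rewrite ReImE.
have phiE (F : RT * RT -> \bar R) : measurable_fun setT F -> (forall p, (0 <= F p)%E) ->
    (\int[leb2]_p F (phi p) = \int[leb2]_p F p)%E.
  by move=> mF F0; rewrite -(integral_translation (complex.Re z, complex.Im z) mF F0).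
split.
- rewrite /aintegrable; under eq_fun do rewrite E.
  exact: (cintegrable_preserving (measurable_translation z) phiE ig).
- rewrite /aint -(cint_preserving phiE ig).
  by apply: eq_cint => p _; rewrite E.
Qed.

Lemma normc_ofR2 (p : R * R) : normc (ofR2 p) = Num.sqrt (p.1 ^+ 2 + p.2 ^+ 2).
Proof. by rewrite normc_sqrtE. Qed.

Lemma measurable_normc_ofR2 : measurable_fun [set: RT * RT] (fun p : RT * RT => normc (ofR2 p) : R).
Proof.
under eq_fun do rewrite normc_ofR2.
apply: (measurableT_comp (f := Num.sqrt : R -> R)).
  by apply: continuous_measurable_fun; exact: sqrt_continuous.
by apply: measurable_funD; exact: measurable_funX.
Qed.

Lemma ge0_area_radial (h : R -> \bar R) : measurable_fun setT h -> (forall r, (0 <= h r)%E) ->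
  (\int[leb2]_p h (normc (ofR2 p)) =
   twopi%:E * \int[leb]_(r in `]0%R, +oo[) (r%:E * h r))%E.
Proof.
move=> mh h0.
have mh' : measurable_fun setT (fun s : R => h (Num.sqrt s)).
  apply: measurableT_comp => //.
  by apply: continuous_measurable_fun; exact: sqrt_continuous.
transitivity (\int[leb2]_p (fun s => h (Num.sqrt s)) (p.1 ^+ 2 + p.2 ^+ 2)%R)%E.
  by apply: eq_integral => p _; rewrite normc_ofR2.
rewrite (radial_integral mh')//; congr (_ * _)%E; apply: eq_integral => r.
by rewrite inE/= in_itv/= andbT => r0; rewrite sqrtr_sqr gtr0_norm.
Qed.

Lemma area_radial_real (u : R -> R) : measurable_fun setT u ->
  leb2.-integrable setT (EFin \o (fun p => u (normc (ofR2 p)))) ->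
  leb.-integrable `]0, +oo[ (EFin \o (fun r => u r * r)) /\
  \int[leb2]_p u (normc (ofR2 p)) = twopi * \int[leb]_(r in `]0, +oo[) (u r * r).
Proof.
move=> mu ui; have t0 := twopi_gt0 R.
have mU : measurable_fun setT (EFin \o u) by exact/measurable_EFinP.
have mabs : measurable_fun setT (fun r => `|(u r)%:E|%E) by exact: measurableT_comp.
have ir : leb.-integrable `]0, +oo[ (EFin \o (fun r => u r * r)).
  apply/integrableP; split.
    by apply/measurable_EFinP; apply: measurable_funTS; exact: measurable_funM.
  have /integrableP[_] := ui.
  rewrite (ge0_area_radial mabs)// => fin.
  have -> : (\int[leb]_(r in `]0%R, +oo[) `|(u r * r)%:E| =
      \int[leb]_(r in `]0%R, +oo[) (r%:E * `|(u r)%:E|))%E.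
    apply: eq_integral => r; rewrite inE/= in_itv/= andbT => r0.
    by rewrite normrM (gtr0_norm r0) -EFinM mulrC.
  rewrite ltNge leye_eq; apply/negP => /eqP e; move: fin.
  by rewrite e gt0_muley ?lte_fin// ltxx.
split => //; rewrite /Rintegral.
rewrite integralE [in RHS]integralE.
have E1 : (\int[leb2]_p (EFin \o (fun p => u (normc (ofR2 p))))^\+ p =
    twopi%:E * \int[leb]_(r in `]0%R, +oo[) (EFin \o (fun r => u r * r)%R)^\+ r)%E.
  transitivity (\int[leb2]_p (EFin \o u)^\+ (normc (ofR2 p)))%E.
    by apply: eq_integral => p _; rewrite !funeposE.
  rewrite (ge0_area_radial (measurable_funepos mU))//; congr (_ * _)%E.
  apply: eq_integral => r; rewrite inE/= in_itv/= andbT => r0.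
  by rewrite !funeposE /= muleC maxe_pMl ?mul0e ?lee_fin ?ltW// EFinM.
have E2 : (\int[leb2]_p (EFin \o (fun p => u (normc (ofR2 p))))^\- p =
    twopi%:E * \int[leb]_(r in `]0%R, +oo[) (EFin \o (fun r => u r * r)%R)^\- r)%E.
  transitivity (\int[leb2]_p (EFin \o u)^\- (normc (ofR2 p)))%E.
    by apply: eq_integral => p _; rewrite !funenegE.
  rewrite (ge0_area_radial (measurable_funeneg mU))//; congr (_ * _)%E.
  apply: eq_integral => r; rewrite inE/= in_itv/= andbT => r0.
  by rewrite !funenegE /= muleC maxe_pMl ?mul0e ?lee_fin ?ltW// -EFinM mulNr.
have mD : measurable (`]0, +oo[%classic : set RT) by [].
rewrite E1 E2 -(fineK (integrable_pos_fin_num mD ir)) -(fineK (integrable_neg_fin_num mD ir)).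
by rewrite -!EFinM -!EFinB /= mulrBr.
Qed.

Lemma area_radial (H : R -> C) : cmeasurable setT H ->
  aintegrable (fun w => H (normc w)) ->
  cintegrable leb `]0, +oo[ (fun r => H r * r%:C) /\
  aint (fun w => H (normc w)) = twopi%:C * cint leb `]0, +oo[ (fun r => H r * r%:C).
Proof.
case=> m1 m2 [i1 i2].
have [r1 e1] := area_radial_real m1 i1; have [r2 e2] := area_radial_real m2 i2.
have E1 r : complex.Re (H r * r%:C) = complex.Re (H r) * r by rewrite ReImE /= mulr0 subr0.
have E2 r : complex.Im (H r * r%:C) = complex.Im (H r) * r by rewrite ReImE /= mulr0 add0r.
split.
  split; [move: r1|move: r2]; apply: eq_integrable => // r _ /=.
    by rewrite -E1 ReImE.
  by rewrite -E2 ReImE.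
apply: complex_ext; rewrite ReImE /= ?mul0r ?subr0 ?addr0.
- by rewrite e1; congr (_ * _); apply: eq_Rintegral => r _; rewrite E1.
- by rewrite e2; congr (_ * _); apply: eq_Rintegral => r _; rewrite E2.
Qed.

Lemma area_gauss_moment n (c : R) : 0 < c ->
  (\int[leb2]_p (normc (ofR2 p) ^+ n.*2 * expR (- (c * normc (ofR2 p) ^+ 2)))%:E =
   (pi * n`!%:R / c ^+ n.+1)%:E)%E.
Proof.
move=> c0.
have mh : measurable_fun setT (fun r : R => (r ^+ n.*2 * expR (- (c * r ^+ 2)))%:E : \bar R).
  apply/measurable_EFinP; apply: measurable_funM; first exact: measurable_funX.
  apply: measurableT_comp => //; apply: measurable_funN.
  by apply: measurable_funM => //; exact: measurable_funX.
rewrite (ge0_area_radial mh); last first.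
  by move=> r; rewrite lee_fin mulr_ge0 ?expR_ge0// -mul2n exprM exprn_ge0 ?sqr_ge0.
rewrite (_ : (\int[leb]_(r in _) _)%E = (n`!%:R / (2 * c ^+ n.+1))%:E).
  rewrite -EFinM; congr EFin; field.
  by rewrite expf_neq0 ?gt_eqF.
rewrite -gauss_moment_oo//; apply: eq_integral => r _.
by rewrite -EFinM; congr EFin; rewrite mulrA -exprS.
Qed.

End AreaIntegral.

(** * The space L2 of the Gaussian measure *)

Section GaussianL2.
Variable R : realType.
Local Notation C := R[i].
Local Notation RT := (measurableTypeR R).
Local Notation leb := (@lebesgue_measure R).
Local Notation leb2 := (leb \x leb)%E.
Implicit Types (f g h : C -> C) (w z c : C).

Definition sqnorm f : R := \int[leb2]_p (normc (f (ofR2 p)) ^+ 2 * gauss (ofR2 p)).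

Lemma gauss_ge0 z : 0 <= gauss z.
Proof. by rewrite mulr_ge0 ?invr_ge0 ?pi_ge0 ?expR_ge0. Qed.

Lemma measurable_gauss : measurable_fun [set: RT * RT] (fun p : RT * RT => gauss (ofR2 p) : R).
Proof.
apply: measurable_funM => //; apply: measurableT_comp => //.
by apply: measurable_funN; apply: measurable_funX; exact: measurable_normc_ofR2.
Qed.

Lemma measurable_sqdensity f : measurable_cfun f ->
  measurable_fun [set: RT * RT] (fun p : RT * RT => normc (f (ofR2 p)) ^+ 2 * gauss (ofR2 p)).
Proof.
move=> mf; apply: measurable_funM; last exact: measurable_gauss.
exact: (cmeasurable_normc_sqr (f := fun p : RT * RT => f (ofR2 p))).
Qed.

Lemma sqdensity_ge0 f p : 0 <= normc (f (ofR2 p)) ^+ 2 * gauss (ofR2 p).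
Proof. by rewrite mulr_ge0 ?sqr_ge0 ?gauss_ge0. Qed.

Lemma L2P f : L2 f <-> measurable_cfun f /\
  leb2.-integrable setT (EFin \o (fun p => normc (f (ofR2 p)) ^+ 2 * gauss (ofR2 p))).
Proof.
split=> -[mf fi]; split => //.
  apply/integrableP; split; first by apply/measurable_EFinP; exact: measurable_sqdensity.
  under eq_integral do rewrite /= ger0_norm ?sqdensity_ge0//.
  exact: fi.
have /integrableP[_] := fi.
by under eq_integral do rewrite /= ger0_norm ?sqdensity_ge0//.
Qed.

Lemma L2_dominated f (u : C -> R) : measurable_cfun f ->
  (forall w, normc (f w) ^+ 2 * gauss w <= u w) ->
  leb2.-integrable setT (EFin \o (fun p => u (ofR2 p))) -> L2 f.
Proof.
move=> mf fu ui; apply/L2P; split => //.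
apply: (le_integrable _ _ _ ui) => //; first by apply/measurable_EFinP; exact: measurable_sqdensity.
move=> p _ /=; rewrite lee_fin ger0_norm ?sqdensity_ge0//.
by rewrite (le_trans (fu _))// ler_norm.
Qed.

Lemma int_muE f : int_mu f = aint (fun w => f w * (gauss w)%:C).
Proof.
rewrite /int_mu /aint /cint; congr (_ +i* _); apply: eq_Rintegral => p _.
  by rewrite ReImE /= mulr0 subr0.
by rewrite ReImE /= mulr0 add0r.
Qed.

Lemma sqr_normcD_le w z : normc (w + z) ^+ 2 <= 2 * (normc w ^+ 2 + normc z ^+ 2).
Proof.
have h : normc (w + z) ^+ 2 <= (normc w + normc z) ^+ 2.
  by rewrite lerXn2r ?nnegrE ?addr_ge0 ?normc_ge0// ler_normcD.
apply: le_trans h _; rewrite -subr_ge0.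
have -> : 2 * (normc w ^+ 2 + normc z ^+ 2) - (normc w + normc z) ^+ 2 = (normc w - normc z) ^+ 2 by ring.
exact: sqr_ge0.
Qed.

Lemma L2_integrableM f g : L2 f -> L2 g ->
  aintegrable (fun w => f w * conjc (g w) * (gauss w)%:C).
Proof.
move=> /L2P[mf fi] /L2P[mg gi].
have := integrableD measurableT fi gi.
apply: cintegrable_le => //.
  apply: cmeasurableM; last by apply: cmeasurable_real; exact: measurable_gauss.
  by apply: cmeasurableM => //; exact: cmeasurableJ.
move=> p _; rewrite normcM normcM normcJ normc_real (ger0_norm (gauss_ge0 _)) -mulrDl.
rewrite ler_wpM2r ?gauss_ge0//.
move: (normc (f _)) (normc (g _)) (normc_ge0 (f (ofR2 p))) (normc_ge0 (g (ofR2 p))) => a b a0 b0.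
rewrite -subr_ge0; have -> : a ^+ 2 + b ^+ 2 - a * b = (a - b) ^+ 2 + a * b by ring.
by rewrite addr_ge0 ?sqr_ge0 ?mulr_ge0.
Qed.

Lemma L2D f g : L2 f -> L2 g -> L2 (fun w => f w + g w).
Proof.
move=> /L2P[mf fi] /L2P[mg gi].
have := integrable_comb 2 2 measurableT fi gi.
apply: (@L2_dominated _ (fun w => 2 * (normc (f w) ^+ 2 * gauss w) + 2 * (normc (g w) ^+ 2 * gauss w))).
  exact: cmeasurableD.
move=> w; rewrite -mulrDr -mulrDl mulrA ler_wpM2r ?gauss_ge0//.
exact: sqr_normcD_le.
Qed.

Lemma L2Z c f : L2 f -> L2 (fun w => c * f w).
Proof.
move=> /L2P[mf fi].
have := integrableZl measurableT (normc c ^+ 2) fi.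
apply: (@L2_dominated _ (fun w => normc c ^+ 2 * (normc (f w) ^+ 2 * gauss w))).
  by apply: cmeasurableM => //; exact: cmeasurable_cst.
by move=> w; rewrite normcM exprMn mulrA.
Qed.

Lemma L2B f g : L2 f -> L2 g -> L2 (fun w => f w - g w).
Proof.
move=> Lf Lg; rewrite (_ : (fun w => f w - g w) = (fun w => f w + (-1) * g w)).
  by apply: L2D => //; exact: L2Z.
by apply/funext => w; rewrite mulN1r.
Qed.

Lemma ip_muE f g : ip_mu f g = aint (fun w => f w * conjc (g w) * (gauss w)%:C).
Proof. exact: int_muE. Qed.

Lemma ip_muD f g h : L2 f -> L2 g -> L2 h ->
  ip_mu (fun w => f w + g w) h = ip_mu f h + ip_mu g h.
Proof.
move=> Lf Lg Lh; rewrite !ip_muE -cintD//; try exact: L2_integrableM.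
by apply: eq_cint => p _; ring.
Qed.

Lemma ip_muZ c f h : L2 f -> L2 h -> ip_mu (fun w => c * f w) h = c * ip_mu f h.
Proof.
move=> Lf Lh; rewrite !ip_muE -cintZ//; try exact: L2_integrableM.
by apply: eq_cint => p _; ring.
Qed.

Lemma ip_muB f g h : L2 f -> L2 g -> L2 h ->
  ip_mu (fun w => f w - g w) h = ip_mu f h - ip_mu g h.
Proof.
move=> Lf Lg Lh; rewrite !ip_muE -cintB//; try exact: L2_integrableM.
by apply: eq_cint => p _; ring.
Qed.

Lemma ip_muC f g : L2 f -> L2 g -> ip_mu g f = conjc (ip_mu f g).
Proof.
move=> Lf Lg; rewrite !ip_muE -cintJ//; last exact: L2_integrableM.
apply: eq_cint => p _; rewrite !conjc_mul conjcK conjc_real; ring.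
Qed.

Lemma ip_mu_sq f : ip_mu f f = (sqnorm f)%:C.
Proof.
rewrite ip_muE; apply: complex_ext => /=.
  by apply: eq_Rintegral => p _; rewrite mulcJ -rmorphM.
rewrite (_ : (fun p => _) = fun=> 0) ?Rintegral_cst ?mul0r//.
by apply/funext => p; rewrite mulcJ -rmorphM.
Qed.

Lemma sqnorm_ge0 f : 0 <= sqnorm f.
Proof. by apply: Rintegral_ge0 => p _; exact: sqdensity_ge0. Qed.

Lemma Re_ip_mu f : complex.Re (ip_mu f f) = sqnorm f.
Proof. by rewrite ip_mu_sq. Qed.

Lemma conjcB w z : conjc (w - z) = conjc w - conjc z.
Proof. exact: rmorphB. Qed.

Lemma sqnormB f g : L2 f -> L2 g -> sqnorm (fun w => f w - g w) =
  sqnorm f - 2 * complex.Re (ip_mu f g) + sqnorm g.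
Proof.
move=> Lf Lg; have LB := L2B Lf Lg.
have : ip_mu (fun w => f w - g w) (fun w => f w - g w) =
    ip_mu f f - (ip_mu f g + conjc (ip_mu f g)) + ip_mu g g.
  rewrite ip_muB// [ip_mu f _]ip_muC// [ip_mu g (fun=> _)]ip_muC//.
  rewrite (ip_muB Lf Lg Lf) (ip_muB Lf Lg Lg) (ip_muC Lf Lg) !conjcB conjcK.
  rewrite !ip_mu_sq !conjc_real; ring.
rewrite !ip_mu_sq => /(congr1 (@complex.Re R)).
by rewrite !ReImE /= => ->; ring.
Qed.

Lemma sqnormZ c f : L2 f -> sqnorm (fun w => c * f w) = normc c ^+ 2 * sqnorm f.
Proof.
move=> Lf; apply: (@complexI R); rewrite rmorphM -!ip_mu_sq.
rewrite ip_muZ//; last exact: L2Z.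
rewrite ip_muC//; last exact: L2Z.
by rewrite ip_muZ// conjc_mul ip_mu_sq conjc_real mulrA mulcJ.
Qed.

Lemma Cauchy_Schwarz f g : L2 f -> L2 g ->
  normc (ip_mu f g) ^+ 2 <= sqnorm f * sqnorm g.
Proof.
move=> Lf Lg; set a := ip_mu f g.
have key (s : R) : 0 <= sqnorm f - 2 * s * normc a ^+ 2 + s ^+ 2 * normc a ^+ 2 * sqnorm g.
  have := sqnorm_ge0 (fun w => f w - (s%:C * a) * g w).
  rewrite sqnormB//; last exact: L2Z.
  rewrite sqnormZ// normcM normc_real exprMn real_normK ?num_real//.
  rewrite ip_muC//; last exact: L2Z.
  rewrite ip_muZ// -[ip_mu g f]conjcK -(ip_muC Lg Lf) -/a conjc_mul conjcK.
  rewrite conjc_mul conjc_real -mulrA (mulrC (conjc a)) mulcJ -rmorphM /= mulrA.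
  by rewrite mulrA.
have [g0|gn0] := eqVneq (sqnorm g) 0.
  rewrite g0 mulr0 leNgt; apply/negP => a0.
  (* the inequality [key] is affine in s here, and fails for this large s *)
  have := key ((sqnorm f + 1) / (2 * normc a ^+ 2)).
  rewrite g0 mulr0 addr0 (_ : 2 * _ * _ = sqnorm f + 1); last first.
    by field; move: a0; rewrite lt0r sqrf_eq0 => /andP[].
  by rewrite opprD addrA subrr add0r oppr_ge0 ler10.
have gp : 0 < sqnorm g by rewrite lt0r gn0 sqnorm_ge0.
have := key (sqnorm g)^-1.
rewrite (_ : _ + _ = sqnorm f - normc a ^+ 2 / sqnorm g); last by field.
by rewrite subr_ge0 ler_pdivrMr.
Qed.

End GaussianL2.

(** * Expansions in the monomial basis *)

Section MonomialBasis.
Variable R : realType.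
Local Notation C := R[i].
Local Notation leb := (@lebesgue_measure R).
Local Notation leb2 := (leb \x leb)%E.
Local Notation twopi := ((pi : R) *+ 2).
Implicit Types (f g h : C -> C) (w z c : C) (x y : nat -> C).
Local Notation u := (@basis_u R).

Lemma measurable_cfun_id : measurable_cfun (fun w : C => w).
Proof. by split; [exact: measurable_fst|exact: measurable_snd]. Qed.

Lemma measurable_cfunX f n : measurable_cfun f -> measurable_cfun (fun w => f w ^+ n).
Proof.
move=> mf; elim: n => [|n ih].
  by under [X in measurable_cfun X]eq_fun do rewrite expr0; exact: cmeasurable_cst.
by under [X in measurable_cfun X]eq_fun do rewrite exprS; exact: (cmeasurableM mf ih).
Qed.

Lemma sqrt_fact_gt0 n : 0 < Num.sqrt (n`!%:R : R).
Proof. by rewrite sqrtr_gt0 ltr0n fact_gt0. Qed.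

Lemma sqrt_factC_neq0 n : (Num.sqrt (n`!%:R : R))%:C != 0 :> C.
Proof. by rewrite eq_complex /= eqxx andbT gt_eqF// sqrt_fact_gt0. Qed.

Lemma sqrt_fact2 n : Num.sqrt (n`!%:R : R) ^+ 2 = n`!%:R.
Proof. by rewrite sqr_sqrtr. Qed.

Lemma basis_uE n w : u n w = ((Num.sqrt (n`!%:R : R))^-1)%:C * w ^+ n.
Proof. by rewrite /basis_u mulrC fmorphV. Qed.

Lemma sqr_normc_basis_u n w : normc (u n w) ^+ 2 = (normc w ^+ 2) ^+ n / n`!%:R.
Proof.
rewrite basis_uE normcM normc_real normcX exprMn exprAC mulrC.
by rewrite ger0_norm ?invr_ge0 ?sqrtr_ge0// exprVn sqrt_fact2.
Qed.

Lemma entire_basis_u n : entire (u n).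
Proof.
rewrite (_ : u n = fun w => ((Num.sqrt (n`!%:R : R))^-1)%:C * w ^+ n).
  by apply: entireM; [exact: entire_cst|exact: entireX].
by apply/funext => w; exact: basis_uE.
Qed.

Lemma measurable_basis_u n : measurable_cfun (u n).
Proof.
rewrite (_ : u n = fun w => ((Num.sqrt (n`!%:R : R))^-1)%:C * w ^+ n).
  apply: cmeasurableM; first exact: cmeasurable_cst.
  exact: (measurable_cfunX n measurable_cfun_id).
by apply/funext => w; exact: basis_uE.
Qed.

Lemma integrable_gauss_moment n (c : R) : 0 < c ->
  leb2.-integrable setT (EFin \o (fun p =>
    normc (ofR2 p) ^+ n.*2 * expR (- (c * normc (ofR2 p) ^+ 2)))).
Proof.
move=> c0; apply/integrableP; split.
  apply/measurable_EFinP; apply: measurable_funM.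
    by apply: measurable_funX; exact: measurable_normc_ofR2.
  apply: measurableT_comp => //; apply: measurable_funN; apply: measurable_funM => //.
  by apply: measurable_funX; exact: measurable_normc_ofR2.
have nn p : 0 <= normc (ofR2 p) ^+ n.*2 * expR (- (c * normc (ofR2 p) ^+ 2)).
  by rewrite mulr_ge0 ?expR_ge0// exprn_ge0// normc_ge0.
under eq_integral do rewrite /= ger0_norm ?nn//.
by rewrite area_gauss_moment// ltry.
Qed.

Lemma L2_basis_u n : L2 (u n).
Proof.
have := integrableZl measurableT (n`!%:R^-1 * pi^-1) (integrable_gauss_moment n (ltr01 : 0 < 1 :> R)).
apply: (@L2_dominated _ _ (fun w => (n`!%:R^-1 * pi^-1) * (normc w ^+ n.*2 * expR (- (1 * normc w ^+ 2))))).
  exact: measurable_basis_u.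
move=> w; rewrite sqr_normc_basis_u /gauss -exprM mul2n mul1r le_eqVlt; apply/orP; left; apply/eqP; ring.
Qed.

Lemma F2_basis_u n : F2 (u n).
Proof. by split; [exact: entire_basis_u|exact: L2_basis_u]. Qed.

Lemma sqnorm_basis_u n : sqnorm (u n) = 1.
Proof.
rewrite /sqnorm /Rintegral.
have -> : (\int[leb2]_p (normc (u n (ofR2 p)) ^+ 2 * gauss (ofR2 p))%:E =
   \int[leb2]_p ((n`!%:R^-1 * pi^-1)%:E *
     (normc (ofR2 p) ^+ n.*2 * expR (- (1 * normc (ofR2 p) ^+ 2)))%:E))%E.
  apply: eq_integral => p _; rewrite sqr_normc_basis_u /gauss -exprM mul2n mul1r -EFinM.
  by congr EFin; ring.
rewrite integralZl//; last exact: (integrable_gauss_moment n (ltr01 : 0 < 1 :> R)).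
rewrite area_gauss_moment// -EFinM /= expr1n divr1 (mulrC pi) mulrACA.
by rewrite !mulVf ?mulr1 ?pnatr_eq0 -?lt0n ?fact_gt0// gt_eqF ?pi_gt0.
Qed.

(** The n-th circle coefficient of a monomial of lower degree vanishes. *)
Lemma ip_basis_u_lt m n : (m < n)%N -> ip_mu (u m) (u n) = 0.
Proof.
move=> mn.
have fc w : cint leb `[0, twopi] (fun t => u m (cis t * w) * cis (- t) ^+ n) =
    twopi%:C * (0 * w ^+ n).
  rewrite mul0r mulr0 -(mulr0 (u m w)) -(cint_cis0 R (n - m).-1).
  rewrite -cintZ//; last first.
    apply: ccontinuous_integrable.
    have := circle_ccontinuous (@entire_cst R 1) 0 (n - m).-1.+1; congr ccontinuous.
    by apply/funext => t; rewrite mul1r.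
  apply: eq_cint => t _; rewrite prednK ?subn_gt0// !basis_uE exprMn -!mulrA; congr (_ * _).
  rewrite mulrCA; congr (_ * _).
  rewrite -{1}(subnKC (ltnW mn)) exprD mulrA -exprMn -[cis (- t)]conj_cis cisJ expr1n mul1r //.
pose H (r : R) : C := ((Num.sqrt (n`!%:R : R))^-1 * (pi^-1 * expR (- r ^+ 2)))%:C.
have E : (fun w => u m w * conjc (u n w) * (gauss w)%:C) =
    (fun w => u m w * conjc w ^+ n * H (normc w)).
  apply/funext => w; rewrite [u n w]basis_uE conjc_mul conjc_real rmorphXn /= /H rmorphM; ring.
have ig : aintegrable (fun w => u m w * conjc w ^+ n * H (normc w)).
  by rewrite -E; exact: L2_integrableM (L2_basis_u m) (L2_basis_u n).
have [_] := aint_circle_coef (@entire_basis_u m) fc ig.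
rewrite ip_muE E => <-.
transitivity (cint leb2 setT (fun=> 0 * 0 : C)).
  by apply: eq_cint => p _; rewrite !mul0r.
rewrite cintZ// ?mul0r//; split => /=; apply: integrable0.
Qed.

Lemma ip_basis_u m n : ip_mu (u m) (u n) = (m == n)%:R.
Proof.
have [mn|nm|->] := ltngtP m n.
- exact: ip_basis_u_lt.
- rewrite ip_muC; [|exact: L2_basis_u|exact: L2_basis_u].
  by rewrite ip_basis_u_lt// conjc0.
- by rewrite ip_mu_sq sqnorm_basis_u.
Qed.

Definition psum x N : C -> C := fun w => \sum_(i < N) x i * u i w.

Lemma psumS x N : psum x N.+1 = (fun w => psum x N w + x N * u N w).
Proof. by apply/funext => w; rewrite /psum big_ord_recr. Qed.

Lemma psum0 x : psum x 0 = fun=> 0.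
Proof. by apply/funext => w; rewrite /psum big_ord0. Qed.

Lemma L2_0 : L2 (fun=> 0 : C).
Proof.
rewrite (_ : (fun=> 0) = (fun w => 0 * u 0 w)); first exact: L2Z (L2_basis_u 0).
by apply/funext => w; rewrite mul0r.
Qed.

Lemma L2_psum x N : L2 (psum x N).
Proof.
elim: N => [|N ih]; first by rewrite psum0; exact: L2_0.
rewrite psumS; apply: L2D => //; apply: L2Z; exact: L2_basis_u.
Qed.

Lemma ip_psum x N g : L2 g -> ip_mu (psum x N) g = \sum_(i < N) x i * ip_mu (u i) g.
Proof.
move=> Lg; elim: N => [|N ih].
  rewrite psum0 big_ord0.
  rewrite (_ : (fun=> 0) = (fun w => 0 * u 0 w)); last by apply/funext => w; rewrite mul0r.
  by rewrite ip_muZ ?mul0r//; exact: L2_basis_u.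
rewrite psumS ip_muD//; [|exact: L2_psum|by apply: L2Z; exact: L2_basis_u].
by rewrite ih big_ord_recr /= ip_muZ//; exact: L2_basis_u.
Qed.

Lemma sum_delta x N m : \sum_(i < N) x i * (i == m :> nat)%:R = if (m < N)%N then x m else 0.
Proof.
elim: N => [|N ih]; first by rewrite big_ord0.
rewrite big_ord_recr /= ih ltnS; case: (ltngtP m N) => [mN|Nm|->].
- by rewrite mulr0 addr0.
- by rewrite mulr0 addr0.
- by rewrite mulr1 add0r.
Qed.

Lemma ip_psum_basis_u x N m : ip_mu (psum x N) (u m) = if (m < N)%N then x m else 0.
Proof.
rewrite ip_psum; last exact: L2_basis_u.
by under eq_bigr do rewrite ip_basis_u; exact: sum_delta.
Qed.

Lemma sqnorm_psum x N : sqnorm (psum x N) = \sum_(i < N) normc (x i) ^+ 2.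
Proof.
apply: (@complexI R); rewrite -ip_mu_sq ip_psum; last exact: L2_psum.
rewrite rmorph_sum; apply: eq_bigr => i _.
rewrite ip_muC; [|exact: L2_psum|exact: L2_basis_u].
by rewrite ip_psum_basis_u ltn_ord mulcJ.
Qed.

Definition coef f n : C := ip_mu f (u n).

(** The difference between g and its projection on the first N monomials has a
    nonnegative norm. *)
Lemma Bessel g N : L2 g -> \sum_(i < N) normc (coef g i) ^+ 2 <= sqnorm g.
Proof.
move=> Lg; rewrite -sqnorm_psum.
have := sqnorm_ge0 (fun w => g w - psum (coef g) N w).
rewrite sqnormB//; last exact: L2_psum.
rewrite [ip_mu g _]ip_muC//; last exact: L2_psum.
have -> : ip_mu (psum (coef g) N) g = (sqnorm (psum (coef g) N))%:C.
  rewrite ip_psum// sqnorm_psum rmorph_sum; apply: eq_bigr => i _.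
  by rewrite ip_muC//; [rewrite mulcJ|exact: L2_basis_u].
by rewrite conjc_real /= => h; lra.
Qed.

Lemma l2_coef g : L2 g -> l2 (coef g).
Proof.
move=> Lg; apply: (@bounded_cvg_series _ _ (sqnorm g)) => n; first exact: sqr_ge0.
by rewrite seriesEord; exact: Bessel.
Qed.

End MonomialBasis.

Section PowerSeriesMap.
Variable R : realType.
Local Notation C := R[i].
Local Notation RT := (measurableTypeR R).
Local Notation leb := (@lebesgue_measure R).
Local Notation leb2 := (leb \x leb)%E.
Implicit Types (f g : C -> C) (w z c : C) (x y : nat -> C).
Local Notation u := (@basis_u R).

(** The inverse of the coefficient map [coef] on F2. *)
Definition basis_series x : C -> C := fun w => csum (fun n => x n * u n w).

Lemma mul_le_sqD (a b : R) : a * b <= a ^+ 2 + b ^+ 2.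
Proof.
have : 0 <= (a - b) ^+ 2 + (a ^+ 2 + b ^+ 2) by rewrite !addr_ge0 ?sqr_ge0.
have : 0 <= (a + b) ^+ 2 by exact: sqr_ge0.
move=> h1 h2; rewrite -subr_ge0.
have -> : a ^+ 2 + b ^+ 2 - a * b = ((a - b) ^+ 2 + (a ^+ 2 + b ^+ 2)) / 2 by field.
by rewrite divr_ge0.
Qed.

(** Dominates both the terms of the expansion at a point of modulus rho and those
    of its power series, by ab <= a^2 + b^2. *)
Lemma l2_majorant x (rho : R) : l2 x ->
  cvgn (series ((fun n => normc (x n) ^+ 2) + (fun n => (rho ^+ 2) ^+ n / n`!%:R))).
Proof. by move=> lx; apply: is_cvg_seriesD => //; exact: cvg_exp_series. Qed.

Lemma basis_series_abs_summable x w : l2 x -> abs_summable (fun n => x n * u n w).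
Proof.
move=> lx; apply: abs_summable_le (@l2_majorant x (normc w) lx) => n.
rewrite normcM; apply: le_trans (mul_le_sqD _ _) _.
by rewrite sqr_normc_basis_u.
Qed.

Lemma entire_basis_series x : l2 x -> entire (basis_series x).
Proof.
move=> lx; apply/entireP => z.
pose a n : C := x n * ((Num.sqrt (n`!%:R : R))^-1)%:C.
have -> : basis_series x = fun w => csum (fun n => a n * w ^+ n).
  apply/funext => w; congr csum; apply/funext => n.
  by rewrite basis_uE mulrA.
eexists; apply: (cdiff_power_series z _).2 => rho rho0.
apply: le0_cvg_series (@l2_majorant x rho lx) => n.
rewrite mulr_ge0 ?normc_ge0 ?exprn_ge0//= /a normcM normc_real -mulrA.
apply: le_trans (mul_le_sqD _ _) _; rewrite lerD2l exprMn real_normK ?num_real//.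
by rewrite exprVn sqrt_fact2 exprAC mulrC.
Qed.

Lemma complexRe_sum x N : complex.Re (\sum_(i < N) x i) = \sum_(i < N) complex.Re (x i).
Proof. by elim: N => [|N ih]; rewrite ?big_ord0// !big_ord_recr complexReD ih. Qed.

Lemma complexIm_sum x N : complex.Im (\sum_(i < N) x i) = \sum_(i < N) complex.Im (x i).
Proof. by elim: N => [|N ih]; rewrite ?big_ord0// !big_ord_recr complexImD ih. Qed.

Lemma psum_cvg x w : l2 x ->
  complex.Re (psum x N w) @[N --> \oo] --> complex.Re (basis_series x w) /\
  complex.Im (psum x N w) @[N --> \oo] --> complex.Im (basis_series x w).
Proof.
move=> lx; have s := @basis_series_abs_summable x w lx; split.
- rewrite (_ : (fun N => _) = series (fun n => complex.Re (x n * u n w))).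
    exact: abs_summable_Re s.
  apply/funext => N; rewrite seriesEord /psum.
  exact: (complexRe_sum (fun i => x i * u i w)).
- rewrite (_ : (fun N => _) = series (fun n => complex.Im (x n * u n w))).
    exact: abs_summable_Im s.
  apply/funext => N; rewrite seriesEord /psum.
  exact: (complexIm_sum (fun i => x i * u i w)).
Qed.

(** Fatou's lemma bounds the norm of a pointwise limit. *)
Lemma L2_Fatou (G : nat -> C -> C) g (K : R) :
  (forall M, L2 (G M)) -> (forall M, sqnorm (G M) <= K) ->
  (forall w, complex.Re (G M w) @[M --> \oo] --> complex.Re (g w)) ->
  (forall w, complex.Im (G M w) @[M --> \oo] --> complex.Im (g w)) ->
  L2 g /\ sqnorm g <= K.
Proof.
move=> LG GK cR cI.
have mG M : measurable_cfun (G M) by have [] := LG M.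
have mg : measurable_cfun g.
  split.
  - apply: (@measurable_fun_cvg _ _ _ _ (fun M p => complex.Re (G M (ofR2 p)))).
      by move=> M; have [] := mG M.
    by move=> p _; exact: cR.
  - apply: (@measurable_fun_cvg _ _ _ _ (fun M p => complex.Im (G M (ofR2 p)))).
      by move=> M; have [] := mG M.
    by move=> p _; exact: cI.
pose F M (p : RT * RT) : \bar R := (normc (G M (ofR2 p)) ^+ 2 * gauss (ofR2 p))%:E.
have mF M : measurable_fun setT (F M).
  by apply/measurable_EFinP; exact: measurable_sqdensity.
have F0 M p : setT p -> (0 <= F M p)%E by move=> _; rewrite lee_fin sqdensity_ge0.
have cF p : F M p @[M --> \oo] --> (normc (g (ofR2 p)) ^+ 2 * gauss (ofR2 p))%:E.
  apply/fine_cvgP; split; first exact: nearW.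
  rewrite /= ; apply: cvgM; last exact: cvg_cst.
  rewrite sqr_normcE; under eq_fun do rewrite sqr_normcE.
  apply: cvgD; rewrite expr2; under eq_fun do rewrite expr2.
    by apply: cvgM; exact: cR.
  by apply: cvgM; exact: cI.
have IF M : (\int[leb2]_p F M p <= K%:E)%E.
  have /L2P[_ iF] := LG M.
  by rewrite -(fineK (integrable_fin_num measurableT iF)) lee_fin; exact: GK.
have main : (\int[leb2]_p (normc (g (ofR2 p)) ^+ 2 * gauss (ofR2 p))%:E <= K%:E)%E.
  have := fatou leb2 measurableT mF F0.
  have -> : (\int[leb2]_p limn_einf (F^~ p) =
      \int[leb2]_p (normc (g (ofR2 p)) ^+ 2 * gauss (ofR2 p))%:E)%E.
    apply: eq_integral => p _; rewrite is_cvg_limn_einfE; first exact/cvg_lim/cF.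
    by apply/cvg_ex; eexists; exact: cF.
  move=> /le_trans; apply.
  rewrite limn_einf_lim; apply: lime_le; first exact: is_cvg_einfs.
  apply: nearW => n; apply: le_trans (IF n).
  by apply: ereal_inf_lbound; exists n => /=.
have Lg : L2 g by split => //; apply: le_lt_trans main _; rewrite ltry.
split => //; have /L2P[_ ig] := Lg.
by rewrite -lee_fin /sqnorm /Rintegral fineK//; exact: (integrable_fin_num measurableT ig).
Qed.

Lemma basis_series_le x : l2 x -> L2 (basis_series x) /\
  sqnorm (basis_series x) <= limn (series (fun n => normc (x n) ^+ 2)).
Proof.
move=> lx; apply: (@L2_Fatou (psum x)).
- exact: L2_psum.
- move=> M; rewrite sqnorm_psum -(@big_mkord _ _ _ M xpredT (fun i => normc (x i) ^+ 2)).
  by apply: series_le_lim => // n; exact: sqr_ge0.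
- by move=> w; have [] := @psum_cvg x w lx.
- by move=> w; have [] := @psum_cvg x w lx.
Qed.

Definition tailseq x N : nat -> C := fun n => if (n < N)%N then 0 else x n.

Definition tail x N : R :=
  limn (series (fun n => normc (x n) ^+ 2)) - series (fun n => normc (x n) ^+ 2) N.

Lemma tail_cvg x : l2 x -> tail x N @[N --> \oo] --> (0 : R).
Proof.
move=> lx; rewrite -(subrr (limn (series (fun n => normc (x n) ^+ 2)))).
by apply: cvgB => //; exact: cvg_cst.
Qed.

(** The remainder of the series is again of the form [basis_series], so that the
    norm bound applies to it. *)
Lemma basis_series_tail x N : l2 x ->
  L2 (fun w => basis_series x w - psum x N w) /\
  sqnorm (fun w => basis_series x w - psum x N w) <= tail x N.
Proof.
move=> lx.
have sE : series (fun n => normc (tailseq x N n) ^+ 2) =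
    fun M => series (fun n => normc (x n) ^+ 2) M - series (fun n => normc (x n) ^+ 2) (minn M N).
  apply/funext; elim => [|M ih].
    by rewrite min0n subrr seriesEnat /= big_geq.
  rewrite !seriesSr ih /tailseq; have [MN|NM] := ltnP M N.
    have -> : minn M.+1 N = M.+1 by exact/minn_idPl.
    rewrite seriesSr normc0 expr0n /=; ring.
  rewrite (minn_idPr (leqW NM)); ring.
have cs : series (fun n => normc (tailseq x N n) ^+ 2) M @[M --> \oo] --> tail x N.
  rewrite sE; apply: cvgB => //.
  apply: cvg_near_cst; exists N => //= M /= NM.
  by rewrite (minn_idPr NM).
have lt : l2 (tailseq x N) by apply/cvg_ex; exists (tail x N).
have [] := basis_series_le lt; rewrite (cvg_lim _ cs)//.
rewrite (_ : basis_series (tailseq x N) = fun w => basis_series x w - psum x N w)//.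
have pE w M : psum (tailseq x N) M w = psum x M w - psum x (minn M N) w.
  elim: M => [|M ih]; first by rewrite min0n subrr psum0.
  rewrite !psumS ih /tailseq; have [MN|NM] := ltnP M N.
    have -> : minn M.+1 N = M.+1 by exact/minn_idPl.
    by rewrite psumS; ring.
  by rewrite (minn_idPr (leqW NM)); ring.
apply/funext => w; have [r1 i1] := @psum_cvg (tailseq x N) w lt.
have [r2 i2] := @psum_cvg x w lx.
have near_cst (p : C -> R) : p (psum x (minn M N) w) @[M --> \oo] --> p (psum x N w).
  by apply: cvg_near_cst; exists N => //= M /= NM; rewrite (minn_idPr NM).
apply: complex_ext; rewrite !ReImE.
- have r3 : complex.Re (psum (tailseq x N) M w) @[M --> \oo] -->
      complex.Re (basis_series x w) - complex.Re (psum x N w).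
    under eq_fun do rewrite pE !ReImE.
    by apply: cvgB => //; exact: (near_cst (@complex.Re R)).
  by rewrite -(cvg_lim _ r1)// (cvg_lim _ r3).
- have i3 : complex.Im (psum (tailseq x N) M w) @[M --> \oo] -->
      complex.Im (basis_series x w) - complex.Im (psum x N w).
    under eq_fun do rewrite pE !ReImE.
    by apply: cvgB => //; exact: (near_cst (@complex.Im R)).
  by rewrite -(cvg_lim _ i1)// (cvg_lim _ i3).
Qed.

Lemma F2_basis_series x : l2 x -> F2 (basis_series x).
Proof. by move=> lx; split; [exact: entire_basis_series|have [] := basis_series_le lx]. Qed.

(** The partial sums converge in norm by [basis_series_tail], and the inner
    product is continuous by the Cauchy-Schwarz inequality. *)
Lemma ip_basis_series x g : l2 x -> L2 g ->
  [/\ cvgn (series (fun n => complex.Re (x n * ip_mu (u n) g))),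
      cvgn (series (fun n => complex.Im (x n * ip_mu (u n) g))) &
      ip_mu (basis_series x) g = csum (fun n => x n * ip_mu (u n) g)].
Proof.
move=> lx Lg; have [LV _] := basis_series_le lx.
have dist N : normc (ip_mu (basis_series x) g - ip_mu (psum x N) g) ^+ 2 <= tail x N * sqnorm g.
  have [LT le] := basis_series_tail N lx.
  rewrite -ip_muB//; last exact: L2_psum.
  apply: le_trans (Cauchy_Schwarz LT Lg) _.
  by rewrite ler_wpM2r// sqnorm_ge0.
have tc : (tail x N * sqnorm g) @[N --> \oo] --> (0 : R).
  by rewrite -[X in _ --> X](mul0r (sqnorm g)); apply: cvgM; [exact: tail_cvg|exact: cvg_cst].
have key (p : C -> R) : (forall w, `|p w| <= normc w) -> (forall w w', p (w - w') = p w - p w') ->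
    p (ip_mu (psum x N) g) @[N --> \oo] --> p (ip_mu (basis_series x) g).
  move=> pn pB; apply/cvgrPdist_le => e e0.
  have e20 : 0 < e ^+ 2 by rewrite exprn_gt0.
  have [N0 _ H] := (cvgrPdist_le _ _).1 tc _ e20.
  exists N0 => // N /= NN0; rewrite -pB; apply: le_trans (pn _) _.
  rewrite -(@ler_pXn2r _ 2) ?nnegrE ?normc_ge0 ?(ltW e0)//.
  apply: le_trans (dist N) _; have := H N NN0; rewrite sub0r normrN.
  by apply: le_trans; exact: ler_norm.
have kR := key _ (@Re_le_normc R) (fun w w' => etrans (complexReD w (- w')) (congr1 _ (complexReN w'))).
have kI := key _ (@Im_le_normc R) (fun w w' => etrans (complexImD w (- w')) (congr1 _ (complexImN w'))).
have sR : (fun N => complex.Re (ip_mu (psum x N) g)) = series (fun n => complex.Re (x n * ip_mu (u n) g)).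
  apply/funext => N; rewrite (ip_psum x N Lg) seriesEord /=.
  exact: (complexRe_sum (fun i => x i * ip_mu (u i) g)).
have sI : (fun N => complex.Im (ip_mu (psum x N) g)) = series (fun n => complex.Im (x n * ip_mu (u n) g)).
  apply/funext => N; rewrite (ip_psum x N Lg) seriesEord /=.
  exact: (complexIm_sum (fun i => x i * ip_mu (u i) g)).
rewrite sR in kR; rewrite sI in kI.
split; [by apply/cvg_ex; eexists; exact: kR|by apply/cvg_ex; eexists; exact: kI|].
by apply: complex_ext; rewrite /csum /=; apply/esym/cvg_lim.
Qed.

Lemma coef_basis_series x : l2 x -> coef (basis_series x) = x.
Proof.
move=> lx; apply/funext => m; rewrite /coef.
have [_ _ ->] := ip_basis_series lx (L2_basis_u R m).
have E p : (forall n, p (x n * ip_mu (u n) (u m)) = (if n == m then p (x m) else 0) :> R) ->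
    limn (series (fun n => p (x n * ip_mu (u n) (u m)))) = p (x m).
  move=> pE; apply: (@lim_near_cst _ _) => //; exists m.+1 => // N /= mN.
  rewrite seriesEord /= (bigD1 (Ordinal mN))//= pE eqxx big1 ?addr0// => i im.
  by rewrite pE; case: eqP => // e; move: im; rewrite -val_eqE /= e eqxx.
apply: complex_ext; rewrite /csum /=; apply: E => n; rewrite ip_basis_u;
  by case: eqP => [->|_]; rewrite ?mulr1 ?mulr0.
Qed.

Lemma ip_basis_series_basis_series x y : l2 x -> l2 y -> ip_mu (basis_series x) (basis_series y) = ip_l2 x y.
Proof.
move=> lx ly; have [Ly _] := basis_series_le ly.
have [_ _ ->] := ip_basis_series lx Ly.
rewrite /csum /ip_l2.
suff E n : ip_mu (u n) (basis_series y) = conjc (y n) by congr (_ +i* _); congr (limn (series _)); apply/funext => n; rewrite E.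
rewrite ip_muC//; last exact: L2_basis_u.
by congr conjc; have := congr1 (fun h => h n) (coef_basis_series ly).
Qed.

End PowerSeriesMap.

(** * Mean values and the reproducing kernel *)

Section ReproducingKernel.
Variable R : realType.
Local Notation C := R[i].
Local Notation RT := (measurableTypeR R).
Local Notation leb := (@lebesgue_measure R).
Local Notation leb2 := (leb \x leb)%E.
Implicit Types (f g h : C -> C) (w z c : C) (x y : nat -> C).
Local Notation u := (@basis_u R).

(** Only the constant Taylor coefficient of g at z survives the integration
    against a radial weight. *)
Lemma mean_value g z (H : R -> C) : entire g ->
  aintegrable (fun w => g (z + w) * H (normc w)) ->
  aintegrable (fun w => g z * H (normc w)) /\
  aint (fun w => g (z + w) * H (normc w)) = aint (fun w => g z * H (normc w)).
Proof.
move=> eg ig.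
have et : entire (fun w => g (z + w)).
  apply: (@entire_comp _ g (fun w => z + w)); first exact: eg.
  by apply: entireD; [exact: entire_cst|exact: entire_id].
have cm w : cint leb `[0, pi *+ 2] (fun t => g (z + cis t * w) * cis (- t) ^+ 0) =
    (pi *+ 2)%:C * (g z * w ^+ 0).
  rewrite expr0 mulr1; have := circle_mean et w; rewrite addr0 => <-.
  by apply: eq_cint => t _; rewrite expr0 mulr1.
have i0 : aintegrable (fun w => g (z + w) * conjc w ^+ 0 * H (normc w)).
  by under eq_fun do rewrite expr0 mulr1.
have [] := @aint_circle_coef _ (fun w => g (z + w)) 0 H (g z) et cm i0.
have -> : (fun w => g z * ((normc w ^+ 0.*2)%:C * H (normc w))) = (fun w => g z * H (normc w)).
  by apply/funext => w; rewrite double0 expr0 mul1r.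
have -> : (fun w => g (z + w) * conjc w ^+ 0 * H (normc w)) = (fun w => g (z + w) * H (normc w)).
  by apply/funext => w; rewrite expr0 mulr1.
by move=> iA ->.
Qed.

(** The function [f ^+ 2] is entire and integrable over the plane. By the mean
    value property with the constant weight 1, each of its values is an
    integrable constant, hence zero because the plane has infinite area. *)
Lemma entire_sqintegrable_eq0 f : entire f -> measurable_cfun f ->
  leb2.-integrable setT (EFin \o (fun p => normc (f (ofR2 p)) ^+ 2)) -> forall z, f z = 0.
Proof.
move=> ef mf if2 z.
have e2 : entire (fun w => f w ^+ 2) by under eq_fun do rewrite expr2; exact: entireM.
have i2 : aintegrable (fun w => f w ^+ 2).
  apply: (@cintegrable_le _ _ R leb2 setT _ (fun p => normc (f (ofR2 p)) ^+ 2)) => //.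
    exact: (measurable_cfunX 2 mf).
  by move=> p _ /=; rewrite normcX.
have [it _] := aint_translation z i2.
have [|iA _] := @mean_value (fun w => f w ^+ 2) z (fun=> 1) e2.
  by under eq_fun do rewrite mulr1.
have mT : measurable [set: RT * RT] by [].
have := cintegrable_normc mT iA.
under [X in _.-integrable _ X -> _]eq_fun do rewrite /= mulr1.
set a : R := normc (f z ^+ 2) => ia.
suff /eqP : a == 0 by move/eqP; rewrite /a normc_eq0 expf_eq0 /= => /eqP.
apply/negPn/negP => a0.
have {}a0 : 0 < a by rewrite lt_def a0 normc_ge0.
have fin : (\int[leb2]_(p in setT) a%:E < +oo)%E.
  have /integrableP[_] := ia.
  by under eq_integral do rewrite /= ger0_norm ?(ltW a0)//.
set I := (\int[leb2]_(p in setT) a%:E)%E in fin.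
have I0 : (0 <= I)%E by apply: integral_ge0 => p _; rewrite lee_fin ltW.
have IE : (fine I)%:E = I by rewrite fineK// ge0_fin_numE.
(* The Gaussian of parameter c has integral pi / c; this choice of c makes
   a * (pi / c) larger than the integral I of the constant a. *)
pose c := a * pi / (fine I + 1).
have I1 : 0 < fine I + 1 by rewrite ltr_wpDl// -lee_fin IE.
have c0 : 0 < c by rewrite /c divr_gt0// mulr_gt0// pi_gt0.
have : (a%:E * (pi / c)%:E <= I)%E.
  have := area_gauss_moment 0 c0; rewrite fact0 mulr1 expr1 => <-.
  have /integrableP[mg _] := integrable_gauss_moment 0 c0.
  rewrite -ge0_integralZl//.
  - apply: ge0_le_integral => //.
    + by move=> p _; rewrite -EFinM lee_fin !mulr_ge0 ?exprn_ge0 ?expR_ge0 ?(ltW a0)// normc_ge0.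
    + exact: emeasurable_funM.
    + move=> p _; rewrite double0 expr0 mul1r -EFinM lee_fin ler_piMr ?(ltW a0)//.
      by rewrite -expR0 ler_expR oppr_le0 mulr_ge0 ?(ltW c0)// sqr_ge0.
  - by move=> p _; rewrite lee_fin mulr_ge0 ?exprn_ge0 ?expR_ge0// normc_ge0.
  - by rewrite lee_fin ltW.
rewrite -IE -EFinM lee_fin.
have -> : a * (pi / c) = fine I + 1.
  by rewrite /c invf_div mulrA mulrCA divff ?mulr1// mulf_neq0 ?gt_eqF// pi_gt0.
by rewrite gerDl ler10.
Qed.

Lemma csumJ (a : nat -> C) : cvgn (series (fun n => complex.Im (a n) : R)) ->
  csum (fun n => conjc (a n)) = conjc (csum a).
Proof.
move=> ca; rewrite /csum.
have -> : series (fun n => complex.Im (conjc (a n))) = - series (fun n => complex.Im (a n)).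
  apply/funext => N; transitivity (- series (fun n => complex.Im (a n)) N) => //; rewrite !seriesEord /= -sumrN.
  by apply: eq_bigr => i _; rewrite Im_conj.
rewrite limN//.
by apply: complex_ext => /=; [congr (limn (series _)); apply/funext => n; rewrite Re_conj|].
Qed.

(** This function represents the evaluation at z: the inner product of g with it
    is the Bargmann projection of g at z. *)
Definition kernel z : C -> C := fun w => expC (conjc z * w).

Lemma l2_conj_basis_u z : l2 (fun n => conjc (u n z)).
Proof.
rewrite /l2 /=.
have -> : (fun n => normc (conjc (u n z)) ^+ 2) = (fun n => (normc z ^+ 2) ^+ n / n`!%:R).
  by apply/funext => n; rewrite normcJ sqr_normc_basis_u.
exact: cvg_exp_series.
Qed.

(** The exponential series of conj(z) w, grouped in the basis. *)
Lemma kernelE z : kernel z = basis_series (fun n => conjc (u n z)).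
Proof.
apply/funext => w; rewrite /kernel (expC_series _).2 /basis_series; congr csum; apply/funext => n.
rewrite !basis_uE conjc_mul conjc_real exprMn conjcX.
rewrite mulrACA -rmorphM -invfM -expr2 sqrt_fact2 mulrC.
by congr (_ * _); rewrite fmorphV rmorph_nat.
Qed.

Lemma L2_kernel z : L2 (kernel z).
Proof. by rewrite kernelE; have [] := basis_series_le (@l2_conj_basis_u z). Qed.

Lemma conj_kernel z w : conjc (kernel z w) = expC (z * conjc w).
Proof. by rewrite /kernel conj_expC conjc_mul conjcK. Qed.

Lemma bargmann_proj_ip g z : bargmann_proj g z = ip_mu g (kernel z).
Proof.
by rewrite /bargmann_proj /ip_mu; congr int_mu; apply/funext => w; rewrite conj_kernel mulrC.
Qed.

(** The inner product of g with the kernel may be taken term by term. *)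
Lemma bargmann_projE g : L2 g -> bargmann_proj g = basis_series (coef g).
Proof.
move=> Lg; apply/funext => z; rewrite bargmann_proj_ip (ip_muC (L2_kernel z) Lg) kernelE.
have [_ cI ->] := ip_basis_series (@l2_conj_basis_u z) Lg.
rewrite -csumJ//; congr csum; apply/funext => n.
by rewrite conjc_mul conjcK mulrC /coef (ip_muC (L2_basis_u R n) Lg).
Qed.

(** Translate the integral by z. The kernel and the Gaussian density at z + v
    combine into e^(- conj(z) v) times the density at v, so the mean value
    property of f(z + v) e^(- conj(z) v) gives its value f(z) at v = 0. *)
Lemma reproducing f : F2 f -> bargmann_proj f = f.
Proof.
move=> [ef Lf]; apply/funext => z.
rewrite bargmann_proj_ip ip_muE.
have iE := L2_integrableM Lf (L2_kernel z).
have [it <-] := aint_translation z iE.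
pose g w := f w * expC (conjc z * (z - w)).
have eg : entire g.
  apply: entireM; first exact: ef.
  apply: (@entire_comp _ (@expC R) (fun w => conjc z * (z - w))); first exact: entire_expC.
  have -> : (fun w => conjc z * (z - w)) = (fun w => conjc z * z + (- conjc z) * w).
    by apply/funext => w; ring.
  exact: entire_affine.
pose H (r : R) : C := (pi^-1 * expR (- r ^+ 2))%:C.
have E v : f (z + v) * conjc (kernel z (z + v)) * (gauss (z + v))%:C = g (z + v) * H (normc v).
  rewrite conj_kernel /g /H -!mulrA; congr (_ * _).
  rewrite /gauss !rmorphM /= mulrCA [RHS]mulrCA; congr (_ * _).
  rewrite -!expC_real -!expCD; congr expC.
  rewrite !rmorphN /= -!mulcJ.
  have -> : conjc (z + v) = conjc z + conjc v by apply: complex_ext; rewrite !ReImE ?opprD.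
  by ring.
have [|i0] := @mean_value g z H eg.
  by move: it; congr aintegrable; apply/funext => v; rewrite E.
have -> : (fun w => f (z + w) * conjc (kernel z (z + w)) * (gauss (z + w))%:C) =
  (fun w => g (z + w) * H (normc w)) by apply/funext => v; rewrite E.
move=> ->.
have gz : g z = f z by rewrite /g subrr mulr0 expC0 mulr1.
rewrite gz.
transitivity (ip_mu (fun w => f z * u 0 w) (u 0)); last first.
  by rewrite ip_muZ ?ip_basis_u ?mulr1//; exact: L2_basis_u.
rewrite ip_muE; congr aint; apply/funext => w.
have -> : u 0 w = 1 by rewrite basis_uE fact0 sqrtr1 invr1 mul1r.
by rewrite conjc1 !mulr1.
Qed.

End ReproducingKernel.

(** * Toeplitz operators with radial symbols *)

Section RadialToeplitz.
Variable R : realType.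
Local Notation C := R[i].
Local Notation RT := (measurableTypeR R).
Local Notation leb := (@lebesgue_measure R).
Implicit Types (f g h : C -> C) (w z c : C) (x y : nat -> C) (phi : R -> C).
Local Notation u := (@basis_u R).

Let s n : C := ((Num.sqrt (n`!%:R : R))^-1)%:C.

Let conj_u n w : conjc (u n w) = s n * conjc w ^+ n.
Proof. by rewrite basis_uE conjc_mul conjc_real conjcX. Qed.

Let s_neq0 n : s n != 0.
Proof. by rewrite /s fmorphV invr_neq0// sqrt_factC_neq0. Qed.

(** Both coefficients are, up to the same constant, the n-th Taylor coefficient
    of f multiplied by a radial integral; the ratio of the two radial integrals
    is the diagonal matrix entry of the symbol. *)
Lemma coef_radial f phi n : F2 f -> L2 (fun w => radial phi w * f w) ->
  L2 (fun w => radial phi w * u n w) ->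
  coef (fun w => radial phi w * f w) n =
  coef f n * ip_mu (fun w => radial phi w * u n w) (u n).
Proof.
move=> [ef Lf] Lpf Lpu.
have mT : measurable [set: RT * RT] by [].
pose G (r : R) : C := (pi^-1 * expR (- r ^+ 2))%:C.
have [c cP] := circle_coef n ef.
have key psi : L2 (fun w => psi (normc w) * f w) -> L2 (fun w => psi (normc w) * u n w) ->
    coef (fun w => psi (normc w) * f w) n * s n =
    c * ip_mu (fun w => psi (normc w) * u n w) (u n).
  move=> L1 L2'.
  have i1 := L2_integrableM L1 (L2_basis_u R n).
  have i2 := L2_integrableM L2' (L2_basis_u R n).
  pose H r : C := s n * psi r * G r.
  have E1 : (fun w => psi (normc w) * f w * conjc (u n w) * (gauss w)%:C) =
      (fun w => f w * conjc w ^+ n * H (normc w)).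
    by apply/funext => w; rewrite conj_u /H /G /gauss; ring.
  rewrite E1 in i1.
  have [i3 E2] := aint_circle_coef ef cP i1.
  rewrite /coef ip_muE E1 -E2 ip_muE /aint mulrC.
  rewrite -(cintZ (s n) mT i3) -(cintZ c mT i2).
  congr cint; apply/funext => p.
  by rewrite conj_u basis_uE -/(s n) -mul_conjX /H /G /gauss; ring.
have e1 := key phi Lpf Lpu.
have one g : (fun w => (fun=> 1) (normc w) * g w) = g by apply/funext => w; rewrite mul1r.
have := key (fun=> 1); rewrite !one => /(_ Lf (L2_basis_u R n)).
rewrite ip_basis_u eqxx mulr1 => e2.
apply: (mulIf (s_neq0 n)); rewrite e1 -e2; ring.
Qed.

(** Integration in polar coordinates. *)
Lemma ip_radial_basis_u phi n : cmeasurable [set: RT] phi ->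
  L2 (fun w => radial phi w * u n w) ->
  ip_mu (fun w => radial phi w * u n w) (u n) = diag_coef phi n.
Proof.
move=> mphi Lpu.
have i := L2_integrableM Lpu (L2_basis_u R n).
pose H (r : R) : C := phi r * (n`!%:R^-1 * r ^+ n.*2 * (pi^-1 * expR (- r ^+ 2)))%:C.
have mH : cmeasurable [set: RT] H.
  apply: cmeasurableM => //; apply: cmeasurable_real.
  apply: measurable_funM; apply: measurable_funM => //.
  by apply: measurableT_comp => //; apply: measurable_funN; exact: measurable_funX.
have E : (fun w => radial phi w * u n w * conjc (u n w) * (gauss w)%:C) = (fun w => H (normc w)).
  apply/funext => w; rewrite -[radial phi w * _ * _]mulrA mulcJ sqr_normc_basis_u -exprM mul2n.
  rewrite /H /radial /gauss -mulrA -rmorphM; congr (_ * _%:C).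
  by rewrite [_ / _]mulrC.
rewrite ip_muE E; rewrite E in i.
have [iH ->] := area_radial mH i.
have mD : measurable (`]0%R, +oo[%classic : set RT) by [].
transitivity ((2 / n`!%:R : R)%:C *
  cint leb `]0, +oo[ (fun r => phi r * (r ^+ n.*2.+1 * expR (- r ^+ 2))%:C)); last first.
  rewrite /diag_coef /cint; congr (_ * (_ +i* _)); apply: eq_Rintegral => r _;
  by rewrite ?complexReM ?complexImM /= !mulr0 ?subr0 ?add0r ?addr0 // mulrC.
have pi0 : (pi : R) != 0 by rewrite gt_eqF// pi_gt0.
have E2 : (fun r => phi r * (r ^+ n.*2.+1 * expR (- r ^+ 2))%:C) =
    (fun r => (n`!%:R * pi)%:C * (H r * r%:C)).
  apply/funext => r; rewrite /H mulrCA -[RHS]mulrA; congr (_ * _).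
  rewrite -!rmorphM; congr (_%:C); rewrite exprSr.
  have f0 : n`!%:R != 0 :> R by rewrite pnatr_eq0 -lt0n fact_gt0.
  have H1 : n`!%:R * pi * ((n`!%:R)^-1 * pi^-1) = 1 :> R by rewrite -invfM divff// mulf_neq0.
  transitivity (n`!%:R * pi * ((n`!%:R)^-1 * pi^-1) * (r ^+ n.*2 * r * expR (- r ^+ 2))).
    by rewrite H1 mul1r.
  ring.
rewrite E2 cintZ// mulrA -rmorphM; congr (_%:C * _).
have f0 : n`!%:R != 0 :> R by rewrite pnatr_eq0 -lt0n fact_gt0.
by rewrite mulrA divfK// mulr2n mulrDl mul1r.
Qed.

End RadialToeplitz.

Section GammaSymbol.
Variable R : realType.
Local Notation C := R[i].
Local Notation RT := (measurableTypeR R).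
Implicit Types (f g h : C -> C) (w z c : C) (x y : nat -> C).
Local Notation u := (@basis_u R).
Variable k : C.
Local Notation gam := (gamma_symbol k).

Lemma cmeasurable_expC d (T : measurableType d) (D : set T) (f : T -> C) :
  cmeasurable D f -> cmeasurable D (fun t => expC (f t)).
Proof.
move=> [f1 f2]; split => /=; apply: measurable_funM.
- exact: measurableT_comp.
- by apply: measurableT_comp => //; exact: measurable_cosine.
- exact: measurableT_comp.
- by apply: measurableT_comp => //; exact: measurable_sine.
Qed.

Lemma cmeasurable_gamma : cmeasurable [set: RT] gam.
Proof.
apply: cmeasurableM; first exact: cmeasurable_cst.
apply: cmeasurable_expC; apply: cmeasurableM; first exact: cmeasurable_cst.
by apply: cmeasurable_real; exact: measurable_funX.
Qed.

Lemma measurable_radial_gamma : measurable_cfun (radial gam).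
Proof.
apply: cmeasurableM; first exact: cmeasurable_cst.
apply: cmeasurable_expC; apply: cmeasurableM; first exact: cmeasurable_cst.
by apply: cmeasurable_real; apply: measurable_funX; exact: measurable_normc_ofR2.
Qed.

(** For Re k > 1/2 the symbol leaves a Gaussian weight, and for Re k <= 1/2 a
    weight that is bounded below: this is where the value 1/2 comes from. *)
Lemma gamma_density f w : normc (radial gam w * f w) ^+ 2 * gauss w =
  (normc k ^+ 2 / pi) *
  (normc (f w) ^+ 2 * expR (- ((complex.Re k *+ 2 - 1) * normc w ^+ 2))).
Proof.
rewrite /radial /gamma_symbol !normcM normc_expC complexReM /= mulr0 subr0 complexReD complexReN /=.
rewrite /gauss !exprMn -expRM_natl.
have -> : expR (- ((complex.Re k *+ 2 - 1) * normc w ^+ 2)) =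
  expR (2%:R * ((1 - complex.Re k) * normc w ^+ 2)) * expR (- normc w ^+ 2).
  by rewrite -expRD; congr expR; ring.
ring.
Qed.

Lemma L2_gamma_basis_u n : 1 / 2 < complex.Re k -> L2 (fun w => radial gam w * u n w).
Proof.
move=> k2.
have c0 : 0 < complex.Re k *+ 2 - 1 by lra.
have := integrableZl measurableT (normc k ^+ 2 / pi * n`!%:R^-1) (integrable_gauss_moment n c0).
apply: (@L2_dominated _ _ (fun w => (normc k ^+ 2 / pi * n`!%:R^-1) *
   (normc w ^+ n.*2 * expR (- ((complex.Re k *+ 2 - 1) * normc w ^+ 2))))).
  by apply: cmeasurableM; [exact: measurable_radial_gamma|exact: measurable_basis_u].
move=> w; rewrite gamma_density sqr_normc_basis_u -exprM mul2n le_eqVlt; apply/orP; left; apply/eqP; ring.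
Qed.

Lemma entire_psum x N : entire (psum x N).
Proof.
elim: N => [|N ih]; first by rewrite psum0; exact: (@entire_cst R 0).
rewrite psumS; apply: entireD; first exact: ih.
by apply: entireM; [exact: entire_cst|exact: entire_basis_u].
Qed.

Lemma toeplitz_dom_psum x N : 1 / 2 < complex.Re k -> toeplitz_dom (radial gam) (psum x N).
Proof.
move=> k2; split; first by split; [exact: entire_psum|exact: L2_psum].
elim: N => [|N ih].
  by rewrite psum0; under eq_fun do rewrite mulr0; exact: L2_0.
have -> : (fun w => radial gam w * psum x N.+1 w) =
    (fun w => radial gam w * psum x N w + x N * (radial gam w * u N w)).
  by apply/funext => w; rewrite psumS; ring.
by apply: L2D => //; apply: L2Z; exact: L2_gamma_basis_u.
Qed.

(** The exponential in [gamma_density] is at least one, so a function in the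
    domain is square integrable for the area itself. *)
Lemma toeplitz_dom_eq0 f : k != 0 -> complex.Re k <= 1 / 2 ->
  toeplitz_dom (radial gam) f -> f = fun=> 0.
Proof.
move=> k0 k2 [[ef [mf _]] /L2P[_ ig]]; apply/funext.
apply: entire_sqintegrable_eq0 => //.
have mT : measurable [set: RT * RT] by [].
have a0 : 0 < normc k ^+ 2 / pi.
  by rewrite divr_gt0 ?pi_gt0// exprn_gt0// lt_def normc_eq0 k0 normc_ge0.
have := integrableZl mT (normc k ^+ 2 / pi)^-1 ig.
apply: le_integrable => //.
  by apply/measurable_EFinP; exact: (cmeasurable_normc_sqr mf).
move=> p _; rewrite -EFinM !abse_EFin lee_fin gamma_density mulKf ?gt_eqF//.
rewrite !ger0_norm ?mulr_ge0 ?exprn_ge0 ?normc_ge0 ?expR_ge0//.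
rewrite ler_peMr ?exprn_ge0 ?normc_ge0// -[X in X <= _]expR0 ler_expR oppr_ge0.
by rewrite mulr_le0_ge0 ?exprn_ge0 ?normc_ge0//; lra.
Qed.

Lemma coef_gamma f n : 1 / 2 < complex.Re k -> toeplitz_dom (radial gam) f ->
  coef (fun w => radial gam w * f w) n = diag_coef gam n * coef f n.
Proof.
move=> k2 [Ff Lgf]; have Lu := L2_gamma_basis_u n k2.
by rewrite coef_radial// ip_radial_basis_u 1?mulrC//; exact: cmeasurable_gamma.
Qed.

Lemma F2_basis_series_coef f : F2 f -> basis_series (coef f) = f.
Proof. by move=> Ff; rewrite -bargmann_projE ?reproducing//; case: Ff. Qed.

Lemma coef_toeplitz f : 1 / 2 < complex.Re k -> toeplitz_dom (radial gam) f ->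
  coef (toeplitz (radial gam) f) = diag_op gam (coef f).
Proof.
move=> k2 df; have [_ Lgf] := df.
rewrite /toeplitz bargmann_projE// coef_basis_series; last exact: l2_coef.
by apply/funext => n; rewrite coef_gamma.
Qed.

Lemma F2_toeplitz f : toeplitz_dom (radial gam) f -> F2 (toeplitz (radial gam) f).
Proof.
by move=> [_ Lgf]; rewrite /toeplitz bargmann_projE//; apply: F2_basis_series; exact: l2_coef.
Qed.

Lemma is_unitary_coef : Defs.is_unitary (@F2 R) (@ip_mu R) (@l2 R) (@ip_l2 R) (@coef R).
Proof.
split.
- by move=> f [_ Lf]; exact: l2_coef.
- move=> a f g [_ Lf] [_ Lg]; apply/funext => n.
  transitivity (ip_mu (fun w => a * f w + g w) (u n)) => //.
  by rewrite ip_muD ?ip_muZ//; [exact: L2_basis_u|exact: L2Z|exact: L2_basis_u].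
- move=> f g Ff Fg; have [_ Lf] := Ff; have [_ Lg] := Fg.
  by rewrite -ip_basis_series_basis_series ?F2_basis_series_coef//; exact: l2_coef.
- by move=> x lx; exists (basis_series x); [exact: F2_basis_series|exact: coef_basis_series].
Qed.

Lemma normc_coef_le f n : L2 f -> normc (coef f n) ^+ 2 <= sqnorm f.
Proof.
by move=> Lf; apply: le_trans (Cauchy_Schwarz Lf (L2_basis_u R n)) _; rewrite sqnorm_basis_u mulr1.
Qed.

(** The relation holds on the graph of the Toeplitz operator, and coefficients
    are continuous in norm. *)
Lemma coef_closure f g n : 1 / 2 < complex.Re k -> toeplitz_closure gam (f, g) ->
  coef g n = diag_coef gam n * coef f n.
Proof.
move=> k2 [/= [_ Lf] [_ Lg] H].
set d := diag_coef gam n; pose K := 2 * (1 + normc d ^+ 2).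
have K0 : 0 < K by rewrite mulr_gt0// ltr_wpDr// sqr_ge0.
apply/eqP; rewrite -subr_eq0 -normc_eq0; apply/negPn/negP => D0.
have {}D0 : 0 < normc (coef g n - d * coef f n) by rewrite lt_def D0 normc_ge0.
set D := normc _ in D0.
have [|q [[dq qE] q1 q2]] := H (D ^+ 2 / K); first by rewrite divr_gt0// exprn_gt0.
have [[_ Lq1] _] := dq; have [_ Lq2] := F2_toeplitz dq; rewrite -qE in Lq2.
have cq : coef q.2 n = d * coef q.1 n by rewrite qE coef_toeplitz.
have {}q1 : sqnorm (fun w => f w - q.1 w) < D ^+ 2 / K by rewrite -Re_ip_mu.
have {}q2 : sqnorm (fun w => g w - q.2 w) < D ^+ 2 / K by rewrite -Re_ip_mu.
have b1 := le_lt_trans (normc_coef_le n (L2B Lf Lq1)) q1.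
have b2 := le_lt_trans (normc_coef_le n (L2B Lg Lq2)) q2.
have E : coef g n - d * coef f n =
    coef (fun w => g w - q.2 w) n + (- d) * coef (fun w => f w - q.1 w) n.
  rewrite /coef !ip_muB//; [|exact: L2_basis_u|exact: L2_basis_u].
  by rewrite -!/(coef _ _) cq; ring.
have := sqr_normcD_le (coef (fun w => g w - q.2 w) n) ((- d) * coef (fun w => f w - q.1 w) n).
rewrite -E -/D; apply/negP; rewrite -ltNge normcM normcN exprMn.
have -> : D ^+ 2 = 2 * (D ^+ 2 / K + normc d ^+ 2 * (D ^+ 2 / K)).
  have -> : 2 * (D ^+ 2 / K + normc d ^+ 2 * (D ^+ 2 / K)) = D ^+ 2 * (K / K) by rewrite /K; ring.
  by rewrite divff ?mulr1// gt_eqF.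
rewrite ltr_pM2l// ltr_leD// ler_wpM2l ?sqr_ge0// ltW//.
Qed.

(** For the converse of [coef_closure], the partial sums of f lie in the domain
    of the Toeplitz operator, which maps them to those of g; both converge in
    norm. The domain itself may be smaller than the one of the diagonal
    operator. *)
Lemma closure_diag f g : 1 / 2 < complex.Re k -> F2 f -> F2 g ->
  toeplitz_closure gam (f, g) <-> diag_graph gam (coef f, coef g).
Proof.
move=> k2 Ff Fg; have [_ Lf] := Ff; have [_ Lg] := Fg.
split=> [H|[[/= lf _] gE]].
  have E : coef g = diag_op gam (coef f) by apply/funext => n; exact: coef_closure.
  by split=> //=; split; [exact: l2_coef|rewrite -E; exact: l2_coef].
have lg := l2_coef Lg.
split=> //= e e0.
have [N1 _ H1] := (cvgrPdist_lt _ _).1 (tail_cvg lf) _ e0.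
have [N2 _ H2] := (cvgrPdist_lt _ _).1 (tail_cvg lg) _ e0.
pose N := maxn N1 N2.
have Ff' := F2_basis_series_coef Ff; have Fg' := F2_basis_series_coef Fg.
have dp := toeplitz_dom_psum (coef f) N k2.
exists (psum (coef f) N, psum (coef g) N); split.
- split=> //=.
  have [Fp _] : toeplitz_dom (radial gam) (psum (coef g) N) by exact: toeplitz_dom_psum.
  rewrite -(F2_basis_series_coef Fp) -(F2_basis_series_coef (F2_toeplitz dp)); congr basis_series.
  rewrite coef_toeplitz//; apply/funext => n.
  rewrite /diag_op {1}/coef ip_psum_basis_u gE /diag_op.
  by rewrite [coef (psum _ _) _]ip_psum_basis_u; case: ifP => // _; rewrite mulr0.
- have [_] := basis_series_tail N lf; rewrite Ff' -Re_ip_mu => /le_lt_trans; apply.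
  have := H1 N (leq_maxl _ _); rewrite sub0r normrN; apply: le_lt_trans; exact: ler_norm.
- have [_] := basis_series_tail N lg; rewrite Fg' -Re_ip_mu => /le_lt_trans; apply.
  have := H2 N (leq_maxr _ _); rewrite sub0r normrN; apply: le_lt_trans; exact: ler_norm.
Qed.

Lemma basis_u0 w : u 0 w = 1.
Proof. by rewrite basis_uE fact0 sqrtr1 invr1 mul1r. Qed.

(** The constant function [u 0] separates the two cases: the domain is zero as
    soon as Re k <= 1/2. *)
Lemma classP_gamma : k != 0 -> classP gam <-> 1 / 2 < complex.Re k.
Proof.
move=> k0; split=> [[_ H]|k2].
  rewrite ltNge; apply/negP => k2.
  have := congr1 (fun f => f 0) (toeplitz_dom_eq0 k0 k2 (H 0)).
  by rewrite basis_u0 => /eqP; rewrite oner_eq0.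
split; first exact: measurable_radial_gamma.
by move=> n; split; [exact: F2_basis_u|exact: L2_gamma_basis_u].
Qed.

(** For Re k <= 1/2 the Toeplitz operator is defined at zero only, and so is its
    closure, whereas the diagonal operator is defined on the first basis
    vector. *)
Lemma equivalent_gamma : k != 0 ->
  unitarily_equivalent (@F2 R) (@ip_mu R) (toeplitz_closure gam)
    (@l2 R) (@ip_l2 R) (diag_graph gam) -> 1 / 2 < complex.Re k.
Proof.
move=> k0 [U [U1 _ U3 U4] UG]; rewrite ltNge; apply/negP => k2.
have L0 := L2_basis_u R 0.
have lx := l2_coef L0.
have Dx : diag_op gam (coef (u 0)) = coef (fun w => diag_coef gam 0 * u 0 w).
  apply/funext => n; rewrite /diag_op /coef ip_muZ//; last exact: L2_basis_u.
  by rewrite ip_basis_u; case: n => [|n] //=; rewrite !mulr0.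
have lDx : l2 (diag_op gam (coef (u 0))) by rewrite Dx; apply: l2_coef; exact: L2Z.
have [f Ff fE] := U4 _ lx.
have [g Fg gE] := U4 _ lDx.
have [_ _ H] : toeplitz_closure gam (f, g) by apply/(UG _ _ Ff Fg); rewrite fE gE; split.
have [q [[dq _] + _]] := H 1 ltr01.
rewrite (toeplitz_dom_eq0 k0 k2 dq).
have -> : (f, g).1 - (fun=> 0) = f by apply/funext => w; exact: subr0.
rewrite -U3// fE -ip_basis_series_basis_series// F2_basis_series_coef; last exact: F2_basis_u.
by rewrite Re_ip_mu sqnorm_basis_u ltxx.
Qed.

End GammaSymbol.

Theorem propositionV2 (R : realType) (k : complex R)
    (hk : 0 < complex.Re k) :
  (classP (gamma_symbol k) <-> 1 / 2 < complex.Re k) /\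
  (unitarily_equivalent
     (@F2 R) (@ip_mu R) (toeplitz_closure (gamma_symbol k))
     (@l2 R) (@ip_l2 R) (diag_graph (gamma_symbol k))
   <-> 1 / 2 < complex.Re k).
Proof.
have k0 : k != 0 by apply: contraTneq hk => ->; rewrite ltxx.
split; first exact: classP_gamma.
split=> [|k2]; first exact: equivalent_gamma.
exists (@coef R); first exact: is_unitary_coef.
by move=> f g Ff Fg; exact: closure_diag.
Qed.
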